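(* Let $\mathbb{F}_q$ be a finite field of characteristic not equal to $2$, let $V(\mathbb{F}_q)=\mathbb{F}_q^2\otimes\mathrm{Sym}^2(\mathbb{F}_q^3)$ be the space of pairs of ternary quadratic forms, and let $\Psi_q\colon V(\mathbb{F}_q)\to\{0,1\}$ be the characteristic function of those $x\in V(\mathbb{F}_q)$ which are singular. Then $$\widehat{\Psi_q}(x)=\begin{cases} q^{-1}+2q^{-2}-q^{-3}-2q^{-4}-q^{-5}+2q^{-6}+q^{-7}-q^{-8} & x\in\mathcal{O}_0,\\ q^{-3}-q^{-4}-2q^{-5}+2q^{-6}+q^{-7}-q^{-8} & x\in\mathcal{O}_{D1^2},\\ 2q^{-4}-5q^{-5}+3q^{-6}+q^{-7}-q^{-8} & x\in\mathcal{O}_{D11},\\ q^{-4}-3q^{-5}+2q^{-6}+q^{-7}-q^{-8} & x\in\mathcal{O}_{Cs},\\ -q^{-5}+q^{-6}+q^{-7}-q^{-8} & x\in\mathcal{O}_{D2}\cup\mathcal{O}_{Dns}\cup\mathcal{O}_{Cns}\cup\mathcal{O}_{B11}\cup\mathcal{O}_{B2},\\ -q^{-6}+2q^{-7}-q^{-8} & x\in\mathcal{O}_{1^21^2},\\ q^{-6}-q^{-8} & x\in\mathcal{O}_{2^2},\\ q^{-7}-q^{-8} & x\in\mathcal{O}_{1^4}\cup\mathcal{O}_{1^31}\cup\mathcal{O}_{1^211}\cup\mathcal{O}_{1^22},\\ -q^{-8} & x\in\mathcal{O}_{1111}\cup\mathcal{O}_{112}\cup\mathcal{O}_{22}\cup\mathcal{O}_{13}\cup\mathcal{O}_{4}.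 \end{cases}$$
   Context: $p=\mathrm{char}(\mathbb{F}_q)\ne 2$. Elements of $V(\mathbb{F}_q)$ are pairs $x=(A,B)$ of ternary quadratic forms in variables $u,v,w$ over $\mathbb{F}_q$, also regarded as pairs of symmetric $3\times3$ matrices. The group $G=\mathrm{GL}_2(\mathbb{F}_q)\times\mathrm{GL}_3(\mathbb{F}_q)$ acts by $\left(\begin{bmatrix}\alpha&\beta\\ \gamma&\delta\end{bmatrix},g_2\right)\circ(A,B)=(\alpha g_2Ag_2^T+\beta g_2Bg_2^T,\ \gamma g_2Ag_2^T+\delta g_2Bg_2^T)$. The cubic resolvent of $x$ is the binary cubic form $r_x(u,v)=-4\det(Au+Bv)$; $\mathrm{Disc}(x)$ is the discriminant of the binary cubic form $r_x$ (the discriminant of $au^3+bu^2v+cuv^2+dv^3$ is $b^2c^2+18abcd-4ac^3-4b^3d-27a^2d^2$), and $x$ is singular if $\mathrm{Disc}(x)=0$. Bilinear form: for ternary forms $A=au^2+buv+cuw+dv^2+evw+fw^2$ and $A'$ (with coefficients $a',\dots,f'$), put $[A,A']'=aa'+bb'/2+cc'/2+dd'+ee'/2+ff'$, and $[(A,B),(A',B')]=[A,A']'+[B,B']'$. For $\Phi\colon V(\mathbb{F}_q)\to\mathbb{C}$, $$\widehat\Phi(y)=q^{-12}\sum_{x\in V(\mathbb{F}_q)}\Phi(x)\exp\left(2\pi\sqrt{-1}\cdot\mathrm{Tr}_{\mathbb{F}_q/\mathbb{F}_p}([x,y])/p\right).$$ The sets $\mathcal{O}_\bullet$ are the $G$-orbits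 in $V(\mathbb{F}_q)$ of the following representatives, where $l\in\mathbb{F}_q^\times$ is a non-square: $\mathcal{O}_0\ni(0,0)$; $\mathcal{O}_{D1^2}\ni(0,w^2)$; $\mathcal{O}_{D11}\ni(0,vw)$; $\mathcal{O}_{D2}\ni(0,v^2-lw^2)$; $\mathcal{O}_{Dns}\ni(0,u^2-vw)$; $\mathcal{O}_{Cs}\ni(w^2,vw)$; $\mathcal{O}_{Cns}\ni(vw,uw)$; $\mathcal{O}_{B11}\ni(w^2,v^2)$; $\mathcal{O}_{B2}\ni(vw,v^2+lw^2)$; $\mathcal{O}_{1^4}\ni(w^2,uw+v^2)$; $\mathcal{O}_{1^31}\ni(vw,uw+v^2)$; $\mathcal{O}_{1^21^2}\ni(w^2,u^2-v^2)$; $\mathcal{O}_{2^2}\ni(w^2,u^2-lv^2)$; $\mathcal{O}_{1^211}\ni(v^2-w^2,uw)$; $\mathcal{O}_{1^22}\ni(v^2-lw^2,uw)$; $\mathcal{O}_{1111}\ni(uw-vw,uv-vw)$; $\mathcal{O}_{112}\ni(vw,u^2-v^2-lw^2)$; $\mathcal{O}_{22}\ni(vw,u^2-lv^2-lw^2)$; $\mathcal{O}_{13}\ni(uw-v^2,B_3)$; $\mathcal{O}_4\ni(uw-v^2,B_4)$. Here $B_3=uv+a_3v^2+b_3vw+c_3w^2$ and $B_4=u^2+a_4uv+b_4v^2+c_4vw+d_4w^2$, where $X^3+a_3X^2+b_3X+c_3$ and $X^4+a_4X^3+b_4X^2+c_4X+d_4$ are irreducible over $\mathbb{F}_q$. These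 twenty orbits are distinct and exhaust $V(\mathbb{F}_q)$. *)

(* Defs.v *)
From HB Require Import structures.
From mathcomp Require Import all_boot all_order all_algebra all_fingroup all_field.
From mathcomp Require Import reals sequences exp trigo.
From mathcomp Require Import complex.
Set Implicit Arguments.
Unset Strict Implicit.
Unset Printing Implicit Defensive.
Import Order.TTheory GRing.Theory Num.Theory.
Local Open Scope ring_scope.
Local Open Scope complex_scope.

(* The ternary form a u^2 + b uv + c uw + d v^2 + e vw + f w^2 is encoded by the
   row of its coefficients (a, b, c, d, e, f). *)
Notation V F := ('rV[F]_6 * 'rV[F]_6)%type.

Section Forms.
Variable F : finFieldType.

Definition uu : 'rV[F]_6 := delta_mx 0 0.
Definition uv : 'rV[F]_6 := delta_mx 0 1.
Definition uw : 'rV[F]_6 := delta_mx 0 2.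
Definition vv : 'rV[F]_6 := delta_mx 0 3.
Definition vw : 'rV[F]_6 := delta_mx 0 4.
Definition ww : 'rV[F]_6 := delta_mx 0 5.

Definition symmx (A : 'rV[F]_6) : 'M[F]_3 :=
  \matrix_(i, j)
    (nth [::] [:: [:: A 0 0;       A 0 1 / 2%:R; A 0 2 / 2%:R];
                  [:: A 0 1 / 2%:R; A 0 3;       A 0 4 / 2%:R];
                  [:: A 0 2 / 2%:R; A 0 4 / 2%:R; A 0 5]] i)`_j.

(* The form t |-> t M t^T, t = (u, v, w); inverse to symmx on symmetric
   matrices when the characteristic is not 2. *)
Definition form_of_mx (M : 'M[F]_3) : 'rV[F]_6 :=
  \row_k [:: M 0 0; M 0 1 + M 1 0; M 0 2 + M 2 0;
             M 1 1; M 1 2 + M 2 1; M 2 2]`_k.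

Definition act3 (g2 : {'GL_3[F]}) (A : 'rV[F]_6) : 'rV[F]_6 :=
  form_of_mx (GLval g2 *m symmx A *m (GLval g2)^T).

Definition Gact (g : {'GL_2[F]} * {'GL_3[F]}) (x : V F) : V F :=
  let g1 : 'M[F]_2 := GLval g.1 in
  let A := act3 g.2 x.1 in
  let B := act3 g.2 x.2 in
  (g1 0 0 *: A + g1 0 1 *: B, g1 1 0 *: A + g1 1 1 *: B).

Definition Gorbit (x : V F) : {set V F} :=
  [set Gact g x | g in [set: {'GL_2[F]} * {'GL_3[F]}]].

(* A binary form in u, v is a polynomial in {poly {poly F}} with u := 'X and
   v := 'X%:P, so that r`_i`_j is the coefficient of u^i v^j. *)
Definition resolvent (x : V F) : {poly {poly F}} :=
  - 4%:R * \det ('X *: map_mx (fun c : F => c%:P%:P) (symmx x.1)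
                 + 'X%:P *: map_mx (fun c : F => c%:P%:P) (symmx x.2)).

Definition bcubic_disc (r : {poly {poly F}}) : F :=
  let a := r`_3`_0 in let b := r`_2`_1 in
  let c := r`_1`_2 in let d := r`_0`_3 in
  b ^+ 2 * c ^+ 2 + 18%:R * a * b * c * d - 4%:R * a * c ^+ 3
  - 4%:R * b ^+ 3 * d - 27%:R * a ^+ 2 * d ^+ 2.

Definition Disc (x : V F) : F := bcubic_disc (resolvent x).

Definition singular (x : V F) : bool := Disc x == 0.

Definition form_pairing (A A' : 'rV[F]_6) : F :=
  A 0 0 * A' 0 0 + A 0 1 * A' 0 1 / 2%:R + A 0 2 * A' 0 2 / 2%:R
  + A 0 3 * A' 0 3 + A 0 4 * A' 0 4 / 2%:R + A 0 5 * A' 0 5.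

Definition pairing (x y : V F) : F :=
  form_pairing x.1 y.1 + form_pairing x.2 y.2.

Definition O_0 : {set V F} := Gorbit (0, 0).
Definition O_D1sq : {set V F} := Gorbit (0, ww).
Definition O_D11 : {set V F} := Gorbit (0, vw).
Definition O_D2 (l : F) : {set V F} := Gorbit (0, vv - l *: ww).
Definition O_Dns : {set V F} := Gorbit (0, uu - vw).
Definition O_Cs : {set V F} := Gorbit (ww, vw).
Definition O_Cns : {set V F} := Gorbit (vw, uw).
Definition O_B11 : {set V F} := Gorbit (ww, vv).
Definition O_B2 (l : F) : {set V F} := Gorbit (vw, vv + l *: ww).
Definition O_1p4 : {set V F} := Gorbit (ww, uw + vv).
Definition O_1p3_1 : {set V F} := Gorbit (vw, uw + vv).
Definition O_1sq_1sq : {set V F} := Gorbit (ww, uu - vv).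
Definition O_2sq (l : F) : {set V F} := Gorbit (ww, uu - l *: vv).
Definition O_1sq_11 : {set V F} := Gorbit (vv - ww, uw).
Definition O_1sq_2 (l : F) : {set V F} := Gorbit (vv - l *: ww, uw).
Definition O_1111 : {set V F} := Gorbit (uw - vw, uv - vw).
Definition O_112 (l : F) : {set V F} := Gorbit (vw, uu - vv - l *: ww).
Definition O_22 (l : F) : {set V F} := Gorbit (vw, uu - l *: vv - l *: ww).
Definition O_13 (a3 b3 c3 : F) : {set V F} :=
  Gorbit (uw - vv, uv + a3 *: vv + b3 *: vw + c3 *: ww).
Definition O_4 (a4 b4 c4 d4 : F) : {set V F} :=
  Gorbit (uw - vv, uu + a4 *: uv + b4 *: vv + c4 *: vw + d4 *: ww).

End Forms.

Section Fourier.
Variables (R : realType) (F : finFieldType) (p : nat) (charFp : p \in [pchar F]).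

(* pPrimeCharType charFp is F viewed as a field extension of 'F_p. The trace of
   'Gal(F / 'F_p) takes its values in the prime subfield 1%AS of F; Tr is its
   preimage under the embedding of 'F_p. *)
Definition Tr (x : F) : 'F_p :=
  odflt 0 [pick k : 'F_p |
    k%:A == galTrace 1%AS {: pPrimeCharType charFp} (x : pPrimeCharType charFp)].

Lemma TrE (x : F) :
  (Tr x)%:A = galTrace 1%AS {: pPrimeCharType charFp} (x : pPrimeCharType charFp).
Proof.
rewrite /Tr; case: pickP => [k /eqP // | noK].
have /vlineP[k Dk] :
    galTrace 1%AS {: pPrimeCharType charFp} (x : pPrimeCharType charFp) \in 1%VS.
  by apply: mem_galTrace (memvf _); apply: finField_galois; apply: sub1v.
by move: (noK k); rewrite Dk eqxx.
Qed.

Definition cexp (z : R[i]) : R[i] :=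
  (expR (complex.Re z))%:C * (cos (complex.Im z) +i* sin (complex.Im z)).

(* The integer lift of an element of 'F_p does not matter, by periodicity. *)
Definition fourier (Phi : V F -> R[i]) (y : V F) : R[i] :=
  (#|F|%:R) ^- 12 *
  \sum_(x : V F)
    Phi x * cexp (2%:R * (pi : R)%:C * 'i%C * (val (Tr (pairing x y)))%:R / p%:R).

Definition Psi (x : V F) : R[i] := (singular x)%:R.

End Fourier.

(* Main.v *)
Require Import Defs.
From HB Require Import structures.
From mathcomp Require Import all_boot all_order all_algebra all_fingroup all_field.
From mathcomp Require Import reals exp trigo.
From mathcomp Require Import complex.
From mathcomp Require Import ring.
Import Order.TTheory GRing.Theory Num.Theory.
Set Implicit Arguments.
Unset Strict Implicit.
Unset Printing Implicit Defensive.
Local Open Scope ring_scope.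

(** The Fourier transform of the singular set is computed from an identity
    between counting functions, each of which has an easy transform.

    Write x = (A, B), q for the cardinality of F, and r for the binary cubic
    r(s, t) = det (s A + t B).  A binary cubic that is not identically zero has
    discriminant 0 exactly when it has one multiple root, and this root is
    rational because F is perfect; the zero cubic has all q + 1 points of the
    projective line as multiple roots.  Hence
<<
      [Disc x = 0]  =  #(rational multiple roots of r)  -  q [r = 0]
>>
    ([sing_dbl_count]), and the two terms are transformed separately.

    Multiple roots.  Put a root at the member C of the pencil, the other member
    being B: the condition is det C = 0 and <adj C, B> = 0.  For fixed C it is
    linear in B, so the sum over B is supported on the multiples of adj C, which
    has rank at most one when det C = 0.  What remains is a sum over singular
    forms C, which inclusion-exclusion turns into sums over forms with a given
    kernel vector and over forms c p^2.  The result ([dbl_hat_rank_le1],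
    [dbl_hat_rank_gt1]) is, with Y2 dual to B and Y1 dual to C,
<<
      [rank Y2 <= 1] (q^8 #{lines p : p | Y1, Y2 a multiple of p^2}
                      + q^6 (1 - #{common zeros of Y1 and Y2}))
>>
    where everything is counted in the projective plane.

    Totally singular pencils.  If r = 0 and x is not 0, then x has exactly one
    common kernel line or exactly one common linear factor up to scalars
    ([all_singular_dichotomy]).  So if K and J are the numbers of common kernel
    points and of common linear factors, (1 - K)(1 - J) vanishes and
    [r = 0] = K + J - K J.  The transforms of K and J are q^6 J and q^6 K, and
    for nonzero x the product K J counts flags: points r on lines p such that both
    forms are p times a linear form vanishing at r.  This is again a sum of
    indicators of subspaces ([hat2_all_singular]).

    Together this expresses the transform at y through a few incidence counts
    of y ([sing_hatE]).  The transform is constant on orbits, because the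
    singular set is stable under the group and transposition is adjoint to the
    action ([fourier_orbit]); so it is enough to evaluate the counts at the
    representatives.  Most of them have no common linear factor, and only the
    common zeros and the members of rank one have to be found
    ([sing_hat_nodiv]).

    Counts run over nonzero vectors and are therefore q - 1 times the projective
    ones; this is where the factors q - 1 come from.  Points and lines of the
    plane are both given by vectors in F^3. *)

(** * Binary cubics with a multiple root *)

Section BinaryCubic.
Variable F : finFieldType.
Hypothesis nz2 : 2%:R != 0 :> F.

Definition cubic_disc (a b c d : F) := b ^+ 2 * c ^+ 2 + 18%:R * a * b * c * d
  - 4%:R * a * c ^+ 3 - 4%:R * b ^+ 3 * d - 27%:R * a ^+ 2 * d ^+ 2.

(** The polynomial g = a + b t + c t^2 + d t^3 and its derivative vanish at t; for
    the binary cubic this is a multiple root at (1, t). *)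
Definition dblroot (a b c d t : F) :=
  (a + t * b + t ^+ 2 * c + t ^+ 3 * d == 0) && (b + 2%:R * t * c + 3%:R * t ^+ 2 * d == 0).

Lemma dblrootP a b c d t : reflect
  (a = c * t ^+ 2 + 2%:R * d * t ^+ 3 /\ b = - (2%:R * t * c + 3%:R * t ^+ 2 * d))
  (dblroot a b c d t).
Proof.
apply: (iffP andP) => [[/eqP h1 /eqP h2]|[-> ->]]; last by split; apply/eqP; ring.
have e : b = - (2%:R * t * c + 3%:R * t ^+ 2 * d).
  by apply/eqP; rewrite -subr_eq0; apply/eqP; rewrite -[RHS]h2; ring.
by split=> //; apply/eqP; rewrite -subr_eq0; apply/eqP; rewrite -[RHS]h1 e; ring.
Qed.

Lemma dblroot_disc a b c d t : dblroot a b c d t -> cubic_disc a b c d = 0.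
Proof. by move=> /dblrootP[-> ->]; rewrite /cubic_disc; ring. Qed.

(** A cubic cannot have two double roots: the values of g and g' at t', where g
    is divisible by (X - t)^2, force first d = 0 and then c = 0. *)
Lemma dblroot_uniq a b c d t t' :
  dblroot a b c d t -> dblroot a b c d t' -> t != t' -> c = 0 /\ d = 0.
Proof.
move=> /dblrootP[-> ->] /andP[/eqP h1 /eqP h2] tt'.
have s0 : t' - t != 0 by rewrite subr_eq0 eq_sym.
have d0 : d = 0.
  apply: (mulfI (expf_neq0 3 s0)); rewrite mulr0.
  transitivity ((t' - t) * 0 - 2%:R * 0 : F); last by ring.
  by rewrite -{1}h2 -h1; ring.
split=> //; apply: (mulfI nz2); apply: (mulfI s0); rewrite !mulr0 -h2 d0; ring.
Qed.

(** In characteristic 3 a cubic d t^3 + a has zero discriminant, and its triple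
    root is rational because the Frobenius map is onto. *)
Lemma cube_root : 3%:R = 0 :> F -> forall x : F, exists y, y ^+ 3 = x.
Proof.
move=> c3; have p3 : 3%N \in [pchar F] by rewrite inE /= c3 eqxx.
have [g _ gK] := injF_bij (fmorph_inj (pFrobenius_aut p3)).
by move=> x; exists (g x); rewrite -(pFrobenius_autE p3) gK.
Qed.

(** F is perfect, so a multiple root is rational; here it is written down, by
    cases on whether the root is double or triple.  The hypothesis on c and d
    excludes the root at infinity. *)
Lemma disc_dblroot a b c d : (c != 0) || (d != 0) -> cubic_disc a b c d = 0 ->
  exists t, dblroot a b c d t.
Proof.
move=> cd D0; have [d0|d0] := eqVneq d 0.
  move: cd D0; rewrite d0 eqxx orbF => c0 D0.
  exists (- b / (2%:R * c)); apply/andP; split; apply/eqP; last by field; rewrite c0.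
  transitivity (- cubic_disc a b c 0 / (4%:R * c ^+ 3)); last by rewrite D0 oppr0 mul0r.
  rewrite /cubic_disc; field; rewrite c0 /=.
  by rewrite -[4%N]/(2 * 2)%N natrM mulf_neq0.
have [h0|h0] := eqVneq (c ^+ 2 - 3%:R * b * d) 0; last first.
  (* The root of the linear remainder of 9 d g by g'. *)
  exists ((9%:R * a * d - b * c) / (2%:R * (c ^+ 2 - 3%:R * b * d))).
  have n4 : 4%:R != 0 :> F by rewrite -[4%N]/(2 * 2)%N natrM mulf_neq0.
  have n8 : 8%:R != 0 :> F by rewrite -[8%N]/(2 * 4)%N natrM mulf_neq0.
  apply/andP; split; apply/eqP.
    transitivity (- cubic_disc a b c d * (2%:R * c ^+ 3 - 9%:R * b * c * d + 27%:R * a * d ^+ 2)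
       / (8%:R * (c ^+ 2 - 3%:R * b * d) ^+ 3)).
      by rewrite /cubic_disc; field; rewrite h0 ?nz2 ?n8.
    by rewrite D0 oppr0 !mul0r.
  transitivity (- 9%:R * d * cubic_disc a b c d / (4%:R * (c ^+ 2 - 3%:R * b * d) ^+ 2)).
    by rewrite /cubic_disc; field; rewrite h0 ?nz2 ?n4.
  by rewrite D0 mulr0 mul0r.
(* The syzygy E0^2 = 4 (c^2 - 3 b d)^3 - 27 d^2 disc of the covariants. *)
have E0 : 2%:R * c ^+ 3 - 9%:R * b * c * d + 27%:R * a * d ^+ 2 = 0.
  apply/eqP; rewrite -sqrf_eq0; apply/eqP.
  transitivity (4%:R * (c ^+ 2 - 3%:R * b * d) ^+ 3 - 27%:R * d ^+ 2 * cubic_disc a b c d).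
    by rewrite /cubic_disc; ring.
  by rewrite D0 h0; ring.
have [n3|n3] := eqVneq (3%:R : F) 0; last first.
  have n9 : 9%:R != 0 :> F by rewrite -[9%N]/(3 * 3)%N natrM mulf_neq0.
  have n27 : 27%:R != 0 :> F by rewrite -[27%N]/(3 * 9)%N natrM mulf_neq0.
  exists (- c / (3%:R * d)); apply/andP; split; apply/eqP.
    transitivity ((2%:R * c ^+ 3 - 9%:R * b * c * d + 27%:R * a * d ^+ 2)/ (27%:R * d ^+ 2)).
      by field; rewrite d0 ?n3 ?n9 ?n27.
    by rewrite E0 mul0r.
  transitivity (- (c ^+ 2 - 3%:R * b * d) / (3%:R * d)).
    by field; rewrite d0 n3.
  by rewrite h0 oppr0 mul0r.
have c0 : c = 0.
  by apply/eqP; rewrite -sqrf_eq0 -[c ^+ 2](subrK (3%:R * b * d)) h0 n3 !mul0r addr0.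
have b0 : b = 0.
  have n4 : 4%:R != 0 :> F by rewrite -[4%N]/(2 * 2)%N natrM mulf_neq0.
  have /eqP : 4%:R * d * b ^+ 3 = 0.
    transitivity (- cubic_disc a b c d - 3%:R * (9%:R * a ^+ 2 * d ^+ 2)).
      by rewrite /cubic_disc c0; ring.
    by rewrite D0 n3; ring.
  by rewrite !mulf_eq0 (negPf n4) (negPf d0) /= !orbb => /eqP.
have [y y3] := cube_root n3 (- a / d).
exists y; apply/andP; split; apply/eqP; last by rewrite c0 b0 n3; ring.
by rewrite c0 b0 y3; field.
Qed.

(** The summand for c = d = 0 is the multiple root at infinity, and the last
    term accounts for the q + 1 multiple roots of the zero cubic. *)
Lemma count_dblroot a b c d :
  (#|[pred t | dblroot a b c d t]| + ((c == 0%R) && (d == 0%R)) =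
   (cubic_disc a b c d == 0%R) + #|F| * [&& a == 0%R, b == 0%R, c == 0%R & d == 0%R])%N.
Proof.
have [/andP[/eqP c0 /eqP d0]|cd] := boolP ((c == 0) && (d == 0)).
  have -> : cubic_disc a b c d == 0 by rewrite c0 d0 /cubic_disc; apply/eqP; ring.
  rewrite !andbT addnC; congr (_ + _)%N.
  have [/andP[/eqP a0 /eqP b0]|ab] := boolP ((a == 0) && (b == 0)).
    rewrite a0 b0 c0 d0 muln1; apply: eq_card => t; rewrite inE.
    by apply/dblrootP; split; ring.
  rewrite muln0; apply: eq_card0 => t; rewrite inE.
  apply: contraNF ab => /dblrootP[-> ->]; rewrite c0 d0.
  by apply/andP; split; apply/eqP; ring.
rewrite !andbF muln0 !addn0.
have cd' : (c != 0) || (d != 0) by rewrite -negb_and.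
have [/eqP D0|D0] := boolP (cubic_disc a b c d == 0); last first.
  by apply: eq_card0 => t; rewrite inE; apply: contraNF D0 => /dblroot_disc ->.
have [t ht] := disc_dblroot cd' D0.
rewrite -[RHS](card1 t); apply: eq_card => t'; rewrite !inE.
apply/idP/eqP => [ht'|-> //]; apply/eqP; apply: contraNT cd => tt'.
by have [-> ->] := dblroot_uniq ht ht' (contra_neq (@esym _ _ _) tt'); rewrite eqxx.
Qed.
End BinaryCubic.

(** * Ternary quadratic forms in coordinates *)

Section Coordinates.
Variable F : finFieldType.
Implicit Types (A B C Y : 'rV[F]_6) (p a b r v w : 'rV[F]_3) (c t : F).

Definition row3 (x y z : F) : 'rV[F]_3 := \row_i [:: x; y; z]`_i.
Definition row6 (x0 x1 x2 x3 x4 x5 : F) : 'rV[F]_6 :=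
  \row_i [:: x0; x1; x2; x3; x4; x5]`_i.

Lemma row3P p r : p 0 0 = r 0 0 -> p 0 1 = r 0 1 -> p 0 2 = r 0 2 -> p = r.
Proof.
move=> e0 e1 e2; apply/rowP => i.
case: i => [[|[|[|//]]] Hi]; [have -> : Ordinal Hi = 0 by apply/val_inj
 |have -> : Ordinal Hi = 1 by apply/val_inj|have -> : Ordinal Hi = 2 by apply/val_inj] => //.
Qed.

Lemma row6P A B : A 0 0 = B 0 0 -> A 0 1 = B 0 1 -> A 0 2 = B 0 2 ->
  A 0 3 = B 0 3 -> A 0 4 = B 0 4 -> A 0 5 = B 0 5 -> A = B.
Proof.
move=> e0 e1 e2 e3 e4 e5; apply/rowP => i.
case: i => [[|[|[|[|[|[|//]]]]]] Hi]; [have -> : Ordinal Hi = 0 by apply/val_inj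
 |have -> : Ordinal Hi = 1 by apply/val_inj|have -> : Ordinal Hi = 2 by apply/val_inj
 |have -> : Ordinal Hi = 3 by apply/val_inj|have -> : Ordinal Hi = 4 by apply/val_inj
 |have -> : Ordinal Hi = 5 by apply/val_inj] => //.
Qed.

Lemma row3_0 x y z : row3 x y z 0 0 = x. Proof. by rewrite mxE. Qed.
Lemma row3_1 x y z : row3 x y z 0 1 = y. Proof. by rewrite mxE. Qed.
Lemma row3_2 x y z : row3 x y z 0 2 = z. Proof. by rewrite mxE. Qed.
Lemma row6_0 x0 x1 x2 x3 x4 x5 : row6 x0 x1 x2 x3 x4 x5 0 0 = x0. Proof. by rewrite mxE. Qed.
Lemma row6_1 x0 x1 x2 x3 x4 x5 : row6 x0 x1 x2 x3 x4 x5 0 1 = x1. Proof. by rewrite mxE. Qed.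
Lemma row6_2 x0 x1 x2 x3 x4 x5 : row6 x0 x1 x2 x3 x4 x5 0 2 = x2. Proof. by rewrite mxE. Qed.
Lemma row6_3 x0 x1 x2 x3 x4 x5 : row6 x0 x1 x2 x3 x4 x5 0 3 = x3. Proof. by rewrite mxE. Qed.
Lemma row6_4 x0 x1 x2 x3 x4 x5 : row6 x0 x1 x2 x3 x4 x5 0 4 = x4. Proof. by rewrite mxE. Qed.
Lemma row6_5 x0 x1 x2 x3 x4 x5 : row6 x0 x1 x2 x3 x4 x5 0 5 = x5. Proof. by rewrite mxE. Qed.
Lemma entD n (A B : 'rV[F]_n) i : (A + B) 0 i = A 0 i + B 0 i. Proof. by rewrite mxE. Qed.
Lemma entN n (A : 'rV[F]_n) i : (- A) 0 i = - A 0 i. Proof. by rewrite mxE. Qed.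
Lemma entZ n c (A : 'rV[F]_n) i : (c *: A) 0 i = c * A 0 i. Proof. by rewrite mxE. Qed.
Lemma ent0 n i : (0 : 'rV[F]_n) 0 i = 0. Proof. by rewrite mxE. Qed.

Definition dot p r := p 0 0 * r 0 0 + p 0 1 * r 0 1 + p 0 2 * r 0 2.
Definition cross p r := row3 (p 0 1 * r 0 2 - p 0 2 * r 0 1)
  (p 0 2 * r 0 0 - p 0 0 * r 0 2) (p 0 0 * r 0 1 - p 0 1 * r 0 0).
Definition qf A p := A 0 0 * p 0 0 ^+ 2 + A 0 1 * p 0 0 * p 0 1 + A 0 2 * p 0 0 * p 0 2
  + A 0 3 * p 0 1 ^+ 2 + A 0 4 * p 0 1 * p 0 2 + A 0 5 * p 0 2 ^+ 2.
(** Twice the symmetric matrix of A applied to p, so that its zeros are the kernel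
    of A; no division by 2 occurs. *)
Definition grad A p := row3
  (2%:R * A 0 0 * p 0 0 + A 0 1 * p 0 1 + A 0 2 * p 0 2)
  (A 0 1 * p 0 0 + 2%:R * A 0 3 * p 0 1 + A 0 4 * p 0 2)
  (A 0 2 * p 0 0 + A 0 4 * p 0 1 + 2%:R * A 0 5 * p 0 2).
(** The product of the linear forms with coefficient vectors p and a. *)
Definition lmul p a := row6 (p 0 0 * a 0 0) (p 0 0 * a 0 1 + p 0 1 * a 0 0)
  (p 0 0 * a 0 2 + p 0 2 * a 0 0) (p 0 1 * a 0 1) (p 0 1 * a 0 2 + p 0 2 * a 0 1)
  (p 0 2 * a 0 2).
Definition sqf c p := c *: lmul p p.
(** Four times the determinant of the symmetric matrix of A. *)
Definition det4 A := 4%:R * A 0 0 * A 0 3 * A 0 5 + A 0 1 * A 0 2 * A 0 4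
  - A 0 0 * A 0 4 ^+ 2 - A 0 3 * A 0 2 ^+ 2 - A 0 5 * A 0 1 ^+ 2.
(** Four times the adjugate matrix, encoded as a form in the dual variables: its
    pairing with B is the derivative of [det4] at A in the direction B. *)
Definition adjf A := row6 (4%:R * A 0 3 * A 0 5 - A 0 4 ^+ 2)
  (2%:R * A 0 2 * A 0 4 - 4%:R * A 0 1 * A 0 5)
  (2%:R * A 0 1 * A 0 4 - 4%:R * A 0 2 * A 0 3)
  (4%:R * A 0 0 * A 0 5 - A 0 2 ^+ 2)
  (2%:R * A 0 1 * A 0 2 - 4%:R * A 0 0 * A 0 4)
  (4%:R * A 0 0 * A 0 3 - A 0 1 ^+ 2).

Lemma cross_0 p r : cross p r 0 0 = p 0 1 * r 0 2 - p 0 2 * r 0 1.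
Proof. by rewrite mxE. Qed.
Lemma cross_1 p r : cross p r 0 1 = p 0 2 * r 0 0 - p 0 0 * r 0 2.
Proof. by rewrite mxE. Qed.
Lemma cross_2 p r : cross p r 0 2 = p 0 0 * r 0 1 - p 0 1 * r 0 0.
Proof. by rewrite mxE. Qed.
Lemma grad_0 A p : grad A p 0 0 = 2%:R * A 0 0 * p 0 0 + A 0 1 * p 0 1 + A 0 2 * p 0 2.
Proof. by rewrite mxE. Qed.
Lemma grad_1 A p : grad A p 0 1 = A 0 1 * p 0 0 + 2%:R * A 0 3 * p 0 1 + A 0 4 * p 0 2.
Proof. by rewrite mxE. Qed.
Lemma grad_2 A p : grad A p 0 2 = A 0 2 * p 0 0 + A 0 4 * p 0 1 + 2%:R * A 0 5 * p 0 2.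
Proof. by rewrite mxE. Qed.
Lemma lmul_0 p a : lmul p a 0 0 = p 0 0 * a 0 0.
Proof. by rewrite mxE. Qed.
Lemma lmul_1 p a : lmul p a 0 1 = p 0 0 * a 0 1 + p 0 1 * a 0 0.
Proof. by rewrite mxE. Qed.
Lemma lmul_2 p a : lmul p a 0 2 = p 0 0 * a 0 2 + p 0 2 * a 0 0.
Proof. by rewrite mxE. Qed.
Lemma lmul_3 p a : lmul p a 0 3 = p 0 1 * a 0 1.
Proof. by rewrite mxE. Qed.
Lemma lmul_4 p a : lmul p a 0 4 = p 0 1 * a 0 2 + p 0 2 * a 0 1.
Proof. by rewrite mxE. Qed.
Lemma lmul_5 p a : lmul p a 0 5 = p 0 2 * a 0 2.
Proof. by rewrite mxE. Qed.
Lemma adjf_0 A : adjf A 0 0 = 4%:R * A 0 3 * A 0 5 - A 0 4 ^+ 2.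
Proof. by rewrite mxE. Qed.
Lemma adjf_1 A : adjf A 0 1 = 2%:R * A 0 2 * A 0 4 - 4%:R * A 0 1 * A 0 5.
Proof. by rewrite mxE. Qed.
Lemma adjf_2 A : adjf A 0 2 = 2%:R * A 0 1 * A 0 4 - 4%:R * A 0 2 * A 0 3.
Proof. by rewrite mxE. Qed.
Lemma adjf_3 A : adjf A 0 3 = 4%:R * A 0 0 * A 0 5 - A 0 2 ^+ 2.
Proof. by rewrite mxE. Qed.
Lemma adjf_4 A : adjf A 0 4 = 2%:R * A 0 1 * A 0 2 - 4%:R * A 0 0 * A 0 4.
Proof. by rewrite mxE. Qed.
Lemma adjf_5 A : adjf A 0 5 = 4%:R * A 0 0 * A 0 3 - A 0 1 ^+ 2.
Proof. by rewrite mxE. Qed.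

End Coordinates.

(** Turns an equation between vectors, or forms, into scalar equations between
    coordinates. *)
Ltac coord := rewrite /det4 /qf /dot /sqf /form_pairing;
  rewrite ?(row3_0, row3_1, row3_2, row6_0, row6_1, row6_2, row6_3, row6_4, row6_5,
    cross_0, cross_1, cross_2, grad_0, grad_1, grad_2, lmul_0,
    lmul_1, lmul_2, lmul_3, lmul_4, lmul_5, adjf_0, adjf_1, adjf_2,
    adjf_3, adjf_4, adjf_5, entD, entN, entZ, ent0).
Ltac r3 := apply: row3P; coord.
Ltac r6 := apply: row6P; coord.

(** * Rank and kernel of a ternary form through its adjugate *)

Section TernaryForms.
Variable F : finFieldType.
Implicit Types (A B C Y : 'rV[F]_6) (p a b r v w : 'rV[F]_3) (c t : F).
Hypothesis nz2 : 2%:R != 0 :> F.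

Let nz4 : 4%:R != 0 :> F.
Proof. by rewrite -[4%N]/(2 * 2)%N natrM mulf_neq0. Qed.

(** The classical adj (adj C) = det C . C; with it, singular forms have adjugates
    of rank at most one. *)
Lemma adjfK C : adjf (adjf C) = (16%:R * det4 C) *: C.
Proof. r6; ring. Qed.

Lemma adjf_sqf c p : adjf (sqf c p) = 0.
Proof. r6; ring. Qed.

Lemma form_pairing_lmul p a Y : 2%:R * form_pairing (lmul p a) Y = dot a (grad Y p).
Proof. by coord; field. Qed.

(** If all 2 x 2 minors vanish, the form is proportional to the square of any row
    of its matrix with a nonzero diagonal entry; if the whole diagonal vanishes,
    so do the other entries. *)
Lemma adjf0_sqf C : adjf C = 0 -> exists c p, p != 0 /\ C = sqf c p.
Proof.
move=> /rowP h.
have := h 0; have := h 1; have := h 2; have := h 3; have := h 4; have := h 5.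
coord => h5 h4 h3 h2 h1 h0.
have [C0|C0] := eqVneq (C 0 0) 0; last first.
  (* The first row of the matrix of C, doubled; its square is 4 C 0 0 times C. *)
  exists (4%:R * C 0 0)^-1, (row3 (2%:R * C 0 0) (C 0 1) (C 0 2)); split.
    apply: contra_neq C0 => /rowP/(_ 0); coord => /eqP.
    by rewrite mulf_eq0 (negPf nz2) /= => /eqP.
  have D (x y : F) : 4%:R * C 0 0 * x - y = 0 -> x = y / (4%:R * C 0 0).
    by move=> /eqP; rewrite subr_eq0 => /eqP <-; rewrite mulrC mulKf // mulf_neq0.
  have e3 := D _ _ h5; have e5 := D _ _ h3.
  have e4 : C 0 4 = 2%:R * C 0 1 * C 0 2 / (4%:R * C 0 0).
    by apply: D; rewrite -[LHS]opprK opprB h4 oppr0.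
  r6; rewrite ?e3 ?e4 ?e5; field; rewrite ?C0 ?nz4 ?nz2 //.
have [C3|C3] := eqVneq (C 0 3) 0; last first.
  exists (4%:R * C 0 3)^-1, (row3 (C 0 1) (2%:R * C 0 3) (C 0 4)); split.
    apply: contra_neq C3 => /rowP/(_ 1); coord => /eqP.
    by rewrite mulf_eq0 (negPf nz2) /= => /eqP.
  have D (x y : F) : 4%:R * x * C 0 3 - y = 0 -> x = y / (4%:R * C 0 3).
    by move=> /eqP; rewrite subr_eq0 => /eqP <-; field; rewrite C3 ?nz4 ?nz2.
  have e5 : C 0 5 = C 0 4 ^+ 2 / (4%:R * C 0 3) by apply: D; rewrite -h0; ring.
  have e2 : C 0 2 = 2%:R * C 0 1 * C 0 4 / (4%:R * C 0 3).
    by apply: D; rewrite -[LHS]opprK opprB h2 oppr0.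
  have e1 : C 0 1 ^+ 2 = 0.
    by have := h5; rewrite C0 mulr0 mul0r sub0r => /eqP; rewrite oppr_eq0 => /eqP.
  have {}e1 : C 0 1 = 0 by apply/eqP; rewrite -sqrf_eq0 e1.
  r6; rewrite ?e2 ?e5 ?C0 ?e1; field; rewrite ?C3 ?nz4 ?nz2 //.
have sq0 x : - x ^+ 2 = 0 -> x = 0 :> F.
  by move/eqP; rewrite oppr_eq0 sqrf_eq0 => /eqP.
move: h5; rewrite C0 mulr0 mul0r sub0r => /sq0 e1.
move: h3; rewrite C0 mulr0 mul0r sub0r => /sq0 e2.
move: h0; rewrite C3 mulr0 mul0r sub0r => /sq0 e4.
exists (C 0 5), (row3 0 0 1); split.
  by apply/eqP => /rowP/(_ 2)/eqP; coord; rewrite oner_eq0.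
r6; rewrite ?C0 ?C3 ?e1 ?e2 ?e4; ring.
Qed.
Lemma form_pairingDl A B Y : form_pairing (A + B) Y = form_pairing A Y + form_pairing B Y.
Proof. by coord; field. Qed.
Lemma form_pairingC A Y : form_pairing A Y = form_pairing Y A.
Proof. by coord; field. Qed.
Lemma form_pairingZl c A Y : form_pairing (c *: A) Y = c * form_pairing A Y.
Proof. by coord; field. Qed.

Lemma form_pairing0l Y : form_pairing 0 Y = 0.
Proof. by have := form_pairingZl 0 0 Y; rewrite scale0r mul0r. Qed.

Lemma dotDl p r v : dot (p + r) v = dot p v + dot r v. Proof. coord; ring. Qed.
Lemma dotZl c p v : dot (c *: p) v = c * dot p v. Proof. coord; ring. Qed.
Lemma lmulZr p c a : lmul p (c *: a) = c *: lmul p a. Proof. r6; ring. Qed.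

(** The identity C . adj C = det C . 1 in the normalization of [grad] and [det4]. *)
Lemma grad_adjf C v : grad C (grad (adjf C) v) = (4%:R * det4 C) *: v.
Proof. r3; ring. Qed.

Lemma grad_lmul p a w : grad (lmul p a) w = dot a w *: p + dot p w *: a.
Proof. r3; ring. Qed.

Lemma grad_sqf c p w : grad (sqf c p) w = (2%:R * c * dot p w) *: p.
Proof. r3; ring. Qed.

Lemma dot_grad A v : dot v (grad A v) = 2%:R * qf A v.
Proof. coord; ring. Qed.

Lemma dot_gradC A v w : dot v (grad A w) = dot w (grad A v).
Proof. coord; ring. Qed.

Lemma form_pairing_sqf c p Y : form_pairing (sqf c p) Y = c * qf Y p.
Proof. by coord; field. Qed.

Lemma adjf_lmul p a : adjf (lmul p a) = sqf (- 1) (cross p a).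
Proof. r6; ring. Qed.

Lemma det4_lmul p a : det4 (lmul p a) = 0.
Proof. coord; ring. Qed.

Lemma qf_lmul p a v : qf (lmul p a) v = dot p v * dot a v.
Proof. coord; ring. Qed.

Lemma qf_sqf c p v : qf (sqf c p) v = c * dot p v ^+ 2.
Proof. coord; ring. Qed.

Lemma det4D A B t : det4 (A + t *: B) = det4 A + t * form_pairing (adjf A) B
  + t ^+ 2 * form_pairing (adjf B) A + t ^+ 3 * det4 B.
Proof. by coord; field. Qed.

Lemma pairing_adjfD A B t : form_pairing (adjf (A + t *: B)) B = form_pairing (adjf A) B
  + 2%:R * t * form_pairing (adjf B) A + 3%:R * t ^+ 2 * det4 B.
Proof. by coord; field. Qed.

(** The Gram determinant of three vectors is the determinant of the form times the
    square of their volume. *)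
Lemma gram A x y z :
  let m00 := 2%:R * qf A x in let m11 := 2%:R * qf A y in let m22 := 2%:R * qf A z in
  let m01 := dot x (grad A y) in let m02 := dot x (grad A z) in let m12 := dot y (grad A z) in
  m00 * m11 * m22 + 2%:R * m01 * m02 * m12 - m00 * m12 ^+ 2 - m11 * m02 ^+ 2 - m22 * m01 ^+ 2
   = 2%:R * dot (cross x y) z ^+ 2 * det4 A.
Proof. rewrite /=; coord; ring. Qed.

Lemma dotC p r : dot p r = dot r p. Proof. coord; ring. Qed.
Lemma dotDr p r v : dot p (r + v) = dot p r + dot p v. Proof. coord; ring. Qed.
Lemma dotZr p c v : dot p (c *: v) = c * dot p v. Proof. coord; ring. Qed.
Lemma dotr0 p : dot p 0 = 0. Proof. by coord; rewrite !mulr0 !addr0. Qed.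
Lemma dot_crossl p r : dot p (cross p r) = 0. Proof. coord; ring. Qed.
Lemma dot_crossr p r : dot r (cross p r) = 0. Proof. coord; ring. Qed.
Lemma crossZl c p : cross (c *: p) p = 0. Proof. r3; ring. Qed.

Lemma row3_neq0 p : p != 0 -> [|| p 0 0 != 0, p 0 1 != 0 | p 0 2 != 0].
Proof.
apply: contra_neqT; rewrite !negb_or !negbK => /and3P[/eqP e0 /eqP e1 /eqP e2].
by apply: row3P; rewrite ent0.
Qed.

Lemma dot_neq0 p : p != 0 -> exists v, dot p v = 1.
Proof.
move=> /row3_neq0/or3P[] h; [exists (row3 (p 0 0)^-1 0 0)|exists (row3 0 (p 0 1)^-1 0)|
  exists (row3 0 0 (p 0 2)^-1)]; by coord; field.
Qed.

Lemma cross0P p r : r != 0 -> cross p r = 0 -> exists t, p = t *: r.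
Proof.
move=> rN0 /rowP h; have := h 0; have := h 1; have := h 2; coord.
move=> /eqP; rewrite subr_eq0 => /eqP e2 /eqP; rewrite subr_eq0 => /eqP e1 /eqP.
rewrite subr_eq0 => /eqP e0.
case/row3_neq0/or3P: rN0 => hr.
- exists (p 0 0 / r 0 0); r3; apply: (mulIf hr); rewrite ?e1 -?e2; by field.
- exists (p 0 1 / r 0 1); r3; apply: (mulIf hr); rewrite ?e2 -?e0; by field.
- exists (p 0 2 / r 0 2); r3; apply: (mulIf hr); rewrite ?e0 -?e1; by field.
Qed.

Lemma sqf_eq0 c p : p != 0 -> sqf c p = 0 -> c = 0.
Proof.
move=> /dot_neq0[v pv] /(congr1 (fun A => qf A v)); rewrite qf_sqf pv expr1n mulr1 => ->.
by coord; ring.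
Qed.

Lemma sqf_prop c p d r : c != 0 -> p != 0 -> sqf c p = sqf d r -> exists t, p = t *: r.
Proof.
move=> c0 /dot_neq0[v pv] /(congr1 (fun A => grad A v)); rewrite !grad_sqf pv mulr1 => e.
exists ((2%:R * c)^-1 * (2%:R * d * dot r v)); rewrite -scalerA -e scalerA mulVf ?scale1r //.
by rewrite mulf_neq0.
Qed.

(** C has rank at most two, and the columns of adj C lie in its kernel; p is in
    the kernel, which determines the coefficients of C involving a variable whose
    coordinate in p is not zero. *)
Lemma ker_adjf C p : p != 0 -> grad C p = 0 -> exists c, adjf C = sqf c p.
Proof.
move=> p0 /rowP h; have := h 0; have := h 1; have := h 2; coord => h2 h1 h0.
have sing_hat (x y z k : F) : z != 0 -> x + y = 0 -> x = k * z -> k = - y / z.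
  by move=> zN /eqP; rewrite addr_eq0 => /eqP -> ->; field.
case/row3_neq0/or3P: p0 => hp.
- have e2 : C 0 2 = - (C 0 4 * p 0 1 + 2%:R * C 0 5 * p 0 2) / p 0 0.
    by apply: (sing_hat (C 0 2 * p 0 0)) => //; rewrite -h2; ring.
  have e1 : C 0 1 = - (2%:R * C 0 3 * p 0 1 + C 0 4 * p 0 2) / p 0 0.
    by apply: (sing_hat (C 0 1 * p 0 0)) => //; rewrite -h1; ring.
  have e0 : C 0 0 = - (C 0 1 * p 0 1 + C 0 2 * p 0 2) / (2%:R * p 0 0).
    by apply: (sing_hat (2%:R * C 0 0 * p 0 0)); rewrite ?mulf_neq0 // -?h0; ring.
  by exists (adjf C 0 0 / p 0 0 ^+ 2); r6; rewrite ?e0 ?e1 ?e2; field; rewrite ?hp ?nz2.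
- have e4 : C 0 4 = - (C 0 2 * p 0 0 + 2%:R * C 0 5 * p 0 2) / p 0 1.
    by apply: (sing_hat (C 0 4 * p 0 1)) => //; rewrite -h2; ring.
  have e1 : C 0 1 = - (2%:R * C 0 0 * p 0 0 + C 0 2 * p 0 2) / p 0 1.
    by apply: (sing_hat (C 0 1 * p 0 1)) => //; rewrite -h0; ring.
  have e3 : C 0 3 = - (C 0 1 * p 0 0 + C 0 4 * p 0 2) / (2%:R * p 0 1).
    by apply: (sing_hat (2%:R * C 0 3 * p 0 1)); rewrite ?mulf_neq0 // -?h1; ring.
  by exists (adjf C 0 3 / p 0 1 ^+ 2); r6; rewrite ?e3 ?e1 ?e4; field; rewrite ?hp ?nz2.
- have e4 : C 0 4 = - (C 0 1 * p 0 0 + 2%:R * C 0 3 * p 0 1) / p 0 2.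
    by apply: (sing_hat (C 0 4 * p 0 2)) => //; rewrite -h1; ring.
  have e2 : C 0 2 = - (2%:R * C 0 0 * p 0 0 + C 0 1 * p 0 1) / p 0 2.
    by apply: (sing_hat (C 0 2 * p 0 2)) => //; rewrite -h0; ring.
  have e5 : C 0 5 = - (C 0 2 * p 0 0 + C 0 4 * p 0 1) / (2%:R * p 0 2).
    by apply: (sing_hat (2%:R * C 0 5 * p 0 2)); rewrite ?mulf_neq0 // -?h2; ring.
  by exists (adjf C 0 5 / p 0 2 ^+ 2); r6; rewrite ?e5 ?e2 ?e4; field; rewrite ?hp ?nz2.
Qed.

Lemma ker_det4 C p : p != 0 -> grad C p = 0 -> det4 C = 0.
Proof.
move=> p0 h; have [c e] := ker_adjf p0 h.
have [v pv] := dot_neq0 p0.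
have /eqP := grad_adjf C v.
rewrite e grad_sqf pv mulr1.
have -> : grad C ((2%:R * c) *: p) = (2%:R * c) *: grad C p by r3; ring.
rewrite h scaler0 eq_sym scaler_eq0 !mulf_eq0 (negPf nz4) /=.
case/orP => [/eqP //|/eqP v0].
by have := oner_neq0 F; rewrite -pv v0 dotr0 eqxx.
Qed.

Lemma det4_adjf C : det4 C = 0 -> exists c p, p != 0 /\ adjf C = sqf c p.
Proof. by move=> d; apply: adjf0_sqf; rewrite // adjfK d mulr0 scale0r. Qed.

Lemma adjf_ker C c p : det4 C = 0 -> c != 0 -> p != 0 -> adjf C = sqf c p -> grad C p = 0.
Proof.
move=> d c0 p0 e; have [v pv] := dot_neq0 p0; have := grad_adjf C v.
rewrite d e grad_sqf pv !mulr0 mulr1 scale0r.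
have -> : grad C ((2%:R * c) *: p) = (2%:R * c) *: grad C p by r3; ring.
by move/eqP; rewrite scaler_eq0 !mulf_eq0 (negPf nz2) (negPf c0) /= => /eqP.
Qed.

Lemma ker_prop C c p v : c != 0 -> p != 0 -> adjf C = sqf c p -> grad C v = 0 ->
  exists t, v = t *: p.
Proof.
move=> c0 p0 e h; have [->|v0] := eqVneq v 0; first by exists 0; rewrite scale0r.
have [d e'] := ker_adjf v0 h.
have d0 : d != 0.
  apply: contra_neq c0 => d0; apply: (@sqf_eq0 c p) => //.
  by rewrite -e e' d0 /sqf scale0r.
by apply: (@sqf_prop d v c p) => //; rewrite -e -e'.
Qed.

(** With b . m = 1, expand A at v = (v - (b . v) m) + (b . v) m: the first summand is
    on the line b = 0, where A vanishes, and the rest is divisible by b . v. *)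
Lemma lmul_div A b : b != 0 -> (forall v, dot b v = 0 -> qf A v = 0) ->
  exists a, A = lmul b a.
Proof.
move=> /dot_neq0[m bm] h; exists (grad A m - qf A m *: b).
have E v : qf A v = qf (lmul b (grad A m - qf A m *: b)) v.
  have /h : dot b (v - dot b v *: m) = 0.
    by rewrite dotDr -scaleNr dotZr bm; ring.
  rewrite qf_lmul.
  have -> : qf A (v - dot b v *: m) = qf A v - dot b v * dot v (grad A m) + dot b v ^+ 2 * qf A m.
    by move: (dot b v) => t; coord; ring.
  have -> : dot (grad A m - qf A m *: b) v = dot v (grad A m) - qf A m * dot b v.
    by move: (qf A m) => t; coord; ring.
  by move=> e; apply/eqP; rewrite -subr_eq0; apply/eqP; rewrite -[RHS]e; ring.
move: (lmul _ _) E => B E.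
have e0 := E (row3 1 0 0); have e1 := E (row3 0 1 0); have e2 := E (row3 0 0 1).
have e01 := E (row3 1 1 0); have e02 := E (row3 1 0 1); have e12 := E (row3 0 1 1).
move: e0 e1 e2 e01 e02 e12; coord.
rewrite ?(expr1n, expr0n) /= ?(mulr1, mulr0, mul0r, addr0, add0r).
move=> e0 e1 e2; rewrite e0 e1 e2 => e3 e4 e5.
r6 => //.
- by move: e3 => /addIr/addrI.
- by move: e4 => /addIr/addrI.
- by move: e5 => /addIr/addrI.
Qed.

(** * Pencils all of whose members are singular *)

(** The four coefficients of det (s A + t B), up to the factor 4, vanish, so that
    the resolvent is 0. *)
Definition all_singular A B := [&& det4 A == 0, form_pairing (adjf A) B == 0,
  form_pairing (adjf B) A == 0 & det4 B == 0].

Lemma all_singularC A B : all_singular A B = all_singular B A.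
Proof. by rewrite /all_singular; do !case: (_ == _). Qed.

Definition common_ker A B v := (grad A v == 0) && (grad B v == 0).
Definition common_div A B p := exists a b, A = lmul p a /\ B = lmul p b.

Lemma common_ker_all_singular A B p : p != 0 -> common_ker A B p -> all_singular A B.
Proof.
move=> p0 /andP[/eqP hA /eqP hB].
have [c eA] := ker_adjf p0 hA; have [d eB] := ker_adjf p0 hB.
have qf0 C : grad C p = 0 -> qf C p = 0.
  by move=> h; apply: (mulfI nz2); rewrite -dot_grad h dotr0 mulr0.
by rewrite /all_singular (ker_det4 p0 hA) (ker_det4 p0 hB) eA eB
  !form_pairing_sqf // !qf0 // !mulr0 eqxx.
Qed.

Lemma common_div_all_singular A B p : common_div A B p -> all_singular A B.
Proof.
move=> [a [b [-> ->]]]; rewrite /all_singular !det4_lmul !adjf_lmul !form_pairing_sqf //.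
by rewrite !qf_lmul !dot_crossl !mul0r !mulr0 eqxx.
Qed.

Lemma crossC p r : cross p r = - cross r p. Proof. r3; ring. Qed.
Lemma dot_cross p r v : dot p (cross r v) = dot (cross p r) v. Proof. coord; ring. Qed.
Lemma cross_cross v p r : cross v (cross p r) = dot v r *: p - dot v p *: r.
Proof. r3; ring. Qed.
Lemma gradDl A B t v : grad (A + t *: B) v = grad A v + t *: grad B v.
Proof. r3; ring. Qed.
Lemma gradZr A t v : grad A (t *: v) = t *: grad A v.
Proof. r3; ring. Qed.
Lemma qfDl A B t v : qf (A + t *: B) v = qf A v + t * qf B v.
Proof. coord; ring. Qed.

Lemma orth_cross p r v : cross p r != 0 -> dot p v = 0 -> dot r v = 0 ->
  exists t, v = t *: cross p r.
Proof.
move=> pr hp hr; apply: cross0P => //.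
by rewrite cross_cross ![dot v _]dotC hp hr !scale0r subr0.
Qed.

(** On the line r = 0 the product vanishes, hence p does too. *)
Lemma factor_of_sqf c p a r : c != 0 -> p != 0 -> r != 0 ->
  sqf c p = lmul r a -> exists t, r = t *: p.
Proof.
move=> c0 p0 r0 e; apply: cross0P => //; rewrite crossC.
have [->|/dot_neq0[v pv]] := eqVneq (cross p r) 0; first by rewrite oppr0.
have /(congr1 (fun A => qf A (cross r v))) := e.
rewrite qf_sqf qf_lmul dot_crossl mul0r dot_cross pv expr1n mulr1 => h.
by rewrite h eqxx in c0.
Qed.

(** Two independent squares have one common kernel line, the intersection of
    the two lines, whereas two proportional squares have a single common factor. *)
Lemma sqf_squares_dichotomy c p d r : p != 0 -> r != 0 ->
  (sqf c p, sqf d r) != 0 ->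
  (exists2 P, P != 0 /\ common_ker (sqf c p) (sqf d r) P &
     forall v, common_ker (sqf c p) (sqf d r) v -> exists t, v = t *: P) \/
  (exists2 P, P != 0 /\ common_div (sqf c p) (sqf d r) P &
     forall v, v != 0 -> common_div (sqf c p) (sqf d r) v -> exists t, v = t *: P).
Proof.
move=> p0 r0.
have J al be l : l != 0 -> (sqf al l, sqf be l) != 0 ->
  exists2 P, P != 0 /\ common_div (sqf al l) (sqf be l) P &
     forall v, v != 0 -> common_div (sqf al l) (sqf be l) v -> exists t, v = t *: P.
  move=> l0 h; exists l.
    by split=> //; exists (al *: l), (be *: l); split; r6; ring.
  move=> v v0 [a [b [eA eB]]].
  have [al0|al0] := eqVneq al 0; last exact: factor_of_sqf eA.
  have [be0|be0] := eqVneq be 0; last exact: factor_of_sqf eB.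
  by move: h; rewrite al0 be0 /sqf !scale0r eqxx.
have [->|c0] := eqVneq c 0.
  have -> : sqf 0 p = sqf 0 r by rewrite /sqf !scale0r.
  by move=> h; right; apply: J.
have [->|d0] := eqVneq d 0.
  have -> : sqf 0 r = sqf 0 p by rewrite /sqf !scale0r.
  by move=> h; right; apply: J.
have [/cross0P h|pr] := eqVneq (cross p r) 0.
  have [t ->] := h r0.
  have -> : sqf c (t *: r) = sqf (c * t ^+ 2) r by r6; ring.
  by move=> h'; right; apply: J.
move=> _; left; exists (cross p r).
  by rewrite /common_ker !grad_sqf dot_crossl dot_crossr !mulr0 !scale0r eqxx.
move=> v /andP[]; rewrite !grad_sqf !scaler_eq0 (negPf p0) (negPf r0) !mulf_eq0.
rewrite (negPf nz2) (negPf c0) (negPf d0) /= !orbF => /eqP h1 /eqP h2.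
exact: orth_cross.
Qed.

(** Let P span the kernel of A.  The second coefficient of the resolvent says
    that B(P, P) = 0.  If P is not in the kernel of B, put b = B P.  For n on the
    line b = 0 and m off it, the Gram determinant on P, n, m of a member other than A
    is a nonzero multiple of its value at n.  So these members vanish on that line,
    hence A does too, and b is a common factor.  A second factor would meet b in a
    point of the common kernel, but the kernel of A is spanned by P. *)
Lemma dichotomy_rank2 A B : all_singular A B -> adjf A != 0 ->
  (exists2 P, P != 0 /\ common_ker A B P &
     forall v, common_ker A B v -> exists t, v = t *: P) \/
  (exists2 P, P != 0 /\ common_div A B P &
     forall v, v != 0 -> common_div A B v -> exists t, v = t *: P).
Proof.
case/and4P => /eqP dA /eqP hAB /eqP hBA /eqP dB adjA.
have [c [P [P0 eA]]] := det4_adjf dA.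
have c0 : c != 0 by apply: contraNneq adjA => c0; rewrite eA c0 /sqf scale0r.
have AP := adjf_ker dA c0 P0 eA.
have kA v : grad A v = 0 -> exists t, v = t *: P by apply: ker_prop eA.
have [BP|BP] := eqVneq (grad B P) 0.
  left; exists P; first by rewrite /common_ker AP BP eqxx.
  by move=> v /andP[/eqP/kA].
set b := grad B P in BP.
have qBP : qf B P = 0.
  by move: hAB; rewrite eA form_pairing_sqf // => /eqP; rewrite mulf_eq0 (negPf c0) => /eqP.
have [m bm] := dot_neq0 BP.
have key C t : t != 0 -> qf C P = 0 -> grad C P = t *: b -> det4 C = 0 ->
    forall n, dot b n = 0 -> qf C n = 0.
  move=> t0 qC gC dC n bn; have := gram C P n m.
  rewrite /= qC dC [dot P (grad C n)]dot_gradC [dot P (grad C m)]dot_gradC gC !dotZr.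
  rewrite ![dot _ b]dotC bn bm => h.
  apply: (mulfI nz2); apply: (mulfI (expf_neq0 2 t0)); rewrite !mulr0.
  by transitivity (- (2%:R * dot (cross P n) m ^+ 2 * 0)); [rewrite -h|]; ring.
have qB n : dot b n = 0 -> qf B n = 0.
  by apply: (key B 1); rewrite ?oner_neq0 ?scale1r.
have qA n : dot b n = 0 -> qf A n = 0.
  move=> bn; have := key (A + 1 *: B) 1; rewrite oner_neq0 => /(_ isT).
  rewrite !qfDl gradDl AP add0r qBP mulr0 addr0 => /(_ _ erefl).
  have -> : qf A P = 0 by apply: (mulfI nz2); rewrite -dot_grad AP dotr0 mulr0.
  move=> /(_ erefl); rewrite det4D // dA hAB hBA dB !mulr0 !addr0.
  by move=> /(_ erefl n bn); rewrite qfDl qB // mulr0 addr0.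
have [a ea] := lmul_div BP qA; have [a' ea'] := lmul_div BP qB.
right; exists b; first by split=> //; exists a, a'.
(* If v is a second factor, the intersection of the lines b and v is in the kernel of both forms. *)
move=> v v0 [a1 [a1' [e1 e1']]]; apply: cross0P => //; apply/eqP.
apply: contraT => w0; set w := cross v b in w0.
have kw C x y : C = lmul b x -> C = lmul v y -> grad C w = 0.
  move=> e e'; have : grad C w = dot x w *: b.
    by rewrite e grad_lmul dot_crossr scale0r addr0.
  rewrite {1}e' grad_lmul dot_crossl scale0r addr0 => h.
  rewrite e grad_lmul dot_crossr scale0r addr0.
  have [->|xw] := eqVneq (dot x w) 0; first by rewrite scale0r.
  case/negP: w0; rewrite /w.
  have -> : b = ((dot x w)^-1 * dot y w) *: v.
    by rewrite -scalerA h scalerA mulVf // scale1r.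
  by rewrite crossC crossZl oppr0.
have [t et] := kA _ (kw A a a1 ea e1).
have := kw B a' a1' ea' e1'; rewrite et gradZr -/b => /eqP.
rewrite scaler_eq0 (negPf BP) orbF => /eqP t0.
by move: w0; rewrite et t0 scale0r eqxx.
Qed.

(** Common linear factor and common kernel are the two classical reasons for a
    pencil of conics to be totally singular; the point is that one of the two
    occurs exactly once, up to scalars. *)
Lemma all_singular_dichotomy A B : all_singular A B -> (A, B) != 0 ->
  (exists2 P, P != 0 /\ common_ker A B P &
     forall v, common_ker A B v -> exists t, v = t *: P) \/
  (exists2 P, P != 0 /\ common_div A B P &
     forall v, v != 0 -> common_div A B v -> exists t, v = t *: P).
Proof.
move=> s AB0; have [aA|aA] := eqVneq (adjf A) 0; last exact: dichotomy_rank2.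
have [aB|aB] := eqVneq (adjf B) 0.
  have [[c [p [p0 eA]]] [d [r [r0 eB]]]] := (adjf0_sqf aA, adjf0_sqf aB).
  by move: AB0; rewrite eA eB; apply: sqf_squares_dichotomy.
have swap C v : common_div B C v <-> common_div C B v.
  by split=> -[a [b [? ?]]]; exists b, a.
have := s; rewrite all_singularC => /dichotomy_rank2 /(_ aB).
case=> -[P [P0 h1] h2]; [left|right]; exists P.
- by split=> //; rewrite /common_ker andbC.
- by move=> v; rewrite /common_ker andbC => /h2.
- by split=> //; apply/swap.
- by move=> v v0 /swap; apply: h2.
Qed.

(** * The resolvent and the group action *)

Definition pencil_disc A B :=
  cubic_disc (det4 A) (form_pairing (adjf A) B) (form_pairing (adjf B) A) (det4 B).
Implicit Types (M : 'M[F]_3) (N : 'M[F]_2) (x y : V F).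

Lemma det_mx33 (R : comNzRingType) (M : 'M[R]_3) : \det M =
  M 0 0 * M 1 1 * M 2 2 + M 0 1 * M 1 2 * M 2 0 + M 0 2 * M 1 0 * M 2 1
  - M 0 0 * M 1 2 * M 2 1 - M 0 1 * M 1 0 * M 2 2 - M 0 2 * M 1 1 * M 2 0.
Proof.
rewrite (expand_det_row _ 0) !big_ord_recl big_ord0 /cofactor.
rewrite ![\det (row' _ _)](expand_det_row _ 0) !big_ord_recl !big_ord0 /cofactor !det_mx11 !mxE.
have e0 : lift 0 0 = 1 :> 'I_3 by apply/val_inj.
have e1 : lift 0 1 = 2 :> 'I_3 by apply/val_inj.
have e2 : lift 1 0 = 0 :> 'I_3 by apply/val_inj.
have e3 : lift 1 1 = 2 :> 'I_3 by apply/val_inj.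
have e4 : lift 2 0 = 0 :> 'I_3 by apply/val_inj.
have e5 : lift 2 1 = 1 :> 'I_3 by apply/val_inj.
have f0 : lift 0 0 = 1 :> 'I_2 by apply/val_inj.
have f1 : lift 1 0 = 0 :> 'I_2 by apply/val_inj.
rewrite /= ?(f0, f1, e0, e1, e2, e3, e4, e5).
rewrite -[ord0]/(0 : 'I_3) /bump /=; ring.
Qed.

Lemma resolventE A B : resolvent (A, B) =
  - ((det4 A)%:P%:P * 'X^3 + (form_pairing (adjf A) B)%:P%:P * 'X^2 * 'X%:P
   + (form_pairing (adjf B) A)%:P%:P * 'X * 'X%:P ^+ 2 + (det4 B)%:P%:P * 'X%:P ^+ 3).
Proof.
rewrite /resolvent det_mx33 /symmx !mxE /=.
have h (z : F) : exists s : F, z = 2%:R * s by exists (z / 2%:R); field.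
rewrite /det4 /form_pairing ?(adjf_0, adjf_1, adjf_2,
    adjf_3, adjf_4, adjf_5).
have [a1 ->] := h (A 0 1); have [a2 ->] := h (A 0 2); have [a4 ->] := h (A 0 4).
have [b1 ->] := h (B 0 1); have [b2 ->] := h (B 0 2); have [b4 ->] := h (B 0 4).
have k (z : F) : 2%:R * z / 2%:R = z by field.
have k2 (z w : F) : z * (2%:R * w) / 2%:R = z * w by field.
rewrite !k !k2.
ring.
Qed.

Lemma resolvent_coef A B : let r := resolvent (A, B) in
  [/\ r`_3`_0 = - det4 A, r`_2`_1 = - form_pairing (adjf A) B,
      r`_1`_2 = - form_pairing (adjf B) A & r`_0`_3 = - det4 B].
Proof.
rewrite resolventE /=.
move: (det4 A) (form_pairing (adjf A) B) (form_pairing (adjf B) A) (det4 B) => a b c d.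
rewrite -!mulrA -!rmorphXn -!rmorphM /= !coefN !coefD !coefCM.
rewrite !coefXn !coefMC !coefX !coefC /= !coefE /=.
by split; ring.
Qed.

Lemma bcubic_disc_resolvent x : bcubic_disc (resolvent x) = pencil_disc x.1 x.2.
Proof.
case: x => A B /=; have [] := resolvent_coef A B.
rewrite /bcubic_disc /pencil_disc /cubic_disc => -> -> -> ->.
by move: (det4 A) (form_pairing (adjf A) B) (form_pairing (adjf B) A) (det4 B) => a b c d; ring.
Qed.

Lemma row3_ord (i : 'I_3) : [\/ i = 0, i = 1 | i = 2].
Proof.
by case: i => [[|[|[|//]]] Hi]; [apply: Or31|apply: Or32|apply: Or33]; apply/val_inj.
Qed.

Lemma symmx_tr A : (symmx A)^T = symmx A.
Proof.
apply/matrixP => i j; rewrite !mxE.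
by case: (row3_ord i) => ->; case: (row3_ord j) => ->.
Qed.

Lemma symmxK A : form_of_mx (symmx A) = A.
Proof.
apply: row6P; rewrite !mxE /= ?mxE //=; by field.
Qed.

Lemma form_of_mxK M : M^T = M -> symmx (form_of_mx M) = M.
Proof.
move=> /matrixP sM; apply/matrixP => i j; rewrite !mxE.
have := sM 0 1; have := sM 0 2; have := sM 1 2; rewrite !mxE => e12 e02 e01.
by case: (row3_ord i) => ->; case: (row3_ord j) => ->; rewrite /= ?e12 ?e02 ?e01 //; field.
Qed.

Definition act3m M A := form_of_mx (M *m symmx A *m M^T).

Lemma symmx_act3m M A : symmx (act3m M A) = M *m symmx A *m M^T.
Proof.
by apply: form_of_mxK; rewrite !trmx_mul trmxK symmx_tr mulmxA.
Qed.

(** The determinant is multiplicative, and the two outer factors are constant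
    matrices. *)
Lemma resolvent_act3m M A B :
  resolvent (act3m M A, act3m M B) = (\det M ^+ 2)%:P%:P * resolvent (A, B).
Proof.
rewrite /resolvent /= !symmx_act3m.
pose f := polyC \o (polyC : F -> {poly F}).
have E (sing_hat : 'M[F]_3) : map_mx (fun c : F => c%:P%:P) sing_hat = map_mx f sing_hat by [].
rewrite !E !map_mxM /=.
have -> : 'X *: (map_mx f M *m map_mx f (symmx A) *m map_mx f M^T)
   + 'X%:P *: (map_mx f M *m map_mx f (symmx B) *m map_mx f M^T)
  = map_mx f M *m ('X *: map_mx f (symmx A) + 'X%:P *: map_mx f (symmx B)) *m map_mx f M^T.
  by rewrite mulmxDr mulmxDl -!scalemxAr -!scalemxAl.
rewrite !det_mulmx !det_map_mx det_tr /f /= rmorphXn /= rmorphXn /=; ring.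
Qed.

Lemma pencil_disc_act3m M A B : pencil_disc (act3m M A) (act3m M B) = \det M ^+ 8 * pencil_disc A B.
Proof.
have := resolvent_coef (act3m M A) (act3m M B); have := resolvent_coef A B.
rewrite /= resolvent_act3m !coefCM => -[-> -> -> ->] [].
rewrite !mulrN => /oppr_inj e0 /oppr_inj e1 /oppr_inj e2 /oppr_inj e3.
rewrite /pencil_disc -e0 -e1 -e2 -e3 /cubic_disc.
move: (det4 A) (form_pairing (adjf A) B) (form_pairing (adjf B) A) (det4 B) => a b c d.
ring.
Qed.

Lemma det4_comb A B s t : det4 (s *: A + t *: B) = s ^+ 3 * det4 A
  + s ^+ 2 * t * form_pairing (adjf A) B + s * t ^+ 2 * form_pairing (adjf B) A + t ^+ 3 * det4 B.
Proof. by coord; field. Qed.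

Lemma pairing_comb A B s t s' t' :
  form_pairing (adjf (s *: A + t *: B)) (s' *: A + t' *: B) =
  3%:R * s ^+ 2 * s' * det4 A + (s ^+ 2 * t' + 2%:R * s * t * s') * form_pairing (adjf A) B
  + (t ^+ 2 * s' + 2%:R * s * t * t') * form_pairing (adjf B) A + 3%:R * t ^+ 2 * t' * det4 B.
Proof. by coord; field. Qed.

(** The discriminant is a covariant of the binary cubic, of degree 6 in the
    substitution. *)
Lemma pencil_disc_comb A B s t s' t' :
  pencil_disc (s *: A + t *: B) (s' *: A + t' *: B) = (s * t' - t * s') ^+ 6 * pencil_disc A B.
Proof.
rewrite /pencil_disc !det4_comb !pairing_comb.
move: (det4 A) (form_pairing (adjf A) B) (form_pairing (adjf B) A) (det4 B) => a b c d.
rewrite /cubic_disc; ring.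
Qed.

(** The action for arbitrary matrices: the adjoint of a group element is given by the
    transposed matrices. *)
Definition mx_act N M x : V F :=
  let A := act3m M x.1 in let B := act3m M x.2 in
  (N 0 0 *: A + N 0 1 *: B, N 1 0 *: A + N 1 1 *: B).

Lemma det_mx22 N : \det N = N 0 0 * N 1 1 - N 0 1 * N 1 0.
Proof.
rewrite (expand_det_row _ 0) !big_ord_recl big_ord0 /cofactor !det_mx11 !mxE.
have f0 : lift 0 0 = 1 :> 'I_2 by apply/val_inj.
have f1 : lift 1 0 = 0 :> 'I_2 by apply/val_inj.
by rewrite !(f0, f1) /bump /= -[ord0]/(0 : 'I_2); ring.
Qed.

Lemma pencil_disc_mx_act N M x : \det N != 0 -> \det M != 0 ->
  (pencil_disc (mx_act N M x).1 (mx_act N M x).2 == 0) = (pencil_disc x.1 x.2 == 0).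
Proof.
move=> dN dM; rewrite /= pencil_disc_comb pencil_disc_act3m -det_mx22.
by rewrite mulf_eq0 expf_eq0 (negPf dN) andbF /= mulf_eq0 expf_eq0 (negPf dM) andbF.
Qed.

Lemma act3m_inj M : \det M != 0 -> injective (act3m M).
Proof.
move=> dM A B /(congr1 (@symmx F)); rewrite !symmx_act3m => e.
have uM : M \in unitmx by rewrite unitmxE unitfE.
have uT : M^T \in unitmx by rewrite unitmx_tr.
rewrite -(symmxK A) -(symmxK B); congr form_of_mx.
by rewrite -[LHS](mulKmx uM) -[RHS](mulKmx uM) -[X in _ *m X](mulmxK uT) e mulmxK.
Qed.

Lemma mx_act_inj N M : \det N != 0 -> \det M != 0 -> injective (mx_act N M).
Proof.
move=> dN dM [A B] [A' B']; rewrite /mx_act /= => -[].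
set a := act3m M A; set b := act3m M B; set a' := act3m M A'; set b' := act3m M B'.
move=> e1 e2; rewrite det_mx22 in dN.
have ea : a = a'.
  apply: (scalerI dN).
  transitivity (N 1 1 *: (N 0 0 *: a + N 0 1 *: b) - N 0 1 *: (N 1 0 *: a + N 1 1 *: b)).
    by apply: row6P; coord; ring.
  by rewrite e1 e2; apply: row6P; coord; ring.
have eb : b = b'.
  apply: (scalerI dN).
  transitivity (N 0 0 *: (N 1 0 *: a + N 1 1 *: b) - N 1 0 *: (N 0 0 *: a + N 0 1 *: b)).
    by apply: row6P; coord; ring.
  by rewrite e1 e2; apply: row6P; coord; ring.
by rewrite (act3m_inj dM ea) (act3m_inj dM eb).
Qed.

Lemma form_pairing_tr A Y : form_pairing A Y = \tr (symmx A *m symmx Y).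
Proof.
rewrite /form_pairing /mxtrace !big_ord_recl big_ord0 !mxE !big_ord_recl !big_ord0 !mxE /=.
by field.
Qed.

Lemma act3m_adj M A Y : form_pairing (act3m M A) Y = form_pairing A (act3m M^T Y).
Proof.
rewrite !form_pairing_tr !symmx_act3m trmxK.
by rewrite -!mulmxA mxtrace_mulC !mulmxA.
Qed.

(** The pairing is tr (A Y) for symmetric matrices, hence transposition is adjoint
    to the action. *)
Lemma pairing_mx_act N M x y : pairing (mx_act N M x) y = pairing x (mx_act N^T M^T y).
Proof.
rewrite /pairing /= !mxE.
rewrite ![form_pairing _ (_ + _)](form_pairingC) !form_pairingDl // !form_pairingZl //.
rewrite ![form_pairing (act3m M^T _) _](form_pairingC) !act3m_adj.
by ring.
Qed.

Lemma GactE g x : Gact g x = mx_act (GLval g.1) (GLval g.2) x.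
Proof. by []. Qed.

End TernaryForms.

Lemma natr_true (R : pzRingType) : true%:R = 1 :> R. Proof. by []. Qed.

(** * Sums of an additive character over linear conditions *)

Section Transforms.
Variables (F : finFieldType) (K : numFieldType) (chi : F -> K).
Implicit Types (A B C Y : 'rV[F]_6) (p a b r v w : 'rV[F]_3) (c t e d : F).
Hypothesis nz2 : 2%:R != 0 :> F.
Hypothesis chiD : {morph chi : x y / x + y >-> x * y}.
Hypothesis chi0 : chi 0 = 1.
Hypothesis chi_nontriv : exists x, chi x != 1.
Notation q := (#|F|%:R : K).
Let nz4 : 4%:R != 0 :> F.
Proof. by rewrite -[4%N]/(2 * 2)%N natrM mulf_neq0. Qed.

Lemma q_neq0 : q != 0.
Proof. by rewrite pnatr_eq0 -lt0n; apply/card_gt0P; exists 0. Qed.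

Lemma qB1_neq0 : q - 1 != 0.
Proof.
rewrite subr_eq0 -[1](mulr1n 1) eqr_nat; apply: contraTneq (finRing_gt1 F) => ->.
by rewrite ltnn.
Qed.

(** Shifting the summation variable multiplies the sum by chi (f w0). *)
Lemma sum_char_eq0 (W : finZmodType) (f : W -> F) (w0 : W) :
  {morph f : x y / x + y} -> chi (f w0) != 1 -> \sum_(x : W) chi (f x) = 0.
Proof.
move=> fD; rewrite -subr_eq0 => h; apply: (mulfI h); rewrite mulr0 mulrBl mul1r.
rewrite mulr_sumr {1}(reindex_inj (addrI (- w0))) /=.
apply/eqP; rewrite subr_eq0; apply/eqP; apply: eq_bigr => y _.
by rewrite -chiD -fD addrA subrr add0r.
Qed.

(** The orthogonality relation for a functional f; the boolean z says whether f is
    zero, and if not, s is a section of f. *)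
Lemma sum_linear (W : finZmodType) (f : W -> F) (z : bool) (s : F -> W) :
  {morph f : x y / x + y} -> (z -> forall y, f y = 0) ->
  (~~ z -> forall x, f (s x) = x) ->
  \sum_(y : W) chi (f y) = #|W|%:R * z%:R.
Proof.
move=> fD; case: z => [/(_ isT) h _|_ /(_ isT) h].
  rewrite (eq_bigr (fun=> 1)) => [|y _]; last by rewrite h chi0.
  by rewrite sumr_const mulr1.
have [x hx] := chi_nontriv; rewrite mulr0.
by apply: (@sum_char_eq0 _ _ (s x)); rewrite ?h.
Qed.

Lemma sum_scalar c : \sum_e chi (e * c) = q * (c == 0)%:R.
Proof.
apply: (@sum_linear F (fun e => e * c) _ (fun x => x / c)).
- by move=> x y; rewrite mulrDl.
- by move=> /eqP -> w; rewrite mulr0.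
- by move=> c0 x; rewrite mulfVK.
Qed.

Lemma card_rV n : #|{: 'rV[F]_n}|%:R = q ^+ n.
Proof. by rewrite card_mx mul1n natrX. Qed.

Lemma sum_dot v : \sum_a chi (dot a v) = q ^+ 3 * (v == 0)%:R.
Proof.
rewrite -(card_rV 3).
have [v0|v0] := eqVneq v 0.
  apply: (@sum_linear 'rV[F]_3 (fun a => dot a v) true (fun x => 0)).
  - by move=> a b; rewrite dotDl.
  - by move=> _ w; rewrite v0 dotr0.
  - by [].
have [w hw] := dot_neq0 v0.
apply: (@sum_linear 'rV[F]_3 (fun a => dot a v) false (fun x => x *: w)).
- by move=> a b; rewrite dotDl.
- by [].
- by move=> _ x; rewrite dotZl dotC hw mulr1.
Qed.

Lemma sum_pairing Y : \sum_A chi (form_pairing A Y) = q ^+ 6 * (Y == 0)%:R.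
Proof.
rewrite -(card_rV 6).
have [Y0|Y0] := eqVneq Y 0.
  apply: (@sum_linear 'rV[F]_6 (fun A => form_pairing A Y) true (fun x => 0)) => //.
  - by move=> a b; rewrite (form_pairingDl nz2).
  - by move=> _ A; rewrite Y0 -(scale0r A) (form_pairingC nz2) (form_pairingZl nz2) mul0r.
have [B hB] : exists B, form_pairing B Y = 1.
  have : [|| Y 0 0 != 0, Y 0 1 != 0, Y 0 2 != 0, Y 0 3 != 0, Y 0 4 != 0 | Y 0 5 != 0].
    apply: contra_neqT Y0; rewrite !negb_or !negbK.
    move=> /and5P[/eqP e0 /eqP e1 /eqP e2 /eqP e3 /andP[/eqP e4 /eqP e5]].
    by apply: row6P; rewrite ent0.
  case/or4P => [h|h|h|/or3P[h|h|h]];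
   [exists (row6 (Y 0 0)^-1 0 0 0 0 0)|exists (row6 0 (2%:R/Y 0 1) 0 0 0 0)
   |exists (row6 0 0 (2%:R/Y 0 2) 0 0 0)|exists (row6 0 0 0 (Y 0 3)^-1 0 0)
   |exists (row6 0 0 0 0 (2%:R/Y 0 4) 0)|exists (row6 0 0 0 0 0 (Y 0 5)^-1)];
   by coord; field; rewrite ?h ?nz2.
apply: (@sum_linear 'rV[F]_6 (fun A => form_pairing A Y) false (fun x => x *: B)) => //.
- by move=> a b; rewrite (form_pairingDl nz2).
- by move=> _ x; rewrite (form_pairingZl nz2) hB mulr1.
Qed.

(** The number of linear forms a with A = p a; it is 0 or 1 for nonzero p. *)
Definition nb_quot A p : K := \sum_a (A == lmul p a)%:R.
(** As [nb_quot], for quotients a that vanish at the point r. *)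
Definition nb_quot_perp r A p : K := \sum_(a | dot a r == 0) (A == lmul p a)%:R.

(** The forms that kill p are the orthogonal of the forms divisible by p. *)
Lemma hat_ker p Y :
  \sum_A (grad A p == 0)%:R * chi (form_pairing A Y) = q ^+ 3 * nb_quot Y p.
Proof.
apply: (mulfI (expf_neq0 3 q_neq0)); rewrite mulr_sumr.
transitivity (\sum_a \sum_A chi (form_pairing A (Y + 2%:R *: lmul p a))).
  rewrite exchange_big; apply: eq_bigr => A _; rewrite mulrA -sum_dot mulr_suml.
  apply: eq_bigr => a _; rewrite -(form_pairing_lmul nz2) // -chiD; congr chi.
  by rewrite [RHS](form_pairingC nz2) (form_pairingDl nz2) (form_pairingZl nz2) addrC [form_pairing Y A](form_pairingC nz2).
(* Twice the product with a appears with a sign; rescale a by - 1 / 2. *)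
have s2 : - (2%:R : F)^-1 != 0 by rewrite oppr_eq0 invr_eq0.
rewrite /nb_quot mulr_sumr mulr_sumr (reindex_inj (scalerI s2)) /=; apply: eq_bigr => a _.
rewrite sum_pairing mulrA -exprD; congr (_ * _%:R); rewrite lmulZr scalerA mulrN divff //.
by rewrite scaleN1r subr_eq0.
Qed.

Lemma sum_indicator (T : finType) (R : pzRingType) (x : T) (f : T -> R) : \sum_y (y == x)%:R * f y = f x.
Proof.
rewrite (bigD1 x) //= eqxx mul1r big1 ?addr0 // => y /negPf ->.
by rewrite mul0r.
Qed.

Lemma pairing_lmul_dot p a Y : form_pairing (lmul p a) Y = dot a (2%:R^-1 *: grad Y p).
Proof. by rewrite dotZr -(form_pairing_lmul nz2) // mulrA mulVf // mul1r. Qed.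

Lemma hat_nb_quot p Y :
  \sum_A nb_quot A p * chi (form_pairing A Y) = q ^+ 3 * (grad Y p == 0)%:R.
Proof.
under eq_bigr do rewrite mulr_suml.
rewrite exchange_big /=.
under eq_bigr do rewrite sum_indicator pairing_lmul_dot.
by rewrite sum_dot scaler_eq0 invr_eq0 (negPf nz2).
Qed.

Lemma cnt_shift v r : r != 0 -> \sum_e (v + e *: r == 0)%:R = (cross v r == 0)%:R :> K.
Proof.
move=> r0; have [/(cross0P r0)[t ->]|h] := eqVneq (cross v r) 0.
  rewrite (bigD1 (- t)) //= scaleNr subrr eqxx big1 ?addr0 // => e et.
  by rewrite -scalerDl scaler_eq0 (negPf r0) orbF addrC addr_eq0 (negPf et).
rewrite big1 // => e _; case: eqP => // /eqP; rewrite addr_eq0 -scaleNr => /eqP vr.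
by rewrite vr crossZl eqxx in h.
Qed.

(** The orthogonal of r^perp is the line spanned by r; the condition a . r = 0 is
    itself expanded in characters. *)
Lemma sum_dot_orth r v : r != 0 ->
  \sum_(a | dot a r == 0) chi (dot a v) = q ^+ 2 * (cross v r == 0)%:R.
Proof.
move=> r0; apply: (mulfI q_neq0).
transitivity (\sum_e \sum_a chi (dot a (v + e *: r))).
  rewrite exchange_big big_mkcond mulr_sumr; apply: eq_bigr => a _.
  rewrite (eq_bigr (fun e => chi (dot a v) * chi (e * dot a r))); last first.
    by move=> e _; rewrite -chiD dotDr dotZr.
  rewrite -mulr_sumr sum_scalar; case: (dot a r == 0); rewrite ?mulr0 ?mulr1 //.
  by rewrite mulrC.
under eq_bigr do rewrite sum_dot.
by rewrite -mulr_sumr cnt_shift // mulrA.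
Qed.

Lemma hat_nb_quot_perp r p Y : r != 0 ->
  \sum_A nb_quot_perp r A p * chi (form_pairing A Y) = q ^+ 2 * (cross (grad Y p) r == 0)%:R.
Proof.
move=> r0; under eq_bigr do rewrite mulr_suml.
rewrite exchange_big /=.
under eq_bigr do rewrite sum_indicator pairing_lmul_dot.
rewrite sum_dot_orth //; congr (_ * _%:R).
have -> : cross (2%:R^-1 *: grad Y p) r = 2%:R^-1 *: cross (grad Y p) r.
  by move: (2%:R^-1) (grad _ _) => z w; r3; ring.
by rewrite scaler_eq0 invr_eq0 (negPf nz2).
Qed.

Lemma cnt_orth r : r != 0 -> \sum_a (dot a r == 0)%:R = q ^+ 2.
Proof.
move=> r0; have := sum_dot_orth 0 r0.
have -> : cross 0 r = 0 by r3; rewrite ?mul0r ?subr0 ?oppr0.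
rewrite eqxx mulr1 => <-; rewrite [RHS]big_mkcond.
by apply: eq_bigr => a _; case: (_ == _); rewrite // dotr0 chi0.
Qed.

Lemma cnt_line (P : pred 'rV[F]_3) r : r != 0 ->
  (forall v, P v <-> exists t, v = t *: r) -> \sum_v (P v)%:R = q.
Proof.
move=> r0 h; transitivity (\sum_v \sum_e (v + e *: r == 0)%:R : K).
  apply: eq_bigr => v _; rewrite cnt_shift //; congr (_%:R); congr nat_of_bool.
  by apply/idP/eqP => [/h[t ->]|/(cross0P r0)/h //]; rewrite crossZl.
rewrite exchange_big /= (eq_bigr (fun=> 1)) ?sumr_const // => e _.
rewrite (bigD1 (- e *: r)) //= scaleNr addNr eqxx big1 ?addr0 // => v hv.
by rewrite addr_eq0 -scaleNr scaleNr (negPf hv).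
Qed.

Lemma sum_neq0 (W : finZmodType) (f : W -> K) : \sum_(x : W | x != 0) f x = \sum_(x : W) f x - f 0.
Proof. by rewrite [X in X - _](bigD1 0) //= addrC addrK. Qed.

Lemma cnt_line1 (P : pred 'rV[F]_3) r : r != 0 ->
  (forall v, P v <-> exists t, v = t *: r) -> \sum_(v | v != 0) (P v)%:R = q - 1.
Proof.
move=> r0 h; rewrite sum_neq0 (cnt_line r0 h).
by have -> : P 0 by apply/h; exists 0; rewrite scale0r.
Qed.

(** * Transform of the totally singular pencils *)

Lemma lmul_inj p : p != 0 -> injective (lmul p).
Proof.
move=> /dot_neq0[v pv] a b e.
have dv : dot a v = dot b v.
  by have /(congr1 (fun A => qf A v)) := e; rewrite !qf_lmul pv !mul1r.
by have /(congr1 (fun A => grad A v)) := e; rewrite !grad_lmul pv !scale1r dv => /addrI.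
Qed.

Definition has_mul A p := [exists a, A == lmul p a].

Lemma sum_exists (T : finType) (P Q : pred T) : {in P &, forall x y, Q x -> Q y -> x = y} ->
  \sum_(x | P x) (Q x)%:R = [exists x, P x && Q x]%:R :> K.
Proof.
move=> h; case: existsP => [[x /andP[Px Qx]]|nE].
  rewrite (bigD1 x) //= Qx big1 ?addr0 // => y /andP[Py yx].
  by case Qy : (Q y) => //; rewrite (h y x) ?eqxx // in yx.
by rewrite big1 // => x Px; case Qx : (Q x) => //; case: nE; exists x; rewrite Px.
Qed.

Lemma nb_quotE A p : p != 0 -> nb_quot A p = (has_mul A p)%:R.
Proof.
move=> p0; rewrite /nb_quot /nb_quot sum_exists //.
by move=> a b _ _ /eqP -> /eqP /(lmul_inj p0).
Qed.

Lemma nb_quot_perpE r A p : p != 0 ->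
  nb_quot_perp r A p = [exists a, (dot a r == 0) && (A == lmul p a)]%:R.
Proof.
move=> p0; rewrite /nb_quot_perp /nb_quot_perp sum_exists //.
by move=> a b _ _ /eqP -> /eqP /(lmul_inj p0).
Qed.

(** The numbers of common kernel vectors, of common linear factors, of flags, and of
    common zeros at which the two gradients are dependent.  Each is a sum over
    nonzero vectors p, so it is q - 1 (for flags, the square of it) times a number of
    points or lines. *)
Definition ker_count A B : K := \sum_(p | p != 0) (common_ker A B p)%:R.
Definition div_count A B : K := \sum_(p | p != 0) nb_quot A p * nb_quot B p.
Definition flag_count A B : K :=
  \sum_(p | p != 0) \sum_(r | (r != 0) && (dot p r == 0)) nb_quot_perp r A p * nb_quot_perp r B p.
Definition tangent_count A B : K :=
  \sum_(p | p != 0) [&& qf A p == 0, qf B p == 0 & cross (grad A p) (grad B p) == 0]%:R.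

Definition common_divb A B p := has_mul A p && has_mul B p.

Lemma common_divP A B p : reflect (common_div A B p) (common_divb A B p).
Proof.
apply: (iffP andP) => [[/existsP[a /eqP ->] /existsP[b /eqP ->]]|[a [b [-> ->]]]].
  by exists a, b.
by split; apply/existsP; [exists a|exists b].
Qed.

Lemma div_countE A B : div_count A B = \sum_(p | p != 0) (common_divb A B p)%:R.
Proof. by apply: eq_bigr => p p0; rewrite !nb_quotE // -natrM mulnb. Qed.

(** If p divides both forms and r is in both kernels, r lies on the lines of p and
    of both quotients: otherwise both quotients are zero.  So a pair of a common
    factor and a common kernel vector is a flag. *)
Lemma common_div_ker A B p r : p != 0 -> r != 0 -> (A, B) != 0 ->
  (common_divb A B p && common_ker A B r) =
  [&& dot p r == 0, [exists a, (dot a r == 0) && (A == lmul p a)]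
    & [exists a, (dot a r == 0) && (B == lmul p a)]].
Proof.
move=> p0 r0 AB0; apply/andP/and3P => [[/common_divP[a [b [eA eB]]] /andP[/eqP kA /eqP kB]]|].
  have key (c : 'rV[F]_3) : grad (lmul p c) r = 0 -> dot p r != 0 -> c = 0.
    rewrite grad_lmul => h pr.
    have : dot r (dot c r *: p + dot p r *: c) = 0 by rewrite h dotr0.
    rewrite dotDr !dotZr ![dot r _]dotC => h'.
    have cr : dot c r = 0.
      apply: (mulfI pr); apply: (mulfI nz2); rewrite !mulr0 -h'; ring.
    by move: h; rewrite cr scale0r add0r => /eqP; rewrite scaler_eq0 (negPf pr) => /eqP.
  have pr : dot p r = 0.
    apply/eqP; apply: contraT => pr.
    have l0 : lmul p 0 = 0 by r6; rewrite ?mulr0 ?addr0.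
    by move: AB0; rewrite eA eB (key a) -?eA // (key b) -?eB // l0 eqxx.
  have key2 (c : 'rV[F]_3) : grad (lmul p c) r = 0 -> dot c r = 0.
    by rewrite grad_lmul pr scale0r addr0 => /eqP; rewrite scaler_eq0 (negPf p0) orbF => /eqP.
  split; first by rewrite pr.
    by apply/existsP; exists a; rewrite key2 -?eA // !eqxx.
  by apply/existsP; exists b; rewrite key2 -?eB // !eqxx.
move=> [/eqP pr /existsP[a /andP[/eqP ar /eqP ->]] /existsP[b /andP[/eqP br /eqP ->]]].
split; first by apply/common_divP; exists a, b.
by rewrite /common_ker !grad_lmul pr ar br !scale0r addr0 eqxx.
Qed.

Lemma flag_countE A B : (A, B) != 0 -> flag_count A B = div_count A B * ker_count A B.
Proof.
move=> AB0; rewrite div_countE mulr_suml; apply: eq_bigr => p p0.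
rewrite mulr_sumr big_mkcondr /=; apply: eq_bigr => r r0.
rewrite -natrM mulnb common_div_ker // !nb_quot_perpE //.
by case: (dot p r == 0); rewrite // -natrM mulnb.
Qed.

Lemma ker_count_neq0 A B : ker_count A B != 0 -> all_singular A B.
Proof.
apply: contraNT => h; rewrite /ker_count big1 // => p p0.
by case: (boolP (common_ker A B p)) => // /(common_ker_all_singular nz2 p0) e; rewrite e in h.
Qed.

Lemma div_count_neq0 A B : div_count A B != 0 -> all_singular A B.
Proof.
rewrite div_countE; apply: contraNT => h; rewrite big1 // => p p0.
by case: (boolP (common_divb A B p)) => // /common_divP/(common_div_all_singular nz2) e; rewrite e in h.
Qed.

Lemma cnt_neq0 : \sum_(p : 'rV[F]_3 | p != 0) (1 : K) = q ^+ 3 - 1.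
Proof. by rewrite sum_neq0 sumr_const card_rV. Qed.

Lemma lmul0r p : lmul p 0 = 0 :> 'rV[F]_6.
Proof. by r6; rewrite ?mulr0 ?addr0. Qed.

(** With K and J the projective counts, K + J - K J is 1 by the dichotomy when the
    resolvent vanishes, and 0 otherwise since then K = J = 0.  At (0, 0) the flags
    are not all the pairs, and the last term corrects this. *)
Lemma all_singularE A B :
  (q - 1) ^+ 2 * (all_singular A B)%:R = (q - 1) * (ker_count A B + div_count A B) - flag_count A B
     + (q - 1) ^+ 2 * q ^+ 3 * ((A, B) == 0)%:R.
Proof.
have [[A0 B0]|AB0] := eqVneq (A, B) 0.
  have -> : all_singular A B.
    by apply: (@common_div_all_singular F nz2 A B 0); exists 0, 0; rewrite lmul0r.
  have m0 Y p : Y = 0 -> p != 0 -> has_mul Y p.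
    by move=> -> p0; apply/existsP; exists 0; rewrite lmul0r.
  have g0 Y p : Y = 0 -> grad Y p = 0 by move=> ->; r3; rewrite ?mulr0 ?mul0r ?addr0.
  have -> : ker_count A B = q ^+ 3 - 1.
    by rewrite -cnt_neq0; apply: eq_bigr => p p0; rewrite /common_ker !g0 // eqxx.
  have -> : div_count A B = q ^+ 3 - 1.
    by rewrite -cnt_neq0; apply: eq_bigr => p p0; rewrite !nb_quotE // !m0 // mulr1.
  have -> : flag_count A B = (q ^+ 3 - 1) * (q ^+ 2 - 1).
    rewrite -cnt_neq0 mulr_suml; apply: eq_bigr => p p0; rewrite mul1r.
    transitivity (\sum_(r | r != 0) (dot r p == 0)%:R : K); last first.
      by rewrite sum_neq0 (cnt_orth p0) dotC dotr0 eqxx.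
    rewrite big_mkcondr; apply: eq_bigr => r r0 /=.
    rewrite dotC; case: (_ == 0) => //; rewrite !nb_quot_perpE //.
    have e Y : Y = 0 -> [exists a, (dot a r == 0) && (Y == lmul p a)].
      by move=> ->; apply/existsP; exists 0; rewrite lmul0r dotC dotr0 !eqxx.
    by rewrite !e // mulr1.
  by rewrite !mulr1; ring.
rewrite mulr0 addr0 flag_countE //.
have [s|s] := boolP (all_singular A B); last first.
  have -> : ker_count A B = 0 by apply/eqP; apply: contraNT s => /ker_count_neq0.
  have -> : div_count A B = 0 by apply/eqP; apply: contraNT s => /div_count_neq0.
  by rewrite mulr0; ring.
case: (all_singular_dichotomy nz2 s AB0) => -[P [P0 h1] h2].
  have -> : ker_count A B = q - 1.
    apply: (cnt_line1 P0) => v; split=> [/h2 //|[t ->]].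
    by move: h1; rewrite /common_ker !gradZr => /andP[/eqP -> /eqP ->]; rewrite scaler0 eqxx.
  by rewrite mulr1; ring.
have -> : div_count A B = q - 1; last by rewrite mulr1; ring.
rewrite div_countE; transitivity (\sum_(v | v != 0) ((v == 0) || common_divb A B v)%:R : K).
  by apply: eq_bigr => v /negPf ->.
apply: (@cnt_line1 (fun v => (v == 0) || common_divb A B v) _ P0) => v; split.
  have [->|v0] := eqVneq v 0; first by exists 0; rewrite scale0r.
  by move=> /common_divP; apply: h2.
move=> [t ->]; rewrite scaler_eq0 (negPf P0) orbF.
have [//|t0] := eqVneq t 0; apply/common_divP.
have [a [b [-> ->]]] := h1; exists (t^-1 *: a), (t^-1 *: b).
by split; r6; field.
Qed.

(** The Fourier transform on pairs of forms, without the factor q^-12. *)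
Definition hat2 (f : 'rV[F]_6 -> 'rV[F]_6 -> K) A' B' : K :=
  \sum_A \sum_B f A B * (chi (form_pairing A A') * chi (form_pairing B B')).

Lemma hat2_prod (f g : 'rV[F]_6 -> K) A' B' :
  hat2 (fun A B => f A * g B) A' B' =
  (\sum_A f A * chi (form_pairing A A')) * (\sum_B g B * chi (form_pairing B B')).
Proof.
rewrite mulr_suml; apply: eq_bigr => A _; rewrite mulr_sumr; apply: eq_bigr => B _.
by ring.
Qed.

Lemma hat2_ext f g A' B' : (forall A B, f A B = g A B) -> hat2 f A' B' = hat2 g A' B'.
Proof. by move=> h; apply: eq_bigr => A _; apply: eq_bigr => B _; rewrite h. Qed.

Lemma hat2_sum (I : finType) (P : pred I) (f : I -> 'rV[F]_6 -> 'rV[F]_6 -> K) A' B' :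
  hat2 (fun A B => \sum_(i | P i) f i A B) A' B' = \sum_(i | P i) hat2 (f i) A' B'.
Proof.
rewrite [RHS]exchange_big; apply: eq_bigr => A _ /=.
rewrite [RHS]exchange_big; apply: eq_bigr => B _ /=.
by rewrite mulr_suml.
Qed.

Lemma hat2_D f g A' B' : hat2 (fun A B => f A B + g A B) A' B' = hat2 f A' B' + hat2 g A' B'.
Proof.
rewrite -big_split; apply: eq_bigr => A _ /=; rewrite -big_split; apply: eq_bigr => B _ /=.
by rewrite mulrDl.
Qed.

Lemma hat2_Z k f A' B' : hat2 (fun A B => k * f A B) A' B' = k * hat2 f A' B'.
Proof.
rewrite mulr_sumr; apply: eq_bigr => A _ /=; rewrite mulr_sumr; apply: eq_bigr => B _ /=.
exact: esym (mulrA _ _ _).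
Qed.

Lemma hat2_ker_count A' B' : hat2 ker_count A' B' = q ^+ 6 * div_count A' B'.
Proof.
rewrite hat2_sum mulr_sumr; apply: eq_bigr => p p0.
rewrite (@hat2_ext _ (fun A B => (grad A p == 0)%:R * (grad B p == 0)%:R)); last first.
  by move=> A B; rewrite -natrM mulnb.
by rewrite hat2_prod !hat_ker //; ring.
Qed.

Lemma hat2_div_count A' B' : hat2 div_count A' B' = q ^+ 6 * ker_count A' B'.
Proof.
rewrite hat2_sum mulr_sumr; apply: eq_bigr => p p0.
by rewrite hat2_prod !hat_nb_quot // /common_ker -mulnb natrM; ring.
Qed.

Lemma crossZr p r t : cross p (t *: r) = t *: cross p r. Proof. r3; ring. Qed.

(** If u or v is nonzero, r has to be proportional to it, so that u and v are
    dependent and orthogonal to p; if both are zero, r is any nonzero vector of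
    p^perp, and there are q^2 - 1 = (q - 1)(1 + q) of them. *)
Lemma cnt_flags p u v : p != 0 ->
  \sum_(r | (r != 0) && (dot p r == 0)) ((cross u r == 0) && (cross v r == 0))%:R =
  (q - 1) * ([&& dot p u == 0, dot p v == 0 & cross u v == 0]%:R
     + q * ((u == 0) && (v == 0))%:R).
Proof.
move=> p0; rewrite big_mkcondr /=.
have key w z : w != 0 -> \sum_(r | r != 0)
   (if dot p r == 0 then ((cross w r == 0) && (cross z r == 0))%:R else 0) =
  (q - 1) * [&& dot p w == 0, dot p z == 0 & cross w z == 0]%:R.
  move=> w0.
  rewrite -(@cnt_line1 (fun r => cross w r == 0) w w0); last first.
    move=> r; split=> [/eqP h|[t ->]]; last by rewrite crossC crossZl oppr0.
    by apply: cross0P; rewrite // crossC h oppr0.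
  rewrite mulr_suml; apply: eq_bigr => r r0; rewrite -natrM mulnb.
  have [/eqP h|_] := boolP (cross w r == 0); last by case: ifP.
  have [t et] : exists t, r = t *: w by apply: cross0P; rewrite // crossC h oppr0.
  have t0 : t != 0 by apply: contraNneq r0 => t0; rewrite et t0 scale0r.
  have -> : (dot p r == 0) = (dot p w == 0) by rewrite et dotZr mulf_eq0 (negPf t0).
  have -> : (cross z r == 0) = (cross w z == 0).
    by rewrite et crossZr scaler_eq0 (negPf t0) /= crossC oppr_eq0.
  have [pw|] := eqVneq (dot p w) 0 => //=.
  have [/eqP wz|_] := boolP (cross w z == 0); last by rewrite andbF.
  have [s ->] : exists s, z = s *: w by apply: cross0P; rewrite // crossC wz oppr0.
  by rewrite dotZr pw mulr0 eqxx.
have [->|u0] := eqVneq u 0; last by rewrite key //= mulr0 addr0.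
have [->|v0] := eqVneq v 0; last first.
  rewrite andbF mulr0 addr0 -[X in _ * X]/([&& _, _ & _]%:R) //.
  have -> : [&& dot p 0 == 0, dot p v == 0 & cross 0 v == 0] =
     [&& dot p v == 0, dot p 0 == 0 & cross v 0 == 0].
     by rewrite dotr0 [cross 0 v]crossC oppr_eq0 eqxx.
  by rewrite -key //; apply: eq_bigr => r _; rewrite andbC.
have c0 r : cross 0 r = 0 :> 'rV[F]_3 by r3; rewrite ?mul0r ?subr0 ?oppr0.
rewrite dotr0 c0 !eqxx /= mulr1.
transitivity (\sum_(r | r != 0) (dot r p == 0)%:R : K).
  by apply: eq_bigr => r _; rewrite c0 eqxx dotC; case: (_ == _).
rewrite sum_neq0 (cnt_orth p0) dotC dotr0 eqxx.
by rewrite (_ : true%:R = 1 :> K) //; ring.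
Qed.

(** For fixed p and r the transform requires the gradients of both forms at p to be
    multiples of r, which is on the line p; by Euler's relation p is then a common zero. *)
Lemma hat2_flag_count A' B' : hat2 flag_count A' B' =
  q ^+ 4 * (q - 1) * (tangent_count A' B' + q * ker_count A' B').
Proof.
rewrite hat2_sum -mulrA [_ * (tangent_count _ _ + _)]mulrDr /tangent_count /ker_count !mulr_sumr -big_split /= mulr_sumr.
apply: eq_bigr => p p0; rewrite hat2_sum.
transitivity (q ^+ 4 * \sum_(r | (r != 0) && (dot p r == 0))
    ((cross (grad A' p) r == 0) && (cross (grad B' p) r == 0))%:R).
  rewrite mulr_sumr; apply: eq_bigr => r /andP[r0 _].
  by rewrite hat2_prod !hat_nb_quot_perp // -mulnb natrM; ring.
rewrite cnt_flags // !dot_grad !mulf_eq0 (negPf nz2) /=.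
by rewrite /common_ker; ring.
Qed.

Lemma hat2_zero A' B' : hat2 (fun A B => ((A, B) == 0)%:R) A' B' = 1.
Proof.
rewrite /hat2 (bigD1 0) //= (bigD1 0) //= eqxx mul1r.
rewrite !form_pairing0l // !chi0 mulr1.
rewrite big1 => [|B B0]; last by rewrite xpair_eqE (negPf B0) andbF mul0r.
rewrite big1 ?addr0 // => A A0; rewrite big1 // => B _.
by rewrite xpair_eqE (negPf A0) mul0r.
Qed.

Lemma hat2_all_singular A' B' :
  (q - 1) * hat2 (fun A B => (all_singular A B)%:R) A' B' =
  q ^+ 6 * (div_count A' B' + ker_count A' B') - q ^+ 4 * (tangent_count A' B' + q * ker_count A' B') + (q - 1) * q ^+ 3.
Proof.
apply: (mulfI qB1_neq0); rewrite mulrA -expr2 -hat2_Z (hat2_ext _ _ all_singularE).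
rewrite !hat2_D hat2_Z hat2_D hat2_ker_count hat2_div_count hat2_Z hat2_zero.
rewrite (@hat2_ext (fun A B => - flag_count A B) (fun A B => -1 * flag_count A B)); last first.
  by move=> A B; rewrite mulN1r.
rewrite hat2_Z hat2_flag_count; ring.
Qed.

(** * Transform of the multiple roots of the resolvent *)

(** The member C of the pencil spanned by C and B is a multiple root of the
    resolvent. *)
Definition dbl_member C B := (det4 C == 0) && (form_pairing (adjf C) B == 0).
Definition dbl_hat Y1 Y2 : K := hat2 (fun C B => (dbl_member C B)%:R) Y1 Y2.
Definition nb_sqf Y p : K := \sum_c (Y == sqf c p)%:R.
(** Linear forms p that divide Y1 and whose square has Y2 as a multiple. *)
Definition sqdiv_count Y1 Y2 : K := \sum_(p | p != 0) nb_quot Y1 p * nb_sqf Y2 p.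
Definition zero_count Y1 Y2 : K := \sum_(p | p != 0) ((qf Y1 p == 0) && (qf Y2 p == 0))%:R.

Lemma adjf_det4 C : adjf C = 0 -> det4 C = 0.
Proof.
move=> /(adjf0_sqf nz2)[c [p [p0 ->]]].
have -> : sqf c p = lmul p (c *: p) by r6; ring.
exact: det4_lmul.
Qed.

Lemma sqf0 p : sqf 0 p = 0 :> 'rV[F]_6. Proof. by rewrite /sqf scale0r. Qed.

Lemma adjf_neq0 C : adjf C != 0 -> C == 0 = false.
Proof.
by move=> aC; apply: contraNF aC => /eqP ->; have := adjf_sqf (0 : F) 0; rewrite sqf0 => ->.
Qed.

Lemma sqf_inj p : p != 0 -> injective (fun c => sqf c p).
Proof.
move=> p0 c d; rewrite /sqf => /eqP; rewrite -subr_eq0 -scalerBl => /eqP h.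
by apply/eqP; rewrite -subr_eq0; apply/eqP; apply: (sqf_eq0 p0).
Qed.

Lemma nb_sqfE Y p : p != 0 -> nb_sqf Y p = [exists c, Y == sqf c p]%:R.
Proof.
by move=> p0; rewrite /nb_sqf sum_exists // => x y _ _ /eqP -> /eqP /(sqf_inj p0).
Qed.

Lemma nb_sqf0 p : p != 0 -> nb_sqf 0 p = 1.
Proof.
move=> p0; rewrite nb_sqfE //; have -> // : [exists c, 0 == sqf c p].
by apply/existsP; exists 0; rewrite sqf0.
Qed.

Lemma nb_sqf_sqf d P p : d != 0 -> P != 0 -> p != 0 -> nb_sqf (sqf d P) p = (cross p P == 0)%:R.
Proof.
move=> d0 P0 p0; rewrite nb_sqfE //; congr (_%:R); congr nat_of_bool; apply/existsP/eqP.
  by move=> [c /eqP /(sqf_prop nz2 d0 P0)[t ->]]; rewrite crossC crossZl oppr0.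
move=> /(cross0P P0)[t pt]; have t0 : t != 0 by apply: contraNneq p0 => t0; rewrite pt t0 scale0r.
by exists (d / t ^+ 2); apply/eqP; rewrite pt; r6; field.
Qed.

Lemma line_iff P v : P != 0 -> (cross v P == 0) <-> exists t, v = t *: P.
Proof. by move=> P0; split=> [/eqP /(cross0P P0) //|[t ->]]; rewrite crossZl. Qed.

(** A nonzero form of rank one is c p^2 for p on a line; the form 0 is c p^2 for
    c = 0 and all p. *)
Lemma cnt_sqf C : \sum_(p | p != 0) nb_sqf C p =
  (q - 1) * ((adjf C == 0)%:R + (q ^+ 2 + q) * (C == 0)%:R).
Proof.
have [aC|aC] := eqVneq (adjf C) 0; last first.
  rewrite (adjf_neq0 aC).
  rewrite big1 ?mulr0 ?addr0 ?mulr0 // => p p0; rewrite nb_sqfE //.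
  by case: existsP => // -[c /eqP e]; rewrite e adjf_sqf eqxx in aC.
have [C0|C0] := eqVneq C 0.
  rewrite (eq_bigr (fun=> 1)) => [|p p0]; last by rewrite C0 nb_sqf0.
  by rewrite cnt_neq0 !natr_true; ring.
have [d [P [P0 eC]]] := adjf0_sqf nz2 aC.
have d0 : d != 0 by apply: contraNneq C0 => d0; rewrite eC d0 sqf0.
rewrite mulr0 addr0 mulr1 -(@cnt_line1 _ _ P0 (fun v => line_iff v P0)).
by apply: eq_bigr => p p0; rewrite eC nb_sqf_sqf.
Qed.

Lemma grad0l p : grad 0 p = 0 :> 'rV[F]_3.
Proof. by r3; rewrite ?mulr0 ?mul0r ?addr0. Qed.

(** The kernel has q^(3 - rank) vectors; solving for [det C = 0] gives the
    inclusion-exclusion over the rank. *)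
Lemma cnt_ker C : \sum_(p | p != 0) (grad C p == 0)%:R =
  (q - 1) * ((det4 C == 0)%:R + q * (adjf C == 0)%:R + q ^+ 2 * (C == 0)%:R).
Proof.
have [aC|aC] := eqVneq (adjf C) 0; last first.
  rewrite (adjf_neq0 aC).
  rewrite !mulr0 !addr0.
  have [dC|dC] := eqVneq (det4 C) 0; last first.
    rewrite big1 ?mulr0 // => p p0; case: eqP => // /(ker_det4 nz2 p0) h.
    by rewrite h eqxx in dC.
  have [c [P [P0 eC]]] := det4_adjf nz2 dC.
  have c0 : c != 0 by apply: contraNneq aC => c0; rewrite eC c0 sqf0.
  rewrite mulr1 -(@cnt_line1 _ _ P0 (fun v => line_iff v P0)).
  apply: eq_bigr => p p0; congr (_%:R); congr nat_of_bool; apply/eqP/idP.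
    by move=> h; apply/(line_iff p P0); apply: ker_prop eC h.
  by move=> /(line_iff p P0)[t ->]; rewrite gradZr (adjf_ker nz2 dC c0 P0 eC) scaler0.
rewrite (adjf_det4 aC) eqxx.
have [C0|C0] := eqVneq C 0.
  rewrite (eq_bigr (fun=> 1)) => [|p p0]; last by rewrite C0 grad0l eqxx.
  by rewrite cnt_neq0 !natr_true; ring.
have [d [P [P0 eC]]] := adjf0_sqf nz2 aC.
have d0 : d != 0 by apply: contraNneq C0 => d0; rewrite eC d0 sqf0.
transitivity (\sum_(p | p != 0) (dot p P == 0)%:R : K).
  apply: eq_bigr => p p0.
  by rewrite eC grad_sqf scaler_eq0 !mulf_eq0 (negPf nz2) (negPf d0) (negPf P0) orbF /= dotC.
rewrite sum_neq0 (cnt_orth P0) dotC dotr0 eqxx !natr_true mulr0.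
ring.
Qed.

(** As [cnt_sqf], inside the forms with P in their kernel. *)
Lemma cnt_sqf_perp P C : P != 0 -> \sum_(p | (p != 0) && (dot p P == 0)) nb_sqf C p =
  (q - 1) * (((adjf C == 0) && (grad C P == 0))%:R + q * (C == 0)%:R).
Proof.
move=> P0; have [aC|aC] := eqVneq (adjf C) 0; last first.
  rewrite (adjf_neq0 aC).
  rewrite big1 ?mulr0 ?addr0 ?mulr0 // => p /andP[p0 _]; rewrite nb_sqfE //.
  by case: existsP => // -[c /eqP e]; rewrite e adjf_sqf eqxx in aC.
have [C0|C0] := eqVneq C 0.
  rewrite C0 grad0l eqxx /= !mulr1.
  transitivity (\sum_(p | p != 0) (dot p P == 0)%:R : K).
    rewrite big_mkcondr; apply: eq_bigr => p p0; rewrite nb_sqf0 //.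
    by case: (_ == 0).
  rewrite sum_neq0 (cnt_orth P0) dotC dotr0 eqxx.
  by rewrite natr_true; ring.
have [d [R [R0 eC]]] := adjf0_sqf nz2 aC.
have d0 : d != 0 by apply: contraNneq C0 => d0; rewrite eC d0 sqf0.
rewrite mulr0 addr0 /=.
have -> : (grad C P == 0) = (dot R P == 0).
  by rewrite eC grad_sqf scaler_eq0 !mulf_eq0 (negPf nz2) (negPf d0) (negPf R0) orbF.
rewrite -(@cnt_line1 _ _ R0 (fun v => line_iff v R0)) mulr_suml big_mkcondr.
apply: eq_bigr => p p0 /=; rewrite eC nb_sqf_sqf //.
have [/eqP/(cross0P R0)[t pt]|_] := boolP (cross p R == 0); last by rewrite mul0r; case: ifP.
have t0 : t != 0 by apply: contraNneq p0 => t0; rewrite pt t0 scale0r.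
by rewrite pt dotZl mulf_eq0 (negPf t0) /=; case: ifP; rewrite mul1r.
Qed.

Lemma hat_nb_sqf p Y : \sum_C nb_sqf C p * chi (form_pairing C Y) = q * (qf Y p == 0)%:R.
Proof.
under eq_bigr do rewrite mulr_suml.
rewrite exchange_big /=.
under eq_bigr do rewrite sum_indicator form_pairing_sqf //.
by rewrite sum_scalar.
Qed.

Lemma sum_hyperplane D Y : \sum_B (form_pairing D B == 0)%:R * chi (form_pairing B Y) =
  q ^+ 5 * \sum_e (Y == e *: D)%:R.
Proof.
apply: (mulfI q_neq0); rewrite mulr_sumr.
transitivity (\sum_e \sum_B chi (form_pairing B (Y + e *: D))).
  rewrite exchange_big; apply: eq_bigr => B _; rewrite mulrA -sum_scalar //.
  rewrite mulr_suml; apply: eq_bigr => e _; rewrite -chiD; congr chi.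
  by rewrite [RHS](form_pairingC nz2) form_pairingDl // form_pairingZl // addrC (form_pairingC nz2 Y).
rewrite mulrA -exprS mulr_sumr (reindex_inj oppr_inj) /=; apply: eq_bigr => e _.
by rewrite sum_pairing // scaleNr subr_eq0.
Qed.

Lemma hat_sum_nb_sqf (P : pred 'rV[F]_3) Y : \sum_(p | P p) q * (qf Y p == 0)%:R =
  \sum_C (\sum_(p | P p) nb_sqf C p) * chi (form_pairing C Y).
Proof.
under [RHS]eq_bigr do rewrite mulr_suml.
by rewrite [RHS]exchange_big /=; apply: eq_bigr => p _; rewrite hat_nb_sqf.
Qed.

Lemma hat_sum_ker (P : pred 'rV[F]_3) Y : \sum_(p | P p) q ^+ 3 * nb_quot Y p =
  \sum_C (\sum_(p | P p) (grad C p == 0)%:R) * chi (form_pairing C Y).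
Proof.
under [RHS]eq_bigr do rewrite mulr_suml.
by rewrite [RHS]exchange_big /=; apply: eq_bigr => p _; rewrite hat_ker.
Qed.

(** The number of scalars e with Y = e adj C, which is what remains of the sum over the
    second form, see [dbl_hatE]. *)
Definition nb_adj C Y : K := \sum_e (Y == e *: adjf C)%:R.

Lemma dbl_hatE Y1 Y2 : dbl_hat Y1 Y2 =
  q ^+ 5 * \sum_C ((det4 C == 0)%:R * nb_adj C Y2) * chi (form_pairing C Y1).
Proof.
rewrite mulr_sumr; apply: eq_bigr => C _.
transitivity ((det4 C == 0)%:R * chi (form_pairing C Y1) *
   \sum_B (form_pairing (adjf C) B == 0)%:R * chi (form_pairing B Y2)).
  by rewrite mulr_sumr; apply: eq_bigr => B _; rewrite /dbl_member -mulnb natrM; ring.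
by rewrite sum_hyperplane /nb_adj; ring.
Qed.

Lemma hat_zero Y : \sum_C (C == 0)%:R * chi (form_pairing C Y) = 1.
Proof. by rewrite sum_indicator form_pairing0l // chi0. Qed.

Lemma qf0l p : qf 0 p = 0 :> F. Proof. by coord; rewrite !mul0r !addr0. Qed.

Lemma nb_adj0 C : (det4 C == 0)%:R * nb_adj C 0 = (det4 C == 0)%:R + (q - 1) * (adjf C == 0)%:R.
Proof.
rewrite /nb_adj; have [aC|aC] := eqVneq (adjf C) 0.
  rewrite adjf_det4 // eqxx (eq_bigr (fun=> 1)) => [|e _]; last by rewrite aC scaler0 eqxx.
  by rewrite sumr_const mulr1 !mul1r addrC subrK.
rewrite mulr0 addr0 (bigD1 0) //= scale0r eqxx big1 ?addr0 ?mulr1 // => e e0.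
by rewrite eq_sym scaler_eq0 (negPf e0) (negPf aC).
Qed.

(** When Y2 = 0 the scalar e is arbitrary if adj C = 0, and e = 0 otherwise.  The
    resulting indicators are combinations of the counts [cnt_ker] and [cnt_sqf]. *)
Lemma dbl_hat_0 Y1 : (q - 1) * dbl_hat Y1 0 =
  q ^+ 8 * sqdiv_count Y1 0 + q ^+ 6 * (q - 1 - zero_count Y1 0).
Proof.
have -> : sqdiv_count Y1 0 = \sum_(p | p != 0) nb_quot Y1 p.
  by apply: eq_bigr => p p0; rewrite nb_sqf0 // mulr1.
have -> : zero_count Y1 0 = \sum_(p | p != 0) (qf Y1 p == 0)%:R.
  by apply: eq_bigr => p p0; rewrite qf0l eqxx andbT.
rewrite dbl_hatE mulrCA mulr_sumr.
transitivity (q ^+ 5 * (\sum_(p | p != 0) (q ^+ 3 * nb_quot Y1 p) -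
    \sum_(p | p != 0) q * (qf Y1 p == 0)%:R + (q - 1) * q * \sum_C (C == 0)%:R * chi (form_pairing C Y1))); last first.
  by rewrite hat_zero -!mulr_sumr; ring.
congr (_ * _).
rewrite hat_sum_ker hat_sum_nb_sqf mulr_sumr -sumrB -big_split /=.
apply: eq_bigr => C _; rewrite cnt_ker cnt_sqf nb_adj0.
by ring.
Qed.

Lemma qf_sqf_perp d P p : d != 0 -> (qf (sqf d P) p == 0) = (dot p P == 0).
Proof. by move=> d0; rewrite qf_sqf mulf_eq0 (negPf d0) sqrf_eq0 dotC. Qed.

Lemma nb_quotZ Y t p : t != 0 -> nb_quot Y (t *: p) = nb_quot Y p.
Proof.
move=> t0; rewrite /nb_quot /nb_quot (reindex_inj (scalerI (invr_neq0 t0))) /=.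
apply: eq_bigr => a _; congr (_%:R); congr nat_of_bool; congr (_ == _).
by r6; field.
Qed.

(** If det C = 0 and adj C is proportional to P^2, then P spans the kernel of C;
    conversely, if P is in the kernel, adj C is a multiple of P^2, and the
    multiple is nonzero unless C has rank at most one. *)
Lemma nb_adj_sqf d P C : d != 0 -> P != 0 ->
  (det4 C == 0)%:R * nb_adj C (sqf d P) =
  (grad C P == 0)%:R - ((adjf C == 0) && (grad C P == 0))%:R.
Proof.
move=> d0 P0; have dP0 : sqf d P != 0 by apply: contraNneq d0 => /(sqf_eq0 P0) ->.
rewrite /nb_adj; have [aC|aC] := eqVneq (adjf C) 0.
  rewrite /= subrr big1 ?mulr0 // => e _.
  by rewrite aC scaler0 (negPf dP0).
rewrite subr0; have [gC|gC] := eqVneq (grad C P) 0.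
  rewrite (ker_det4 nz2 P0 gC) eqxx mul1r.
  have [c ec] := ker_adjf nz2 P0 gC.
  have c0 : c != 0 by apply: contraNneq aC => c0; rewrite ec c0 sqf0.
  rewrite (bigD1 (d / c)) //= big1 => [|e he].
    rewrite addr0 ec; have -> : sqf d P = (d / c) *: sqf c P by r6; field.
    by rewrite eqxx.
  case: eqP => // h; case/negP: he; apply/eqP; apply: (mulIf c0); rewrite divfK //.
  by apply: (sqf_inj P0); rewrite h ec /sqf scalerA.
have [dC|] := eqVneq (det4 C) 0; last by rewrite mul0r.
rewrite big1 ?mulr0 // => e _; case: eqP => // h; case/negP: gC.
have e0 : e != 0 by apply: contraNneq dP0 => e0; rewrite h e0 scale0r.
apply/eqP; apply: (@adjf_ker _ nz2 C (d / e) P) => //; first by rewrite mulf_neq0 ?invr_eq0.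
have -> : sqf (d / e) P = e^-1 *: sqf d P by r6; field.
by rewrite h scalerA mulVf // scale1r.
Qed.

Lemma dbl_hat_sqf d P Y1 : d != 0 -> P != 0 -> (q - 1) * dbl_hat Y1 (sqf d P) =
  q ^+ 8 * sqdiv_count Y1 (sqf d P) + q ^+ 6 * (q - 1 - zero_count Y1 (sqf d P)).
Proof.
move=> d0 P0.
have -> : sqdiv_count Y1 (sqf d P) = (q - 1) * nb_quot Y1 P.
  rewrite -(@cnt_line1 _ _ P0 (fun v => line_iff v P0)) mulr_suml.
  apply: eq_bigr => p p0; rewrite nb_sqf_sqf // mulrC.
  have [/eqP/(cross0P P0)[t pt]|_] := boolP (cross p P == 0); last by rewrite !mul0r.
  by rewrite pt nb_quotZ //; apply: contraNneq p0 => t0; rewrite pt t0 scale0r.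
have -> : zero_count Y1 (sqf d P) = \sum_(p | (p != 0) && (dot p P == 0)) (qf Y1 p == 0)%:R.
  rewrite big_mkcondr; apply: eq_bigr => p p0; rewrite qf_sqf_perp // andbC.
  by case: (dot p P == 0).
rewrite dbl_hatE mulrCA mulr_sumr.
transitivity (q ^+ 5 * ((q - 1) * (q ^+ 3 * nb_quot Y1 P) -
    \sum_(p | (p != 0) && (dot p P == 0)) q * (qf Y1 p == 0)%:R + (q - 1) * q * \sum_C (C == 0)%:R * chi (form_pairing C Y1))); last first.
  by rewrite hat_zero -!mulr_sumr; ring.
congr (_ * _).
rewrite -(hat_ker) // hat_sum_nb_sqf !mulr_sumr -sumrB -big_split /=.
apply: eq_bigr => C _; rewrite cnt_sqf_perp // nb_adj_sqf //.
by ring.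
Qed.

(** adj C has rank at most one when det C = 0. *)
Lemma dbl_hat_rank_gt1 Y1 Y2 : adjf Y2 != 0 -> dbl_hat Y1 Y2 = 0.
Proof.
move=> aY; rewrite dbl_hatE big1 ?mulr0 // => C _.
have [dC|] := eqVneq (det4 C) 0; last by rewrite !mul0r.
rewrite /nb_adj big1 ?mulr0 ?mul0r // => e _; case: eqP => // h; case/negP: aY.
have -> : adjf Y2 = e ^+ 2 *: adjf (adjf C).
  by rewrite h; move: (adjf C) => Z; r6; ring.
by rewrite adjfK dC mulr0 scale0r scaler0.
Qed.

(** A form with zero adjugate is c p^2, so this only puts [dbl_hat_0] and
    [dbl_hat_sqf] together. *)
Lemma dbl_hat_rank_le1 Y1 Y2 : adjf Y2 = 0 -> (q - 1) * dbl_hat Y1 Y2 =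
  q ^+ 8 * sqdiv_count Y1 Y2 + q ^+ 6 * (q - 1 - zero_count Y1 Y2).
Proof.
move=> /(adjf0_sqf nz2)[d [P [P0 ->]]].
have [->|d0] := eqVneq d 0; first by rewrite sqf0 dbl_hat_0.
exact: dbl_hat_sqf.
Qed.

(** * Transform of the singular pencils in terms of incidence counts *)

(** The sum is over the members A + t B and B, which represent the points of the
    projective line. *)
Definition dbl_count A B : K := \sum_t (dbl_member (A + t *: B) B)%:R + (dbl_member B A)%:R.

(** The substitution A := C - t B moves the member C to the first place, and acts
    on the dual variables by (A', B' - t A'). *)
Lemma hat2_dbl_count A' B' : hat2 dbl_count A' B' =
  \sum_t dbl_hat A' (B' - t *: A') + dbl_hat B' A'.
Proof.
rewrite hat2_D hat2_sum; congr (_ + _).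
  apply: eq_bigr => t _; rewrite /dbl_hat /hat2 exchange_big [RHS]exchange_big /=.
  apply: eq_bigr => B _; rewrite (reindex_inj (addIr (- (t *: B)))) /=.
  apply: eq_bigr => A _; rewrite subrK -!chiD; congr (_ * chi _).
  rewrite form_pairingDl // -scaleNr form_pairingZl // -scaleNr.
  rewrite ![form_pairing B _](form_pairingC nz2) form_pairingDl // form_pairingZl //.
  by rewrite (form_pairingC nz2 A'); ring.
rewrite /dbl_hat /hat2 exchange_big; apply: eq_bigr => B _; apply: eq_bigr => A _.
by rewrite [chi _ * chi _]mulrC.
Qed.

Lemma sing_dbl_count A B : (pencil_disc A B == 0)%:R = dbl_count A B - q * (all_singular A B)%:R.
Proof.
have n : (0 < 2)%N by [].
have := count_dblroot nz2 (det4 A) (form_pairing (adjf A) B) (form_pairing (adjf B) A) (det4 B).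
move=> /(congr1 (fun n => n%:R : K)); rewrite !natrD natrM.
rewrite -/(all_singular A B) -/(pencil_disc A B) => e.
apply/eqP; rewrite eq_sym subr_eq -e eq_sym; apply/eqP.
rewrite /dbl_count; congr (_ + _); last by rewrite /dbl_member andbC.
rewrite -sum1_card natr_sum big_mkcond; apply: eq_bigr => t _.
rewrite inE /dblroot /dbl_member det4D // pairing_adjfD //.
by case: (_ && _).
Qed.

Definition sing_hat A B : K := hat2 (fun A B => (pencil_disc A B == 0)%:R) A B.

Lemma sing_hatE A' B' : (q - 1) * sing_hat A' B' =
  \sum_t (q - 1) * dbl_hat A' (B' - t *: A') + (q - 1) * dbl_hat B' A'
  - q ^+ 7 * (div_count A' B' + ker_count A' B') + q ^+ 5 * tangent_count A' B' + q ^+ 6 * ker_count A' B' - (q - 1) * q ^+ 4.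
Proof.
rewrite /sing_hat (@hat2_ext _ (fun A B => dbl_count A B + (- q) * (all_singular A B)%:R)); last first.
  by move=> A B; rewrite sing_dbl_count mulNr.
rewrite hat2_D hat2_Z hat2_dbl_count -mulr_sumr mulrDr mulrCA hat2_all_singular //.
ring.
Qed.

(** * Evaluation for pencils without a common linear factor *)

Definition rank1_count A B : K := \sum_t (adjf (B - t *: A) == 0)%:R + (adjf A == 0)%:R.

Lemma sqdiv_count_nodiv A B : (forall p, p != 0 -> ~ common_div A B p) -> sqdiv_count A B = 0.
Proof.
move=> h; rewrite /sqdiv_count big1 // => p p0; rewrite nb_quotE // nb_sqfE // -natrM mulnb.
case: (boolP (_ && _)) => // /andP[/existsP[a /eqP ea] /existsP[c /eqP ec]].
case: (h p p0); exists a, (c *: p); split=> //.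
by rewrite ec; r6; ring.
Qed.

Lemma common_div_sub A B t p : common_div A (B - t *: A) p -> common_div A B p.
Proof.
move=> [a [b [ea eb]]]; exists a, (b + t *: a); split=> //.
rewrite -[B](subrK (t *: A)) eb ea; r6; ring.
Qed.

Lemma common_divC A B p : common_div A B p -> common_div B A p.
Proof. by move=> [a [b [? ?]]]; exists b, a. Qed.

Lemma zero_count_sub A B t : zero_count A (B - t *: A) = zero_count A B.
Proof.
apply: eq_bigr => p _; rewrite -scaleNr qfDl.
by have [->|] := eqVneq (qf A p) 0; rewrite ?mulr0 ?addr0.
Qed.

Lemma zero_countC A B : zero_count A B = zero_count B A.
Proof. by apply: eq_bigr => p _; rewrite andbC. Qed.

(** Without a common factor [div_count] and all the [sqdiv_count] vanish, and all
    members of rank one contribute equally. *)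
Lemma sing_hat_nodiv A B : (forall p, p != 0 -> ~ common_div A B p) ->
  (q - 1) * sing_hat A B = rank1_count A B * q ^+ 6 * (q - 1 - zero_count A B)
    - q ^+ 7 * ker_count A B + q ^+ 5 * tangent_count A B + q ^+ 6 * ker_count A B - (q - 1) * q ^+ 4.
Proof.
move=> h; rewrite sing_hatE //.
have d Y1 Y2 : (forall p, p != 0 -> ~ common_div Y1 Y2 p) ->
    (q - 1) * dbl_hat Y1 Y2 = (adjf Y2 == 0)%:R * q ^+ 6 * (q - 1 - zero_count Y1 Y2).
  move=> h'; have [aY|aY] := eqVneq (adjf Y2) 0.
    by rewrite dbl_hat_rank_le1 // sqdiv_count_nodiv // mulr0 add0r mul1r.
  by rewrite dbl_hat_rank_gt1 // mulr0 !mul0r.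
rewrite d => [|p p0 /common_divC]; last exact: h.
rewrite (eq_bigr (fun t => (adjf (B - t *: A) == 0)%:R * (q ^+ 6 * (q - 1 - zero_count A B)))); last first.
  move=> t _; rewrite d => [|p p0 /common_div_sub]; last exact: h.
  by rewrite zero_count_sub mulrA.
rewrite -mulr_suml zero_countC.
have -> : div_count A B = 0.
  by rewrite div_countE big1 // => p p0; case: common_divP => // /(h p p0).
rewrite /rank1_count; ring.
Qed.

(** A pencil with a nonsingular member has neither common factors nor common
    kernel vectors. *)
Lemma sing_hat_nondeg A B : ~~ all_singular A B ->
  (q - 1) * sing_hat A B = rank1_count A B * q ^+ 6 * (q - 1 - zero_count A B) + q ^+ 5 * tangent_count A B - (q - 1) * q ^+ 4.
Proof.
move=> nA; rewrite sing_hat_nodiv => [|p p0 /(common_div_all_singular nz2)]; last by apply/negP.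
have -> : ker_count A B = 0 by apply/eqP; apply: contraNT nA => /ker_count_neq0.
ring.
Qed.

Lemma cnt_axis (P : pred 'rV[F]_3) :
  (forall v, P v = (v 0 1 == 0) && (v 0 2 == 0)) -> \sum_(v | v != 0) (P v)%:R = q - 1.
Proof.
move=> h; apply: (@cnt_line1 P (row3 1 0 0)) => [|v].
  by apply/eqP => /rowP/(_ 0)/eqP; coord; rewrite oner_eq0.
rewrite h; split=> [/andP[/eqP h1 /eqP h2]|[t ->]].
  by exists (v 0 0); r3; rewrite ?mulr1 ?mulr0.
by coord; rewrite !mulr0 eqxx.
Qed.

Lemma cnt_plane (P : pred 'rV[F]_3) r : r != 0 ->
  (forall v, P v = (dot v r == 0)) -> \sum_(v | v != 0) (P v)%:R = q ^+ 2 - 1.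
Proof.
move=> r0 h; rewrite (eq_bigr (fun v => (dot v r == 0)%:R)) => [|v _]; last by rewrite h.
by rewrite sum_neq0 (cnt_orth r0) dotC dotr0 eqxx.
Qed.

Lemma cnt_none (P : pred 'rV[F]_3) : (forall v, P v -> v = 0) ->
  \sum_(v | v != 0) (P v)%:R = 0 :> K.
Proof.
move=> h; rewrite big1 // => v v0; case: (boolP (P v)) => // /h v1.
by rewrite v1 eqxx in v0.
Qed.

Lemma cross_eq0 v w : (cross v w == 0) = [&& v 0 1 * w 0 2 == v 0 2 * w 0 1,
  v 0 2 * w 0 0 == v 0 0 * w 0 2 & v 0 0 * w 0 1 == v 0 1 * w 0 0].
Proof.
apply/eqP/and3P => [/rowP h|[/eqP h0 /eqP h1 /eqP h2]].
  have := h 0; have := h 1; have := h 2; coord => h2 h1 h0.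
  by split; rewrite -subr_eq0 ?h0 ?h1 ?h2.
by r3; rewrite ?h0 ?h1 ?h2 subrr.
Qed.

Lemma row3_eq0 v : (v == 0) = [&& v 0 0 == 0, v 0 1 == 0 & v 0 2 == 0].
Proof.
apply/eqP/and3P => [->|[/eqP h0 /eqP h1 /eqP h2]]; first by coord; rewrite eqxx.
by r3.
Qed.

(** The zeros of a common factor fill a line, not just a point. *)
Lemma nodiv_axis A B : (forall v, qf A v = 0 -> qf B v = 0 -> v 0 1 = 0 /\ v 0 2 = 0) ->
  forall p, p != 0 -> ~ common_div A B p.
Proof.
move=> h p p0 [a [b [eA eB]]].
have k (e : 'rV[F]_3) : cross p e 0 1 = 0 /\ cross p e 0 2 = 0.
  by apply: h; rewrite ?eA ?eB qf_lmul dot_crossl mul0r.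
have [] := k (row3 1 0 0); coord; rewrite !mulr1 !mulr0 subr0 sub0r => e2 /eqP.
rewrite oppr_eq0 => /eqP e1; have [_] := k (row3 0 1 0); coord; rewrite mulr1 mulr0 subr0 => e0.
by move: p0; rewrite row3_eq0 e0 e1 e2 eqxx.
Qed.

Lemma rank1_count0 A B : adjf A != 0 -> (forall t, adjf (B - t *: A) != 0) -> rank1_count A B = 0.
Proof.
move=> hA hB; rewrite /rank1_count (negPf hA) addr0 big1 // => t _.
by rewrite (negPf (hB t)).
Qed.

Lemma rank1_count1 A B : adjf A = 0 -> (forall t, adjf (B - t *: A) != 0) -> rank1_count A B = 1.
Proof.
move=> hA hB; rewrite /rank1_count hA eqxx big1 ?add0r // => t _.
by rewrite (negPf (hB t)).
Qed.

Lemma row_neq0 n (C : 'rV[F]_n) i : C 0 i != 0 -> C != 0.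
Proof. by apply: contraNneq => ->; rewrite mxE. Qed.

(** Pencils in the two variables v and w: the only common zero is the common kernel,
    so that members of rank one do not contribute. *)
Lemma sing_hat_axis A B : (forall v, (qf A v == 0) && (qf B v == 0) -> v 0 1 = 0 /\ v 0 2 = 0) ->
  (forall v, v 0 1 = 0 -> v 0 2 = 0 -> common_ker A B v) -> 
  (q - 1) * sing_hat A B = (q - 1) * (- q ^+ 7 + q ^+ 6 + q ^+ 5 - q ^+ 4).
Proof.
move=> h1 h2.
have qf0 C v : grad C v = 0 -> qf C v = 0.
  by move=> h; apply: (mulfI nz2); rewrite -dot_grad h dotr0 mulr0.
have Z v : (qf A v == 0) && (qf B v == 0) = (v 0 1 == 0) && (v 0 2 == 0).
  apply/idP/andP => [/h1[-> ->]|[/eqP e1 /eqP e2]]; first by rewrite eqxx.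
  by have /andP[/eqP/qf0 -> /eqP/qf0 ->] := h2 v e1 e2; rewrite eqxx.
have Kv v : common_ker A B v = (v 0 1 == 0) && (v 0 2 == 0).
  apply/idP/andP => [/andP[/eqP/qf0 e1 /eqP/qf0 e2]|[/eqP e1 /eqP e2]]; last exact: h2.
  by have [] := h1 v; rewrite ?e1 ?e2 ?eqxx // => -> ->.
rewrite sing_hat_nodiv; last first.
  by apply: nodiv_axis => v e1 e2; apply: h1; rewrite e1 e2 eqxx.
have -> : zero_count A B = q - 1 by apply: cnt_axis.
have -> : ker_count A B = q - 1 by apply: cnt_axis.
have -> : tangent_count A B = q - 1.
  apply: cnt_axis => v; rewrite andbA Z -Kv.
  case: (boolP (common_ker A B v)) => //= /andP[/eqP -> _].
  by rewrite cross_eq0; coord; rewrite !mul0r !eqxx.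
ring.
Qed.

(** One singular base point, and either no member of rank one or no other base
    point. *)
Lemma sing_hat_onepoint A B : ~~ all_singular A B ->
  rank1_count A B * (q - 1 - zero_count A B) = 0 ->
  tangent_count A B = q - 1 ->
  (q - 1) * sing_hat A B = (q - 1) * (q ^+ 5 - q ^+ 4).
Proof. by move=> nA U L; rewrite sing_hat_nondeg // mulrAC U L; ring. Qed.

Lemma sing_hat_nopoint A B : ~~ all_singular A B -> rank1_count A B = 0 -> tangent_count A B = 0 ->
  (q - 1) * sing_hat A B = (q - 1) * - q ^+ 4.
Proof. by move=> nA U L; rewrite sing_hat_nondeg // U L; ring. Qed.

Lemma nonsquare_form l : (forall y : F, y ^+ 2 != l) -> forall x y : F, x ^+ 2 = l * y ^+ 2 ->
  x = 0 /\ y = 0.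
Proof.
move=> hl x y e; have [y0|y0] := eqVneq y 0.
  by move: e; rewrite y0 expr0n mulr0 => /eqP; rewrite sqrf_eq0 => /eqP.
by case/eqP: (hl (x / y)); rewrite expr_div_n e mulfK // expf_neq0.
Qed.

(** * Representatives without a common linear factor *)

Variable l : F.
Hypothesis l_neq0 : l != 0.
Hypothesis l_ns : forall y : F, y ^+ 2 != l.

Lemma uuE : uu F = row6 1 0 0 0 0 0. Proof. by apply: row6P; rewrite !mxE. Qed.
Lemma uvE : uv F = row6 0 1 0 0 0 0. Proof. by apply: row6P; rewrite !mxE. Qed.
Lemma uwE : uw F = row6 0 0 1 0 0 0. Proof. by apply: row6P; rewrite !mxE. Qed.
Lemma vvE : vv F = row6 0 0 0 1 0 0. Proof. by apply: row6P; rewrite !mxE. Qed.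
Lemma vwE : vw F = row6 0 0 0 0 1 0. Proof. by apply: row6P; rewrite !mxE. Qed.
Lemma wwE : ww F = row6 0 0 0 0 0 1. Proof. by apply: row6P; rewrite !mxE. Qed.

Lemma qfD A B v : qf (A + B) v = qf A v + qf B v. Proof. coord; ring. Qed.
Lemma qfN A v : qf (- A) v = - qf A v. Proof. coord; ring. Qed.
Lemma qfZ t A v : qf (t *: A) v = t * qf A v. Proof. coord; ring. Qed.
Lemma qf_uu v : qf (uu F) v = v 0 0 ^+ 2. Proof. by rewrite uuE; coord; ring. Qed.
Lemma qf_uv v : qf (uv F) v = v 0 0 * v 0 1. Proof. by rewrite uvE; coord; ring. Qed.
Lemma qf_uw v : qf (uw F) v = v 0 0 * v 0 2. Proof. by rewrite uwE; coord; ring. Qed.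
Lemma qf_vv v : qf (vv F) v = v 0 1 ^+ 2. Proof. by rewrite vvE; coord; ring. Qed.
Lemma qf_vw v : qf (vw F) v = v 0 1 * v 0 2. Proof. by rewrite vwE; coord; ring. Qed.
Lemma qf_ww v : qf (ww F) v = v 0 2 ^+ 2. Proof. by rewrite wwE; coord; ring. Qed.

Lemma gradD A B v : grad (A + B) v = grad A v + grad B v. Proof. r3; ring. Qed.
Lemma gradN A v : grad (- A) v = - grad A v. Proof. r3; ring. Qed.
Lemma gradZ t A v : grad (t *: A) v = t *: grad A v. Proof. r3; ring. Qed.
Lemma grad_uu v : grad (uu F) v = row3 (2%:R * v 0 0) 0 0.
Proof. by rewrite uuE; r3; ring. Qed.
Lemma grad_uv v : grad (uv F) v = row3 (v 0 1) (v 0 0) 0.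
Proof. by rewrite uvE; r3; ring. Qed.
Lemma grad_uw v : grad (uw F) v = row3 (v 0 2) 0 (v 0 0).
Proof. by rewrite uwE; r3; ring. Qed.
Lemma grad_vv v : grad (vv F) v = row3 0 (2%:R * v 0 1) 0.
Proof. by rewrite vvE; r3; ring. Qed.
Lemma grad_vw v : grad (vw F) v = row3 0 (v 0 2) (v 0 1).
Proof. by rewrite vwE; r3; ring. Qed.
Lemma grad_ww v : grad (ww F) v = row3 0 0 (2%:R * v 0 2).
Proof. by rewrite wwE; r3; ring. Qed.

Ltac qv := rewrite ?(qfD, qfN, qfZ, qf_uu, qf_uv, qf_uw, qf_vv, qf_vw, qf_ww, qf0l).
Ltac gv := rewrite ?(gradD, gradN, gradZ, grad_uu, grad_uv, grad_uw, grad_vv, grad_vw, grad_ww, grad0l).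
Ltac zero := coord; rewrite ?(mulr0, mul0r, addr0, add0r, subr0, sub0r, oppr0, eqxx).
Ltac calc := rewrite ?(uuE, uvE, uwE, vvE, vwE, wwE); coord; by [ring | field].

Lemma not_all_singular1 A B c : det4 A = c -> c != 0 -> ~~ all_singular A B.
Proof. by move=> <-; apply: contraNN => /and4P[]. Qed.
Lemma not_all_singular2 A B c : form_pairing (adjf A) B = c -> c != 0 -> ~~ all_singular A B.
Proof. by move=> <-; apply: contraNN => /and4P[]. Qed.
Lemma not_all_singular3 A B c : form_pairing (adjf B) A = c -> c != 0 -> ~~ all_singular A B.
Proof. by move=> <-; apply: contraNN => /and4P[]. Qed.
Lemma not_all_singular4 A B c : det4 B = c -> c != 0 -> ~~ all_singular A B.
Proof. by move=> <-; apply: contraNN => /and4P[]. Qed.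
Lemma adjf_entry C i c : adjf C 0 i = c -> c != 0 -> adjf C != 0.
Proof. by move=> <-; apply: row_neq0. Qed.
Lemma oppr1_neq0 : - 1 != 0 :> F. Proof. by rewrite oppr_eq0 oner_eq0. Qed.

Lemma sqr_eq0 (x : F) : x ^+ 2 = 0 -> x = 0.
Proof. by move=> /eqP; rewrite sqrf_eq0 => /eqP. Qed.

Lemma sing_hat_D2 : (q - 1) * sing_hat 0 (vv F - l *: ww F) =
  (q - 1) * (- q ^+ 7 + q ^+ 6 + q ^+ 5 - q ^+ 4).
Proof.
apply: sing_hat_axis => // v.
  qv => /andP[_ /eqP e]; apply: (nonsquare_form l_ns).
  by apply/eqP; rewrite -subr_eq0 e.
by move=> e1 e2; rewrite /common_ker; gv; rewrite !row3_eq0 e1 e2; zero.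
Qed.

Lemma sing_hat_B11 : (q - 1) * sing_hat (ww F) (vv F) =
  (q - 1) * (- q ^+ 7 + q ^+ 6 + q ^+ 5 - q ^+ 4).
Proof.
apply: sing_hat_axis => // v.
  by qv => /andP[/eqP/sqr_eq0 -> /eqP/sqr_eq0 ->].
by move=> e1 e2; rewrite /common_ker; gv; rewrite !row3_eq0 e1 e2; zero.
Qed.

Lemma sing_hat_B2 : (q - 1) * sing_hat (vw F) (vv F + l *: ww F) =
  (q - 1) * (- q ^+ 7 + q ^+ 6 + q ^+ 5 - q ^+ 4).
Proof.
apply: sing_hat_axis => // v.
  qv; rewrite mulf_eq0 => /andP[/orP[] /eqP ->].
    by rewrite expr0n add0r mulf_eq0 (negPf l_neq0) /= => /eqP/sqr_eq0.
  by rewrite expr0n mulr0 addr0 => /eqP/sqr_eq0.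
by move=> e1 e2; rewrite /common_ker; gv; rewrite !row3_eq0 e1 e2; zero.
Qed.

Lemma sing_hat_1p4 : (q - 1) * sing_hat (ww F) (uw F + vv F) = (q - 1) * (q ^+ 5 - q ^+ 4).
Proof.
have Z v : (qf (ww F) v == 0) && (qf (uw F + vv F) v == 0) = (v 0 1 == 0) && (v 0 2 == 0).
  qv; apply/andP/andP => [[/eqP/sqr_eq0 -> ]|[/eqP -> /eqP ->]]; last by rewrite expr0n mulr0 addr0 eqxx.
  by rewrite mulr0 add0r => /eqP/sqr_eq0 ->; rewrite eqxx.
apply: sing_hat_onepoint => //.
- by apply: (@not_all_singular4 _ _ (- 1)); [calc|exact: oppr1_neq0].
- have -> : zero_count _ _ = q - 1 := cnt_axis Z.
  by rewrite subrr mulr0.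
- apply: cnt_axis => v; rewrite andbA Z.
  case: (boolP ((v 0 1 == 0) && (v 0 2 == 0))) => //= /andP[/eqP e1 /eqP e2]; gv.
  by rewrite cross_eq0 e1 e2; zero.
Qed.

Lemma sing_hat_1sq_2 : (q - 1) * sing_hat (vv F - l *: ww F) (uw F) = (q - 1) * (q ^+ 5 - q ^+ 4).
Proof.
have Z v : (qf (vv F - l *: ww F) v == 0) && (qf (uw F) v == 0) = (v 0 1 == 0) && (v 0 2 == 0).
  qv; apply/andP/andP => [[/eqP e _]|[/eqP -> /eqP ->]]; last by rewrite expr0n !mulr0 subr0 eqxx.
  have [] := nonsquare_form l_ns (x := v 0 1) (y := v 0 2); last by move=> -> ->; rewrite eqxx.
  by apply/eqP; rewrite -subr_eq0 e.
apply: sing_hat_onepoint => //.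
- by apply: (@not_all_singular3 _ _ (- 1)); [calc|exact: oppr1_neq0].
- have -> : zero_count _ _ = q - 1 := cnt_axis Z.
  by rewrite subrr mulr0.
- apply: cnt_axis => v; rewrite andbA Z.
  case: (boolP ((v 0 1 == 0) && (v 0 2 == 0))) => //= /andP[/eqP e1 /eqP e2]; gv.
  by rewrite cross_eq0 e1 e2; zero.
Qed.

Lemma sing_hat_1p3_1 : (q - 1) * sing_hat (vw F) (uw F + vv F) = (q - 1) * (q ^+ 5 - q ^+ 4).
Proof.
apply: sing_hat_onepoint => //.
- by apply: (@not_all_singular4 _ _ (- 1)); [calc|exact: oppr1_neq0].
- rewrite rank1_count0 ?mul0r //.
    by apply: (@adjf_entry _ 0 (- 1)); [calc|exact: oppr1_neq0].
  by move=> t; apply: (@adjf_entry _ 3 (- 1)); [calc|exact: oppr1_neq0].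
- apply: cnt_axis => v; qv; gv; rewrite cross_eq0; coord.
  apply/and3P/andP => [[_ /eqP e /and3P[_ _ /eqP h]]|[/eqP -> /eqP ->]]; last first.
    by rewrite !(mulr0, mul0r, addr0, add0r, expr0n) /= !eqxx.
  have z0 : v 0 2 = 0 by apply: sqr_eq0; rewrite expr2 -[LHS]add0r; move: h; rewrite !(mul0r, addr0, add0r).
  by move: e; rewrite z0 mulr0 add0r => /sqr_eq0 ->; rewrite eqxx.
Qed.

Lemma sing_hat_1sq_11 : (q - 1) * sing_hat (vv F - ww F) (uw F) = (q - 1) * (q ^+ 5 - q ^+ 4).
Proof.
apply: sing_hat_onepoint => //.
- by apply: (@not_all_singular3 _ _ (- 1)); [calc|exact: oppr1_neq0].
- rewrite rank1_count0 ?mul0r //.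
    by apply: (@adjf_entry _ 0 (- 4%:R)); [calc|rewrite oppr_eq0].
  by move=> t; apply: (@adjf_entry _ 3 (- 1)); [calc|exact: oppr1_neq0].
- apply: cnt_axis => v; qv; gv; rewrite cross_eq0; coord.
  apply/and3P/andP => [[/eqP e _ /and3P[_ /eqP h _]]|[/eqP -> /eqP ->]]; last first.
    by rewrite !(mulr0, mul0r, addr0, add0r, expr0n, subr0, oppr0) /= !eqxx.
  have z0 : v 0 2 = 0.
    apply: sqr_eq0; apply: (mulfI nz2); apply/eqP; rewrite mulr0.
    by move: h => /eqP; rewrite -subr_eq0 => /eqP h; rewrite -oppr_eq0 -h; apply/eqP; ring.
  by move: e; rewrite z0 expr0n subr0 => /sqr_eq0 ->; rewrite eqxx.
Qed.

Lemma mul_eq0_or (x y : F) : x * y = 0 -> x = 0 \/ y = 0.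
Proof. by move/eqP; rewrite mulf_eq0 => /orP[] /eqP ->; [left|right]. Qed.

Lemma sing_hat_1111 : (q - 1) * sing_hat (uw F - vw F) (uv F - vw F) = (q - 1) * - q ^+ 4.
Proof.
apply: sing_hat_nopoint => //.
- by apply: (@not_all_singular2 _ _ (- 1)); [calc|exact: oppr1_neq0].
- apply: rank1_count0; first by apply: (@adjf_entry _ 3 (- 1)); [calc|exact: oppr1_neq0].
  by move=> t; apply: (@adjf_entry _ 5 (- 1)); [calc|exact: oppr1_neq0].
apply: cnt_none => v; qv; gv; rewrite cross_eq0; coord.
move: (v 0 0) (v 0 1) (v 0 2) (row3_eq0 v) => x y z E.
case/and5P => /eqP h1 /eqP h2 /eqP c0 /eqP c1 /eqP c2; apply/eqP; rewrite {}E.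
have {h1} : z * (x - y) = 0 by rewrite -h1; ring.
case/mul_eq0_or => [z0|xy].
  have xx : x = 0.
    have : x * y = 0 by rewrite -h2 z0; ring.
    case/mul_eq0_or => [//|y0]; apply: sqr_eq0.
    apply/eqP; move/eqP: c0; rewrite -subr_eq0 => /eqP c0; rewrite -oppr_eq0 -c0 z0 y0; apply/eqP; ring.
  have y0 : y = 0.
    apply: sqr_eq0; apply/eqP; move/eqP: c1; rewrite -subr_eq0 => /eqP c1; rewrite -oppr_eq0 -c1 z0 xx.
    by apply/eqP; ring.
  by rewrite xx y0 z0 eqxx.
have {xy} xy : x = y by apply/eqP; rewrite -subr_eq0 xy.
have : z * y = 0.
  apply/eqP; move/eqP: c0; rewrite -subr_eq0 => /eqP c0; rewrite -c0 xy; apply/eqP; ring.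
case/mul_eq0_or => [z0|y0].
  have y0 : y = 0 by apply: sqr_eq0; rewrite -h2 z0 xy; ring.
  by rewrite xy y0 z0 eqxx.
have z0 : z = 0.
  apply: sqr_eq0; apply/eqP; move/eqP: c2; rewrite -subr_eq0 => /eqP c2; rewrite -oppr_eq0 -c2 xy y0.
  by apply/eqP; ring.
by rewrite xy y0 z0 eqxx.
Qed.

(** For both values k = 1 and k = l the four base points are distinct. *)
Lemma sing_hat_split (k : F) : k != 0 ->
  (q - 1) * sing_hat (vw F) (uu F - k *: vv F - l *: ww F) = (q - 1) * - q ^+ 4.
Proof.
move=> k0; apply: sing_hat_nopoint => //.
- apply: (@not_all_singular4 _ _ (4%:R * k * l)); [calc|by rewrite !mulf_neq0].
- apply: rank1_count0; first by apply: (@adjf_entry _ 0 (- 1)); [calc|exact: oppr1_neq0].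
  by move=> t; apply: (@adjf_entry _ 5 (- (4%:R * k))); [calc|by rewrite oppr_eq0 mulf_neq0].
apply: cnt_none => v; qv; gv; rewrite cross_eq0; coord.
move: (v 0 0) (v 0 1) (v 0 2) (row3_eq0 v) => x y z E.
case/and5P => /eqP h1 /eqP h2 /eqP c0 /eqP _ /eqP _; apply/eqP; rewrite {}E.
have {c0} c0 : k * y ^+ 2 - l * z ^+ 2 = 0.
  apply: (mulfI nz2); rewrite mulr0; move/eqP: c0; rewrite -subr_eq0 => /eqP <-; ring.
have yz : y = 0 /\ z = 0.
  case/mul_eq0_or: h1 => e; split=> //; move/eqP: c0; rewrite e expr0n ?(mulr0, sub0r, subr0) ?oppr_eq0 mulf_eq0.
    by rewrite (negPf l_neq0) => /eqP/sqr_eq0.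
  by rewrite (negPf k0) => /eqP/sqr_eq0.
case: yz => y0 z0; rewrite y0 z0 !eqxx !andbT; apply/eqP/sqr_eq0; rewrite -h2 y0 z0; ring.
Qed.

Lemma sing_hat_112 : (q - 1) * sing_hat (vw F) (uu F - vv F - l *: ww F) = (q - 1) * - q ^+ 4.
Proof. by rewrite -(sing_hat_split (oner_neq0 F)) scale1r. Qed.

Lemma sing_hat_22 : (q - 1) * sing_hat (vw F) (uu F - l *: vv F - l *: ww F) = (q - 1) * - q ^+ 4.
Proof. exact: sing_hat_split. Qed.

Definition ax1 : 'rV[F]_3 := row3 1 0 0.
Definition ax2 : 'rV[F]_3 := row3 0 1 0.
Definition ax3 : 'rV[F]_3 := row3 0 0 1.
Lemma ax2_neq0 : ax2 != 0.
Proof. by apply: (@row_neq0 _ _ 1); rewrite row3_1 oner_eq0. Qed.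
Lemma ax3_neq0 : ax3 != 0.
Proof. by apply: (@row_neq0 _ _ 2); rewrite row3_2 oner_eq0. Qed.
Lemma dot_ax2 v : dot v ax2 = v 0 1. Proof. rewrite /ax2; coord; ring. Qed.
Lemma dot_ax3 v : dot v ax3 = v 0 2. Proof. rewrite /ax3; coord; ring. Qed.

Lemma adjf_ww : adjf (ww F) = 0.
Proof.
have -> : ww F = sqf 1 ax3 by rewrite wwE /ax3; r6; ring.
exact: adjf_sqf.
Qed.

Lemma adjf0 : adjf (0 : 'rV[F]_6) = 0.
Proof. by have := adjf_sqf (0 : F) 0; rewrite sqf0. Qed.

(** Off the line u = v = 0 of the cone, w is determined by u and v; the substitution
    by h straightens this part to the plane w = 0. *)
Lemma cnt_cone : \sum_(v : 'rV[F]_3 | v != 0) (v 0 0 ^+ 2 - v 0 1 * v 0 2 == 0)%:R = q ^+ 2 - 1.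
Proof.
rewrite sum_neq0.
have -> : ((0 : 'rV[F]_3) 0 0 ^+ 2 - (0 : 'rV[F]_3) 0 1 * (0 : 'rV[F]_3) 0 2 == 0)%:R = 1 :> K.
  by zero; rewrite expr0n eqxx.
congr (_ - _).
transitivity (\sum_(v : 'rV[F]_3) ((v 0 1 == 0) && (v 0 0 == 0))%:R +
   \sum_(v : 'rV[F]_3) ((v 0 1 != 0) && (v 0 2 == v 0 0 ^+ 2 / v 0 1))%:R : K).
  rewrite -big_split; apply: eq_bigr => v _ /=.
  have [->|y0] := eqVneq (v 0 1) 0; first by rewrite mul0r subr0 sqrf_eq0 addr0.
  rewrite add0r /= subr_eq0 eq_sym; congr (nat_of_bool _)%:R.
  apply/eqP/eqP => [<-|->]; first by rewrite mulrAC mulfV // mul1r.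
  by rewrite mulrC divfK.
rewrite (@cnt_line _ ax3); [|exact: ax3_neq0|]; last first.
  move=> v; split=> [/andP[/eqP h1 /eqP h0]|[t ->]].
    by exists (v 0 2); rewrite /ax3; r3; rewrite ?h0 ?h1; ring.
  by rewrite /ax3; zero.
(* On the rest w = u^2 / v; shear this graph to w = 0. *)
pose h (v : 'rV[F]_3) := row3 (v 0 0) (v 0 1) (v 0 2 + v 0 0 ^+ 2 / v 0 1).
have h_inj : injective h.
  move=> v w /rowP e; have := e 0; have := e 1; have := e 2; rewrite /h; coord => e2' e1' e0'.
  by apply: row3P => //; move: e2'; rewrite e0' e1' => /addIr.
rewrite (reindex_inj h_inj) /=.
transitivity (q + (\sum_(v : 'rV[F]_3) (dot v ax3 == 0)%:R -
     \sum_(v : 'rV[F]_3) ((v 0 1 == 0) && (v 0 2 == 0))%:R)).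
  congr (_ + _); rewrite -sumrB; apply: eq_bigr => v _; rewrite dot_ax3 /h; coord.
  have -> : (v 0 2 + v 0 0 ^+ 2 / v 0 1 == v 0 0 ^+ 2 / v 0 1) = (v 0 2 == 0).
    by rewrite -subr_eq0 addrK.
  by case: (v 0 1 == 0); case: (v 0 2 == 0); rewrite /= ?subrr ?subr0.
rewrite (cnt_orth ax3_neq0) (@cnt_line _ ax1); first by ring.
  by apply: (@row_neq0 _ _ 0); rewrite row3_0 oner_eq0.
move=> v; split=> [/andP[/eqP h1 /eqP h0]|[t ->]].
  by exists (v 0 0); rewrite /ax1; r3; rewrite ?h0 ?h1; ring.
by rewrite /ax1; zero.
Qed.

Lemma sing_hat_Dns : (q - 1) * sing_hat 0 (uu F - vw F) =
  (q - 1) * (- q ^+ 7 + q ^+ 6 + q ^+ 5 - q ^+ 4).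
Proof.
have na : ~~ all_singular 0 (uu F - vw F).
  by apply: (@not_all_singular4 _ _ (- 1)); [calc|exact: oppr1_neq0].
rewrite sing_hat_nondeg // rank1_count1; [|exact: adjf0|]; last first.
  by move=> t; rewrite scaler0 subr0; apply: (@adjf_entry _ 0 (- 1)); [calc|exact: oppr1_neq0].
have -> : zero_count 0 (uu F - vw F) = q ^+ 2 - 1.
  by rewrite -cnt_cone; apply: eq_bigr => v _; qv; rewrite eqxx.
have -> : tangent_count 0 (uu F - vw F) = q ^+ 2 - 1.
  rewrite -cnt_cone; apply: eq_bigr => v _; qv; gv; rewrite eqxx cross_eq0.
  by congr (nat_of_bool _)%:R; zero; rewrite /= andbT.
ring.
Qed.

Lemma sing_hat_1sq_1sq : (q - 1) * sing_hat (ww F) (uu F - vv F) =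
  (q - 1) * (- q ^+ 6 + 2%:R * q ^+ 5 - q ^+ 4).
Proof.
have na : ~~ all_singular (ww F) (uu F - vv F).
  by apply: (@not_all_singular3 _ _ (- 4%:R)); [calc|rewrite oppr_eq0].
rewrite sing_hat_nondeg // rank1_count1; [|exact: adjf_ww|]; last first.
  by move=> t; apply: (@adjf_entry _ 5 (- 4%:R)); [calc|rewrite oppr_eq0].
have Z v : (qf (ww F) v == 0) && (qf (uu F - vv F) v == 0) =
   (dot v ax3 == 0) && (v 0 0 ^+ 2 == v 0 1 ^+ 2).
  by qv; rewrite sqrf_eq0 subr_eq0 dot_ax3.
have cnt : \sum_(v | v != 0) ((qf (ww F) v == 0) && (qf (uu F - vv F) v == 0))%:R = 2%:R * (q - 1) :> K.
  transitivity (\sum_(v : 'rV[F]_3 | v != 0) ((v 0 2 == 0) && (v 0 0 == v 0 1))%:R +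
     \sum_(v : 'rV[F]_3 | v != 0) ((v 0 2 == 0) && (v 0 0 == - v 0 1))%:R : K).
    rewrite -big_split; apply: eq_bigr => v v0 /=; rewrite Z dot_ax3 eqf_sqr.
    have [z0|//] := eqVneq (v 0 2) 0; last by rewrite addr0.
    have [e|ne] /= := eqVneq (v 0 0) (v 0 1); last by rewrite add0r.
    rewrite e; have [e'|//] := eqVneq (v 0 1) (- v 0 1); last by rewrite addr0.
    case/negP: v0; have y0 : v 0 1 = 0.
      by apply: (mulfI nz2); rewrite mulr0 mulr_natl mulr2n {1}e' addNr.
    by rewrite row3_eq0 e y0 z0 eqxx.
  rewrite (@cnt_line1 _ (row3 1 1 0)); last 2 first.
  - by apply: (@row_neq0 _ _ 0); rewrite row3_0 oner_eq0.
  - move=> v; split=> [/andP[/eqP h2 /eqP h0]|[t ->]]; last by zero.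
    by exists (v 0 0); r3; rewrite ?mulr1 ?mulr0 ?h0.
  rewrite (@cnt_line1 _ (row3 1 (- 1) 0)); last 2 first.
  - by apply: (@row_neq0 _ _ 0); rewrite row3_0 oner_eq0.
  - move=> v; split=> [/andP[/eqP h2 /eqP h0]|[t ->]].
      by exists (v 0 0); r3; rewrite ?mulr1 ?mulr0 ?h0 ?mulrNN ?mulr1.
    by coord; rewrite !mulr0 mulrN opprK !eqxx.
  by ring.
have -> : zero_count (ww F) (uu F - vv F) = 2%:R * (q - 1) := cnt.
have -> : tangent_count (ww F) (uu F - vv F) = 2%:R * (q - 1).
  rewrite -cnt; apply: eq_bigr => v _; rewrite andbA Z dot_ax3.
  case: (boolP ((v 0 2 == 0) && (v 0 0 ^+ 2 == v 0 1 ^+ 2))) => //= /andP[/eqP z0 _]; gv; rewrite z0 cross_eq0; by zero.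
by ring.
Qed.

Lemma sing_hat_2sq : (q - 1) * sing_hat (ww F) (uu F - l *: vv F) = (q - 1) * (q ^+ 6 - q ^+ 4).
Proof.
have na : ~~ all_singular (ww F) (uu F - l *: vv F).
  by apply: (@not_all_singular3 _ _ (- (4%:R * l))); [calc|rewrite oppr_eq0 mulf_neq0].
rewrite sing_hat_nondeg // rank1_count1; [|exact: adjf_ww|]; last first.
  by move=> t; apply: (@adjf_entry _ 5 (- (4%:R * l))); [calc|rewrite oppr_eq0 mulf_neq0].
have Z v : (qf (ww F) v == 0) && (qf (uu F - l *: vv F) v == 0) -> v = 0.
  qv => /andP[/eqP/sqr_eq0 z0 /eqP/subr0_eq/(nonsquare_form l_ns)[x0 y0]].
  by apply/eqP; rewrite row3_eq0 x0 y0 z0 eqxx.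
have -> : zero_count (ww F) (uu F - l *: vv F) = 0 := cnt_none Z.
have -> : tangent_count (ww F) (uu F - l *: vv F) = 0.
  by apply: cnt_none => v; rewrite andbA => /andP[/Z].
by ring.
Qed.

(** The base conic u w = v^2 is parametrized by (s^2, s, 1), where a second form restricts
    to a quartic polynomial in s. *)
Lemma conic_param v : qf (uw F - vv F) v = 0 -> v 0 2 != 0 ->
  v = v 0 2 *: row3 ((v 0 1 / v 0 2) ^+ 2) (v 0 1 / v 0 2) 1.
Proof.
qv => /subr0_eq e z0; r3; rewrite ?mulr1 //; last by field.
by rewrite expr_div_n -e; field.
Qed.

Lemma conic_infinity v : qf (uw F - vv F) v = 0 -> v 0 2 = 0 -> v = v 0 0 *: ax1.
Proof.
qv => /subr0_eq e z0; move: e; rewrite z0 mulr0 => /esym/sqr_eq0 y0.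
by rewrite /ax1; r3; rewrite ?y0 ?z0 ?mulr1 ?mulr0.
Qed.

Lemma qfZr A t v : qf A (t *: v) = t ^+ 2 * qf A v.
Proof. coord; ring. Qed.

Lemma irr_noroot (P : {poly F}) s : irreducible_poly P -> (2 < size P)%N -> P.[s] != 0.
Proof.
move=> [_ irr] sP; apply/negP; rewrite -rootE -dvdp_XsubCl => /irr.
by rewrite size_XsubC => /(_ isT) /eqp_size; rewrite size_XsubC => e; rewrite -e in sP.
Qed.

Lemma size_gt_coef (P : {poly F}) n : P`_n != 0 -> (n < size P)%N.
Proof. by apply: contraNT; rewrite -leqNgt => h; rewrite nth_default. Qed.

(** A base point is (1, 0, 0) or a root s of the cubic; the latter is excluded by
    irreducibility, and at (1, 0, 0) the gradients are independent. *)
Lemma sing_hat_13 (a3 b3 c3 : F) : irreducible_poly ('X^3 + a3 *: 'X^2 + b3 *: 'X + c3%:P) ->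
  (q - 1) * sing_hat (uw F - vv F) (uv F + a3 *: vv F + b3 *: vw F + c3 *: ww F) = (q - 1) * - q ^+ 4.
Proof.
set P := (X in irreducible_poly X) => irr3; apply: sing_hat_nopoint => //.
- by apply: (@not_all_singular1 _ _ 1); [calc|exact: oner_neq0].
- apply: rank1_count0; first by apply: (@adjf_entry _ 3 (- 1)); [calc|exact: oppr1_neq0].
  by move=> t; apply: (@adjf_entry _ 5 (- 1)); [calc|exact: oppr1_neq0].
apply: cnt_none => v /and3P[/eqP hA /eqP hB]; have [z0|z0] := eqVneq (v 0 2) 0.
  have ev := conic_infinity hA z0; rewrite {}ev; move: (v 0 0) => x.
  gv; rewrite cross_eq0 /ax1; coord => /and3P[/eqP h _ _].
  have -> : x = 0; last by rewrite scale0r.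
  apply: sqr_eq0; apply/eqP; move/eqP: h; rewrite -subr_eq0 => /eqP h; rewrite -oppr_eq0 -h.
  by apply/eqP; ring.
have ev := conic_param hA z0; move: hB; rewrite {1}ev qfZr; move: (v 0 1 / v 0 2) => s.
move=> /eqP; rewrite mulf_eq0 expf_eq0 (negPf z0) /= => /eqP hB _.
have sP : (2 < size P)%N.
  by apply: ltnW; apply: size_gt_coef; rewrite /P !coefE /= !mulr0 !addr0 oner_neq0.
case/eqP: (irr_noroot s irr3 sP); rewrite /P !(hornerD, hornerZ, hornerXn, hornerX, hornerC) -[RHS]hB; qv; coord; ring.
Qed.

(** The base points are the roots of the quartic.  A member of rank one would be
    c g^2 on the conic, with g of degree two, and g would divide the irreducible
    quartic. *)
Lemma sing_hat_4 (a4 b4 c4 d4 : F) :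
  irreducible_poly ('X^4 + a4 *: 'X^3 + b4 *: 'X^2 + c4 *: 'X + d4%:P) ->
  (q - 1) * sing_hat (uw F - vv F) (uu F + a4 *: uv F + b4 *: vv F + c4 *: vw F + d4 *: ww F) =
  (q - 1) * - q ^+ 4.
Proof.
set P := (X in irreducible_poly X) => irr4.
have sP : (4 < size P)%N.
  by apply: size_gt_coef; rewrite /P !coefE /= !mulr0 !addr0 oner_neq0.
apply: sing_hat_nopoint => //.
- by apply: (@not_all_singular1 _ _ 1); [calc|exact: oner_neq0].
- apply: rank1_count0; first by apply: (@adjf_entry _ 3 (- 1)); [calc|exact: oppr1_neq0].
  move=> t; apply/eqP => /(adjf0_sqf nz2)[c [p [p0 e]]].
  pose g := Poly [:: p 0 2; p 0 1; p 0 0].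
  have gE : g = (p 0 0)%:P * 'X^2 + (p 0 1)%:P * 'X + (p 0 2)%:P.
    by rewrite /g /= !cons_poly_def; ring.
  have /rowP e' := e.
  have := e' 0; have := e' 1; have := e' 2; have := e' 3; have := e' 4; have := e' 5.
  rewrite ?(uuE, uvE, uwE, vvE, vwE, wwE); coord => h5 h4 h3 h2 h1 h0.
  have p00 : p 0 0 != 0.
    apply/eqP => p00; have /eqP := oner_neq0 F; case; move: h0; rewrite p00 => h0.
    by transitivity (c * (0 * 0)); [rewrite -h0|]; ring.
  have sg : size g = 3%N.
    apply/eqP; rewrite eqn_leq size_Poly size_gt_coef //.
    by rewrite gE !coefE /= !(mulr0, mulr1, addr0).
  have Pg : P = c%:P * g * g.
    rewrite /P gE -!mul_polyC.
    have -> : a4 = c * (p 0 0 * p 0 1 + p 0 1 * p 0 0) by rewrite -h1; ring.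
    have -> : c4 = c * (p 0 1 * p 0 2 + p 0 2 * p 0 1) by rewrite -h4; ring.
    have -> : d4 = c * (p 0 2 * p 0 2) by rewrite -h5; ring.
    have -> : b4 = c * (p 0 0 * p 0 2 + p 0 2 * p 0 0) + c * (p 0 1 * p 0 1) by rewrite -h2 -h3; ring.
    have -> : 'X^4 = (c * (p 0 0 * p 0 0))%:P * 'X^4.
      by rewrite -h0 (_ : _ + _ = 1) ?mul1r //; ring.
    by rewrite !(rmorphD, rmorphM) /=; ring.
  have /(irr4.2 g) : size g != 1 by rewrite sg.
  by rewrite Pg dvdp_mull // => /(_ isT)/eqp_size; rewrite -Pg sg => es; rewrite -es in sP.
apply: cnt_none => v /and3P[/eqP hA /eqP hB _]; have [z0|z0] := eqVneq (v 0 2) 0.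
  have ev := conic_infinity hA z0; move: hB; rewrite {}ev; move: (v 0 0) => x.
  rewrite qfZr => h; have -> : x = 0; last by rewrite scale0r.
  by apply: sqr_eq0; rewrite -h; qv; rewrite /ax1; coord; ring.
have ev := conic_param hA z0; move: hB; rewrite {1}ev qfZr; move: (v 0 1 / v 0 2) => s.
move=> /eqP; rewrite mulf_eq0 expf_eq0 (negPf z0) /= => /eqP hB.
case/eqP: (irr_noroot s irr4 (ltnW (ltnW sP))); rewrite /P !(hornerD, hornerZ, hornerXn, hornerX, hornerC) -[RHS]hB; qv; coord; ring.
Qed.

(** * Representatives with a common linear factor *)

Lemma has_mul_ww p : p != 0 -> has_mul (ww F) p = (cross p ax3 == 0).
Proof.
have eW : ww F = sqf 1 ax3 by rewrite wwE /ax3; r6; ring.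
move=> p0; apply/existsP/eqP => [[a /eqP e]|].
  have [t ->] : exists t, p = t *: ax3.
    by apply: (@factor_of_sqf _ 1 ax3 a p); rewrite ?oner_neq0 ?ax3_neq0 // -e.
  by rewrite crossZl.
move=> /(cross0P ax3_neq0)[t pt]; have t0 : t != 0 by apply: contraNneq p0 => t0; rewrite pt t0 scale0r.
by exists (t^-1 *: ax3); rewrite pt eW; apply/eqP; r6; field.
Qed.

(** By unique factorization the factors of v w are the multiples of v and of w. *)
Lemma has_mul_vw p : p != 0 -> has_mul (vw F) p = (cross p ax2 == 0) || (cross p ax3 == 0).
Proof.
move=> p0; apply/existsP/orP => [[a]|].
  rewrite vwE => /eqP/rowP e; have := e 0; have := e 1; have := e 2; have := e 3.
  have := e 4; have := e 5; coord; move=> {e} h5 h4 h3 h2 h1 h0.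
  have [p1|p1] := eqVneq (p 0 1) 0.
    right; have p2 : p 0 2 != 0.
      by apply: contraTneq (oner_neq0 F) => p2; rewrite h4 p1 p2 !mul0r addr0 negbK.
    have a1 : a 0 1 != 0.
      by apply: contraTneq (oner_neq0 F) => a1; rewrite h4 p1 a1 mul0r mulr0 addr0 negbK.
    have p00 : p 0 0 = 0.
      by apply: (mulIf a1); rewrite mul0r [RHS]h1 p1 mul0r addr0.
    by rewrite cross_eq0 /ax3 p1 p00; zero.
  left; have a1 : a 0 1 = 0 by apply: (mulfI p1); rewrite mulr0 -h3.
  have a2 : a 0 2 != 0.
    by apply: contraTneq (oner_neq0 F) => a2; rewrite h4 a1 a2 !mulr0 addr0 negbK.
  have p2 : p 0 2 = 0 by apply: (mulIf a2); rewrite mul0r -h5.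
  have p00 : p 0 0 = 0.
    by apply: (mulIf a2); rewrite mul0r [RHS]h2 p2 mul0r addr0.
  by rewrite cross_eq0 /ax2 p2 p00; zero.
have T t r : p = t *: r -> t != 0.
  by move=> pt; apply: contraNneq p0 => t0; rewrite pt t0 scale0r.
case=> [/eqP/(cross0P ax2_neq0)|/eqP/(cross0P ax3_neq0)] [t pt]; have t0 := T _ _ pt.
  by exists (t^-1 *: ax3); rewrite pt vwE /ax3 /ax2; apply/eqP; r6; field.
by exists (t^-1 *: ax2); rewrite pt vwE /ax3 /ax2; apply/eqP; r6; field.
Qed.

Lemma has_mul_uw p : p != 0 -> cross p ax2 = 0 -> has_mul (uw F) p = false.
Proof.
move=> p0 /(cross0P ax2_neq0)[t pt]; have t0 : t != 0 by apply: contraNneq p0 => t0; rewrite pt t0 scale0r.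
have p00 : p 0 0 = 0 by rewrite pt /ax2; zero.
have p02 : p 0 2 = 0 by rewrite pt /ax2; zero.
apply/existsP => -[a]; rewrite uwE => /eqP/rowP e; have := e 2; coord.
by rewrite p00 p02 !mul0r addr0 => /eqP; rewrite oner_eq0.
Qed.

Lemma has_mul_uw3 p : p != 0 -> cross p ax3 = 0 -> has_mul (uw F) p.
Proof.
move=> p0 /(cross0P ax3_neq0)[t pt]; have t0 : t != 0 by apply: contraNneq p0 => t0; rewrite pt t0 scale0r.
apply/existsP; exists (t^-1 *: ax1).
by rewrite pt uwE /ax3 /ax1; apply/eqP; r6; field.
Qed.

Lemma has_mul0 p : has_mul (0 : 'rV[F]_6) p.
Proof. by apply/existsP; exists 0; rewrite lmul0r. Qed.

Lemma cnt_ax2 : \sum_(p | p != 0) (cross p ax2 == 0)%:R = q - 1.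
Proof. exact: cnt_line1 ax2_neq0 (fun v => line_iff v ax2_neq0). Qed.
Lemma cnt_ax3 : \sum_(p | p != 0) (cross p ax3 == 0)%:R = q - 1.
Proof. exact: cnt_line1 ax3_neq0 (fun v => line_iff v ax3_neq0). Qed.

Lemma ax2_ax3 p : p != 0 -> (cross p ax2 == 0) && (cross p ax3 == 0) = false.
Proof.
move=> p0; apply: contraNF p0 => /andP[]; rewrite !cross_eq0 /ax2 /ax3; zero.
rewrite ?mulr1 row3_eq0 => /and3P[/eqP <- _ /eqP ->] /and3P[/eqP -> _ _].
by rewrite eqxx.
Qed.

Lemma nb_sqf_ww p : p != 0 -> nb_sqf (ww F) p = (cross p ax3 == 0)%:R.
Proof.
have -> : ww F = sqf 1 ax3 by rewrite wwE /ax3; r6; ring.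
by move=> p0; rewrite nb_sqf_sqf ?oner_neq0 ?ax3_neq0.
Qed.

Lemma sing_hat_0 : (q - 1) * sing_hat 0 0 =
  (q - 1) * (q ^+ 11 + 2%:R * q ^+ 10 - q ^+ 9 - 2%:R * q ^+ 8
   - q ^+ 7 + 2%:R * q ^+ 6 + q ^+ 5 - q ^+ 4).
Proof.
rewrite sing_hatE.
have dz : (q - 1) * dbl_hat 0 0 = q ^+ 8 * (q ^+ 3 - 1) + q ^+ 6 * (q - 1 - (q ^+ 3 - 1)).
  rewrite dbl_hat_rank_le1 ?adjf0 //.
  have -> : sqdiv_count (0 : 'rV[F]_6) 0 = q ^+ 3 - 1.
    by rewrite -cnt_neq0; apply: eq_bigr => p p0; rewrite nb_quotE // has_mul0 nb_sqf0 // mulr1.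
  have -> // : zero_count (0 : 'rV[F]_6) 0 = q ^+ 3 - 1.
  by rewrite -cnt_neq0; apply: eq_bigr => p p0; rewrite qf0l eqxx.
under eq_bigr do rewrite scaler0 subr0 dz.
rewrite dz sumr_const -mulr_natl.
have -> : div_count (0 : 'rV[F]_6) 0 = q ^+ 3 - 1.
  by rewrite -cnt_neq0 div_countE; apply: eq_bigr => p p0; rewrite /common_divb !has_mul0.
have -> : ker_count (0 : 'rV[F]_6) 0 = q ^+ 3 - 1.
  by rewrite -cnt_neq0; apply: eq_bigr => p p0; rewrite /common_ker grad0l eqxx.
have -> : tangent_count (0 : 'rV[F]_6) 0 = q ^+ 3 - 1.
  rewrite -cnt_neq0; apply: eq_bigr => p p0; rewrite qf0l grad0l cross_eq0 !eqxx.
  by zero.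
ring.
Qed.

Lemma plane_ax3 (P : pred 'rV[F]_3) : (forall v, P v = (v 0 2 == 0)) ->
  \sum_(v | v != 0) (P v)%:R = q ^+ 2 - 1 :> K.
Proof.
move=> h; apply: (cnt_plane ax3_neq0) => v.
by rewrite h dot_ax3.
Qed.

Lemma sing_hat_D1sq : (q - 1) * sing_hat 0 (ww F) =
  (q - 1) * (q ^+ 9 - q ^+ 8 - 2%:R * q ^+ 7 + 2%:R * q ^+ 6 + q ^+ 5 - q ^+ 4).
Proof.
rewrite sing_hatE.
have Z : zero_count 0 (ww F) = q ^+ 2 - 1.
  by apply: plane_ax3 => v; qv; rewrite eqxx sqrf_eq0.
have d1 : (q - 1) * dbl_hat 0 (ww F) = q ^+ 8 * (q - 1) + q ^+ 6 * (q - 1 - (q ^+ 2 - 1)).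
  rewrite dbl_hat_rank_le1 ?adjf_ww // Z.
  have -> // : sqdiv_count 0 (ww F) = q - 1.
  by rewrite -cnt_ax3; apply: eq_bigr => p p0; rewrite nb_quotE // has_mul0 nb_sqf_ww // mul1r.
have d2 : (q - 1) * dbl_hat (ww F) 0 = q ^+ 8 * (q - 1) + q ^+ 6 * (q - 1 - (q ^+ 2 - 1)).
  rewrite dbl_hat_rank_le1 ?adjf0 // zero_countC Z.
  have -> // : sqdiv_count (ww F) 0 = q - 1.
  by rewrite -cnt_ax3; apply: eq_bigr => p p0; rewrite nb_quotE // has_mul_ww // nb_sqf0 // mulr1.
under eq_bigr do rewrite scaler0 subr0 d1.
rewrite d2 sumr_const -mulr_natl.
have -> : div_count 0 (ww F) = q - 1.
  by rewrite -cnt_ax3 div_countE; apply: eq_bigr => p p0; rewrite /common_divb has_mul0 has_mul_ww.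
have -> : ker_count 0 (ww F) = q ^+ 2 - 1.
  by apply: plane_ax3 => v; rewrite /common_ker; gv; rewrite eqxx row3_eq0; zero; rewrite /= mulf_eq0 (negPf nz2).
have -> : tangent_count 0 (ww F) = q ^+ 2 - 1.
  by apply: plane_ax3 => v; qv; gv; rewrite cross_eq0; zero; rewrite /= sqrf_eq0 andbT.
ring.
Qed.

Lemma cnt_vw : \sum_(p | p != 0) (has_mul (vw F) p)%:R = 2%:R * (q - 1) :> K.
Proof.
transitivity (\sum_(p | p != 0) (cross p ax2 == 0)%:R + \sum_(p | p != 0) (cross p ax3 == 0)%:R : K).
  rewrite -big_split; apply: eq_bigr => p p0; rewrite has_mul_vw //=.
  have := ax2_ax3 p0; case: (_ == 0); case: (_ == 0) => // _; rewrite ?addr0 ?add0r //.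
by rewrite cnt_ax2 cnt_ax3; ring.
Qed.

Lemma ker_count_vw A : (forall v, v 0 1 = 0 -> v 0 2 = 0 -> grad A v = 0) ->
  ker_count A (vw F) = q - 1.
Proof.
move=> h; apply: cnt_axis => v; rewrite /common_ker; gv; rewrite [row3 _ _ _ == 0]row3_eq0; coord; rewrite eqxx /=.
have [z0|] := eqVneq (v 0 2) 0; last by rewrite !andbF.
have [y0|] := eqVneq (v 0 1) 0; last by rewrite !andbF.
by rewrite h // eqxx.
Qed.

Lemma sing_hat_D11 : (q - 1) * sing_hat 0 (vw F) =
  (q - 1) * (2%:R * q ^+ 8 - 5%:R * q ^+ 7 + 3%:R * q ^+ 6 + q ^+ 5 - q ^+ 4).
Proof.
have av : adjf (vw F) != 0 by apply: (@adjf_entry _ 0 (- 1)); [calc|exact: oppr1_neq0].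
rewrite sing_hatE.
have Zc : \sum_(v : 'rV[F]_3 | v != 0) (v 0 1 * v 0 2 == 0)%:R = 2%:R * (q ^+ 2 - 1) - (q - 1) :> K.
  transitivity (\sum_(v : 'rV[F]_3 | v != 0) (v 0 1 == 0)%:R +
    \sum_(v : 'rV[F]_3 | v != 0) (v 0 2 == 0)%:R -
    \sum_(v : 'rV[F]_3 | v != 0) ((v 0 1 == 0) && (v 0 2 == 0))%:R : K).
    rewrite -big_split -sumrB; apply: eq_bigr => v _ /=; rewrite mulf_eq0.
    by case: (v 0 1 == 0); case: (v 0 2 == 0); rewrite /= ?addrK ?addr0 ?add0r ?subr0.
  have -> : \sum_(v : 'rV[F]_3 | v != 0) ((v 0 1 == 0) && (v 0 2 == 0))%:R = q - 1 :> K by apply: cnt_axis.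
  have -> : \sum_(v : 'rV[F]_3 | v != 0) (v 0 2 == 0)%:R = q ^+ 2 - 1 :> K by apply: plane_ax3.
  have -> : \sum_(v : 'rV[F]_3 | v != 0) (v 0 1 == 0)%:R = q ^+ 2 - 1 :> K.
    by apply: (cnt_plane ax2_neq0) => v; rewrite dot_ax2.
  by ring.
have Z : zero_count 0 (vw F) = 2%:R * (q ^+ 2 - 1) - (q - 1).
  by rewrite -Zc; apply: eq_bigr => v _; qv; rewrite eqxx.
have d2 : (q - 1) * dbl_hat (vw F) 0 = q ^+ 8 * (2%:R * (q - 1)) + q ^+ 6 * (q - 1 - (2%:R * (q ^+ 2 - 1) - (q - 1))).
  rewrite dbl_hat_rank_le1 ?adjf0 // zero_countC Z.
  have -> // : sqdiv_count (vw F) 0 = 2%:R * (q - 1).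
  by rewrite -cnt_vw; apply: eq_bigr => p p0; rewrite nb_quotE // nb_sqf0 // mulr1.
under eq_bigr do rewrite scaler0 subr0 (dbl_hat_rank_gt1 _ av) mulr0.
rewrite d2 big1 // add0r.
have -> : div_count 0 (vw F) = 2%:R * (q - 1).
  by rewrite -cnt_vw div_countE; apply: eq_bigr => p p0; rewrite /common_divb has_mul0.
rewrite ker_count_vw => [|v _ _]; last exact: grad0l.
have -> : tangent_count 0 (vw F) = 2%:R * (q ^+ 2 - 1) - (q - 1).
  by rewrite -Zc; apply: eq_bigr => v _; qv; gv; rewrite cross_eq0; zero; rewrite /= andbT.
ring.
Qed.

Lemma sing_hat_Cs : (q - 1) * sing_hat (ww F) (vw F) =
  (q - 1) * (q ^+ 8 - 3%:R * q ^+ 7 + 2%:R * q ^+ 6 + q ^+ 5 - q ^+ 4).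
Proof.
rewrite sing_hatE big1 => [|t _]; last first.
  rewrite dbl_hat_rank_gt1 ?mulr0 //.
  by apply: (@adjf_entry _ 0 (- 1)); [calc|exact: oppr1_neq0].
have M p : p != 0 -> has_mul (vw F) p && (cross p ax3 == 0) = (cross p ax3 == 0).
  by move=> p0; rewrite has_mul_vw //; case: (cross p ax3 == 0); rewrite ?orbT ?andbF.
rewrite dbl_hat_rank_le1 ?adjf_ww //.
have -> : sqdiv_count (vw F) (ww F) = q - 1.
  by rewrite -cnt_ax3; apply: eq_bigr => p p0; rewrite nb_quotE // nb_sqf_ww // -natrM mulnb M.
have -> : zero_count (vw F) (ww F) = q ^+ 2 - 1.
  apply: plane_ax3 => v; qv; rewrite sqrf_eq0.
  by have [->|] := eqVneq (v 0 2) 0; rewrite ?mulr0 ?eqxx ?andbF.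
have -> : div_count (ww F) (vw F) = q - 1.
  by rewrite -cnt_ax3 div_countE; apply: eq_bigr => p p0; rewrite /common_divb has_mul_ww // andbC M.
rewrite ker_count_vw => [|v y0 z0]; last by gv; rewrite z0 mulr0; r3.
have -> : tangent_count (ww F) (vw F) = q ^+ 2 - 1.
  apply: plane_ax3 => v; qv; gv; rewrite sqrf_eq0 cross_eq0.
  by have [->|] := eqVneq (v 0 2) 0; rewrite ?andbF //; zero.
ring.
Qed.

Lemma sing_hat_Cns : (q - 1) * sing_hat (vw F) (uw F) =
  (q - 1) * (- q ^+ 7 + q ^+ 6 + q ^+ 5 - q ^+ 4).
Proof.
have av : adjf (vw F) != 0 by apply: (@adjf_entry _ 0 (- 1)); [calc|exact: oppr1_neq0].
rewrite sing_hatE big1 => [|t _]; last first.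
  rewrite dbl_hat_rank_gt1 ?mulr0 //.
  by apply: (@adjf_entry _ 3 (- 1)); [calc|exact: oppr1_neq0].
rewrite (dbl_hat_rank_gt1 _ av).
have -> : div_count (vw F) (uw F) = q - 1.
  rewrite -cnt_ax3 div_countE; apply: eq_bigr => p p0; rewrite /common_divb has_mul_vw //.
  have [/eqP h|h] := boolP (cross p ax3 == 0); first by rewrite orbT has_mul_uw3.
  rewrite orbF; have [/eqP h'|//] := boolP (cross p ax2 == 0).
  by rewrite has_mul_uw.
have -> : ker_count (vw F) (uw F) = 0.
  apply: cnt_none => v; rewrite /common_ker; gv; rewrite !row3_eq0; coord.
  move=> /andP[/and3P[_ z0 y0] /and3P[_ _ x0]].
  by apply/eqP; rewrite row3_eq0 z0 y0 x0.
have -> : tangent_count (vw F) (uw F) = q ^+ 2 - 1.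
  apply: plane_ax3 => v; qv; gv; rewrite cross_eq0; coord.
  have [->|z0] := eqVneq (v 0 2) 0; first by zero.
  by rewrite ?mul0r !mulf_eq0 [0 == _]eq_sym mulf_eq0 (negPf z0) !andbF.
ring.
Qed.

End Transforms.

Local Open Scope complex_scope.

(** * The additive character of a finite field through its trace *)

Section AdditiveCharacter.
Variables (R : realType) (F : finFieldType) (p : nat) (charFp : p \in [pchar F]).
Hypothesis p_neq2 : p != 2%N.

Let p_pr : prime p := pcharf_prime charFp.
Let p_gt0 : (0 < p)%N := prime_gt0 p_pr.
Let pR0 : p%:R != 0 :> R. Proof. by rewrite pnatr_eq0 -lt0n. Qed.

Lemma two_neq0 : 2%:R != 0 :> F.
Proof.
apply: contra p_neq2 => h; have : 2%N \in [pchar F] by rewrite inE.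
by rewrite (pcharf_eq charFp) inE eq_sym.
Qed.

Let nz2 := two_neq0.

(** The character value attached to the integer lift k of an element of F_p. *)
Definition unit_root (k : nat) : R[i] :=
  cexp (2%:R * (pi : R)%:C * 'i%C * k%:R / p%:R).

Definition add_char (a : F) : R[i] := unit_root (val (Tr charFp a)).

Lemma unit_rootE k : unit_root k =
  cos (2%:R * pi * k%:R / p%:R) +i* sin (2%:R * pi * k%:R / p%:R).
Proof.
rewrite /unit_root.
have -> : 2%:R * (pi : R)%:C * 'i%C * k%:R / p%:R = 0 +i* (2%:R * pi * k%:R / p%:R) :> R[i].
  have E (n : nat) : n%:R = (n%:R)%:C :> R[i] by rewrite -(rmorph_nat (real_complex R)).
  rewrite (E 2%N) (E k) (E p) -fmorphV.
  by simpc; rewrite ?(mul0r, mulr0, addr0, subr0, add0r).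
rewrite /cexp /= expR0; simpc.
by rewrite ?(mul0r, subr0, addr0, mul1r).
Qed.

Lemma unit_rootD k m : unit_root (k + m) = unit_root k * unit_root m.
Proof.
rewrite !unit_rootE natrD !mulrDr mulrDl cosD sinD; simpc.
by congr (_ +i* _); rewrite addrC.
Qed.

Lemma unit_root0 : unit_root 0 = 1.
Proof. by rewrite unit_rootE mulr0 mul0r cos0 sin0. Qed.

Lemma unit_root_p : unit_root p = 1.
Proof.
by rewrite unit_rootE mulfK // mulr_natl cos2pi sin2pi.
Qed.

Lemma unit_rootM k m : unit_root (k * m) = unit_root k ^+ m.
Proof.
elim: m => [|m IH]; first by rewrite muln0 unit_root0.
by rewrite mulnS unit_rootD IH exprS.
Qed.

Lemma unit_root_mod k : unit_root (k %% p) = unit_root k.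
Proof.
by rewrite {2}(divn_eq k p) unit_rootD mulnC unit_rootM unit_root_p expr1n mul1r.
Qed.

(** Its real part cos (2 pi / p) is not 1, because p > 2 puts the angle in ]0, pi]. *)
Lemma unit_root1 : unit_root 1 != 1.
Proof.
have p3 : (2 < p)%N by rewrite ltn_neqAle eq_sym p_neq2 prime_gt1.
rewrite unit_rootE; apply/eqP => -[/= c1 _].
have : 2%:R * pi * 1%:R / p%:R = 0 :> R.
  apply: cos_inj; rewrite ?cos0 // !in_itv /= ?lexx ?pi_ge0 //.
  have pi0 := pi_gt0 R.
  rewrite mulr1; apply/andP; split.
    by rewrite divr_ge0 ?ler0n // mulr_ge0 ?pi_ge0 ?ler0n.
  rewrite ler_pdivrMr ?ltr0n // mulrC ler_pM2l //.
  by rewrite ler_nat ltnW.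
move/eqP; rewrite mulr1 !mulf_eq0 invr_eq0 (negPf pR0) pnatr_eq0 /=.
by rewrite orbF (gt_eqF (pi_gt0 R)).
Qed.

Let L := pPrimeCharType charFp.

Lemma TrD a b : Tr charFp (a + b) = Tr charFp a + Tr charFp b.
Proof.
apply: (fmorph_inj (in_alg L)).
rewrite rmorphD /= !(TrE charFp).
exact: (raddfD (galTrace 1%AS {: L})).
Qed.

(** The automorphisms in the Galois group are linearly independent. *)
Lemma Tr_neq0 : exists a, Tr charFp a != 0.
Proof.
have [a _] := @gal_independent_contra _ L {: L}%AS [in 'Gal({: L} / 1%AS)%g] (fun=> 1) _
  (group1 _) (oner_neq0 L).
under eq_bigr do rewrite mul1r.
move=> h; exists a; apply: contraNneq h => Ta0.
have := TrE charFp a; rewrite Ta0 scale0r /galTrace => h.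
exact/eqP/esym.
Qed.

Lemma add_charD : {morph add_char : x y / x + y >-> x * y}.
Proof.
move=> x y; rewrite /add_char TrD -unit_rootD -[RHS]unit_root_mod; congr unit_root.
by rewrite /=; congr (_ %% _)%N; apply: Fp_cast.
Qed.

Lemma add_char0 : add_char 0 = 1.
Proof.
have T0 : Tr charFp 0 = 0 by apply: (addrI (Tr charFp 0)); rewrite -TrD !addr0.
by rewrite /add_char T0 unit_root0.
Qed.

(** The image of the trace is additive and not zero, so it contains 1. *)
Lemma add_char_nontriv : exists x, add_char x != 1.
Proof.
have [a Ta] := Tr_neq0.
have TM n : Tr charFp (a *+ n) = Tr charFp a *+ n.
  elim: n => [|n IH]; last by rewrite !mulrS TrD IH.
  by rewrite !mulr0n; apply: (addrI (Tr charFp 0)); rewrite -TrD !addr0.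
(* A multiple of a has trace 1. *)
exists (a *+ val (Tr charFp a)^-1); rewrite /add_char TM.
have -> : Tr charFp a *+ val (Tr charFp a)^-1 = 1.
  by rewrite -mulr_natr natr_Zp mulfV.
exact: unit_root1.
Qed.

Lemma fourier_Psi (y : V F) :
  fourier charFp (@Psi R F) y = #|F|%:R ^- 12 *
    hat2 add_char (fun A B => (pencil_disc A B == 0)%:R) y.1 y.2.
Proof.
rewrite /fourier /hat2; congr (_ * _); rewrite pair_big; apply: eq_bigr => -[A B] _ /=.
by rewrite /Psi /singular /Disc (bcubic_disc_resolvent nz2) -add_charD.
Qed.

(** Substituting x by the transposed action turns the transform at g y into the one
    at y, since the singular set is stable. *)
Lemma fourier_orbit (x y : V F) : x \in Gorbit y ->
  fourier charFp (@Psi R F) x = fourier charFp (@Psi R F) y.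
Proof.
move=> /imsetP[g _ ->]; rewrite GactE /fourier; congr (_ * _).
set N := (GLval g.1)^T; set M := (GLval g.2)^T.
have dN : \det N != 0 by rewrite det_tr; have := GL_det g.1.
have dM : \det M != 0 by rewrite det_tr; have := GL_det g.2.
rewrite [RHS](reindex_inj (mx_act_inj nz2 dN dM)) /=; apply: eq_bigr => z _.
have -> : Psi R (mx_act N M z) = Psi R z.
  congr (nat_of_bool _)%:R; rewrite /singular /Disc.
  have -> : bcubic_disc (resolvent (mx_act N M z)) = pencil_disc (mx_act N M z).1 (mx_act N M z).2.
    exact: bcubic_disc_resolvent nz2 _.
  by rewrite (pencil_disc_mx_act nz2 _ dN dM) (bcubic_disc_resolvent nz2 z).
by rewrite (pairing_mx_act nz2 N M z y) /N /M !trmxK.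
Qed.

End AdditiveCharacter.

(** * Values on the orbits *)

Lemma fourier_value (R : realType) (F : finFieldType) (p : nat)
    (charFp : p \in [pchar F]) (p_neq2 : p != 2%N) (x y : V F) (E : R[i]) :
  x \in Gorbit y ->
  (#|F|%:R - 1) * sing_hat (add_char R charFp) y.1 y.2 = (#|F|%:R - 1) * E ->
  fourier charFp (@Psi R F) x = #|F|%:R ^- 12 * E.
Proof.
move=> xy /(mulfI (qB1_neq0 F R[i])) e.
rewrite (@fourier_orbit R F p charFp p_neq2 x y xy) (@fourier_Psi R F p charFp p_neq2).
by rewrite -e.
Qed.

Unset Implicit Arguments.

Theorem theorem2 (R : realType) (F : finFieldType) (p : nat)
    (charFp : p \in [pchar F]) (p_neq2 : p != 2%N)
    (l : F) (l_neq0 : l != 0) (l_nonsquare : forall y : F, y ^+ 2 != l)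
    (a3 b3 c3 : F)
    (irr3 : irreducible_poly ('X^3 + a3 *: 'X^2 + b3 *: 'X + c3%:P))
    (a4 b4 c4 d4 : F)
    (irr4 : irreducible_poly
              ('X^4 + a4 *: 'X^3 + b4 *: 'X^2 + c4 *: 'X + d4%:P)) :
  let q : R[i] := #|F|%:R in
  let Psi_hat : V F -> R[i] := fourier charFp (@Psi R F) in
  forall x : V F,
  (x \in O_0 F ->
     Psi_hat x = q ^- 1 + 2%:R * q ^- 2 - q ^- 3 - 2%:R * q ^- 4 - q ^- 5
                 + 2%:R * q ^- 6 + q ^- 7 - q ^- 8) /\
  (x \in O_D1sq F ->
     Psi_hat x = q ^- 3 - q ^- 4 - 2%:R * q ^- 5 + 2%:R * q ^- 6
                 + q ^- 7 - q ^- 8) /\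
  (x \in O_D11 F ->
     Psi_hat x = 2%:R * q ^- 4 - 5%:R * q ^- 5 + 3%:R * q ^- 6
                 + q ^- 7 - q ^- 8) /\
  (x \in O_Cs F ->
     Psi_hat x = q ^- 4 - 3%:R * q ^- 5 + 2%:R * q ^- 6 + q ^- 7 - q ^- 8) /\
  (x \in O_D2 l :|: O_Dns F :|: O_Cns F :|: O_B11 F :|: O_B2 l ->
     Psi_hat x = - q ^- 5 + q ^- 6 + q ^- 7 - q ^- 8) /\
  (x \in O_1sq_1sq F ->
     Psi_hat x = - q ^- 6 + 2%:R * q ^- 7 - q ^- 8) /\
  (x \in O_2sq l ->
     Psi_hat x = q ^- 6 - q ^- 8) /\
  (x \in O_1p4 F :|: O_1p3_1 F :|: O_1sq_11 F :|: O_1sq_2 l ->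
     Psi_hat x = q ^- 7 - q ^- 8) /\
  (x \in O_1111 F :|: O_112 l :|: O_22 l :|: O_13 a3 b3 c3 :|: O_4 a4 b4 c4 d4 ->
     Psi_hat x = - q ^- 8).
Proof.
move=> q Psi_hat x.
have q0 : q != 0 := q_neq0 F R[i].
have h2 : 2%:R != 0 :> F := two_neq0 charFp p_neq2.
pose ch := add_char R charFp.
have cD : {morph ch : x y / x + y >-> x * y} := @add_charD R F p charFp.
have c0 : ch 0 = 1 := @add_char0 R F p charFp.
have cN : exists x, ch x != 1 := @add_char_nontriv R F p charFp p_neq2.
have val y E E' : (q - 1) * sing_hat ch y.1 y.2 = (q - 1) * E -> q ^- 12 * E = E' ->
    x \in Gorbit y -> Psi_hat x = E'.
  by move=> e <- xy; apply: fourier_value xy _.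
split; first by apply: val => /=; [exact: sing_hat_0|field].
split; first by apply: val => /=; [exact: sing_hat_D1sq|field].
split; first by apply: val => /=; [exact: sing_hat_D11|field].
split; first by apply: val => /=; [exact: sing_hat_Cs|field].
have vEE : q ^- 12 * (- q ^+ 7 + q ^+ 6 + q ^+ 5 - q ^+ 4) = - q ^- 5 + q ^- 6 + q ^- 7 - q ^- 8.
  by field.
split.
  rewrite !in_setU => /orP[/orP[/orP[/orP[]|]|]|]; apply: val vEE => /=.
  - exact: sing_hat_D2.
  - exact: sing_hat_Dns.
  - exact: sing_hat_Cns.
  - exact: sing_hat_B11.
  - exact: sing_hat_B2.
split; first by apply: val => /=; [exact: sing_hat_1sq_1sq|field].
split; first by apply: val => /=; [exact: sing_hat_2sq|field].
have v1 : q ^- 12 * (q ^+ 5 - q ^+ 4) = q ^- 7 - q ^- 8 by field.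
split.
  rewrite !in_setU => /orP[/orP[/orP[]|]|]; apply: val v1 => /=.
  - exact: sing_hat_1p4.
  - exact: sing_hat_1p3_1.
  - exact: sing_hat_1sq_11.
  - exact: sing_hat_1sq_2.
have v0 : q ^- 12 * - q ^+ 4 = - q ^- 8 by field.
rewrite !in_setU => /orP[/orP[/orP[/orP[]|]|]|]; apply: val v0 => /=.
- exact: sing_hat_1111.
- exact: sing_hat_112.
- exact: sing_hat_22.
- exact: sing_hat_13.
- exact: sing_hat_4.
Qed.
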